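(* The concordance group $\mathscr{VC}$ of long virtual knots is not abelian.
   Context: A long virtual knot diagram is a proper generic immersion of the interval $I=[0,1]$ into the rectangle $[0,1]\times[0,2]$ sending $0\mapsto(0,1)$ and $1\mapsto(1,1)$, oriented from left to right, whose transverse double points are each marked as a classical crossing (with over/under information) or as a virtual crossing. Diagrams are considered up to planar isotopy fixing the endpoints, the Reidemeister moves $\Omega1,\Omega2,\Omega3$, and the detour move (an arc containing only virtual crossings may be replaced by any other generic arc with the same endpoints, all of whose new crossings are marked virtual). Two long virtual knots are concordant if there is a finite sequence of Reidemeister moves, detour moves, births (adding a disjoint crossing-free circle), deaths (deleting a disjoint crossing-free circle) and saddles (oriented band surgeries) from one to the other, such that the sequence is connected (the cobordism surface it describes is connected) and $\#(\text{births})-\#(\text{saddles})+\#(\text{deaths})=0$. The concatenation $\vec K\#\vec K^*$ is formed by placing $\vec K^*$ to the right of $\vec K$ and rescaling the $x$-coordinate by $1/2$. The group $\mathscr{VC}$ is the set of concordance classes of long virtual knots with the operation induced by concatenation; its identity is the class of the trivial (crossing-free) long virtual knot, and this operation is known to define a group. *)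

(* Defs.v *)
From HB Require Import structures.
From Stdlib Require Import Relation_Operators.
From mathcomp Require Import all_boot all_order all_algebra.
From mathcomp Require Import generic_quotient.
From mathcomp Require Import ring lra.
From mathcomp Require Import all_classical all_reals topology normedtype.

Set Implicit Arguments.
Unset Strict Implicit.
Unset Printing Implicit Defensive.

Import Order.TTheory GRing.Theory Num.Theory.
Import numFieldNormedType.Exports.

Local Open Scope classical_set_scope.
Local Open Scope ring_scope.
Local Open Scope quotient_scope.

(* Diagrams are taken in the piecewise linear category: the immersed curves are
   polygons, given by their lists of vertices.  In this category concatenating
   two long knots and rescaling needs no smoothing at the junction. *)
Section Diagrams.
Variable R : realType.

Notation pt := (R * R)%type.
Notation edge := (pt * pt)%type.

Definition on_edge (e : edge) (s : R) : pt :=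
  ((1 - s) * e.1.1 + s * e.2.1, (1 - s) * e.1.2 + s * e.2.2).

Definition dir (e : edge) : pt := (e.2.1 - e.1.1, e.2.2 - e.1.2).

Definition wedge (u v : pt) : R := u.1 * v.2 - u.2 * v.1.

Definition cross (e f : edge) : Prop :=
  e != f /\
  exists s t, [/\ 0 < s < 1, 0 < t < 1 & on_edge e s = on_edge f t].

Definition path_edges (l : seq pt) : seq edge := zip l (behead l).
Definition loop_edges (l : seq pt) : seq edge := zip l (rot 1 l).

Definition edges_of (l : seq pt) (ls : seq (seq pt)) : seq edge :=
  path_edges l ++ flatten (map loop_edges ls).

Definition in_rect (p : pt) : Prop := 0 < p.1 < 1 /\ 0 < p.2 < 2.

Definition ptL : pt := (0, 1).
Definition ptR : pt := (1, 1).

(* A generic proper immersion of an interval, with list of vertices [l], and of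
   finitely many circles, with cyclic lists of vertices [ls].
   Uniqueness of the vertices together with the conditions on pairs of edges
   says that the polygonal map is locally injective and that its multiple
   points are transverse and away from the vertices. *)
Definition generic (l : seq pt) (ls : seq (seq pt)) : Prop :=
  [/\ exists m, l = ptL :: rcons m ptR,
      uniq (l ++ flatten ls) /\ (forall c, c \in ls -> (2 < size c)%N),
      forall v, v \in l ++ flatten ls -> [\/ v = ptL, v = ptR | in_rect v],
      forall e f s t, e \in edges_of l ls -> f \in edges_of l ls -> e != f ->
        0 <= s <= 1 -> 0 <= t <= 1 -> on_edge e s = on_edge f t ->
        [\/ [/\ 0 < s < 1, 0 < t < 1 & wedge (dir e) (dir f) != 0],
            s = 1 /\ t = 0 | s = 0 /\ t = 1]
    & forall e f g s t u, e \in edges_of l ls -> f \in edges_of l ls ->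
        g \in edges_of l ls -> uniq [:: e; f; g] ->
        0 < s < 1 -> 0 < t < 1 -> 0 < u < 1 ->
        ~ (on_edge e s = on_edge f t /\ on_edge f t = on_edge g u)].

Inductive marking := Over | Under | Virtual.

Definition flip (m : marking) : marking :=
  match m with Over => Under | Under => Over | Virtual => Virtual end.

(* [mark D e f] is the status of the strand [e] at its crossing with [f];
   its values on pairs of edges of [D] that do not cross are irrelevant. *)
Record diagram := Diagram {
  long : seq pt;
  loops : seq (seq pt);
  mark : edge -> edge -> marking }.

Definition edges (D : diagram) : seq edge := edges_of (long D) (loops D).
Definition vertices (D : diagram) : seq pt := long D ++ flatten (loops D).

Definition wf (D : diagram) : Prop :=
  generic (long D) (loops D) /\
  forall e f, e \in edges D -> f \in edges D -> cross e f ->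
    mark D f e = flip (mark D e f).

Definition same_marks (D D' : diagram) (E : seq edge) : Prop :=
  forall e f, e \in E -> f \in E -> cross e f -> mark D e f = mark D' e f.

Definition mapE (g : pt -> pt) (e : edge) : edge := (g e.1, g e.2).

(* A path of generic diagrams, described by the motion [g t] of the vertices.
   Genericity pins the endpoints to [ptL] and [ptR] at all times. *)
Definition isotopy (D D' : diagram) : Prop :=
  exists g : R -> pt -> pt,
  [/\ forall v, g 0 v = v,
      forall v, v \in vertices D ->
        {within `[0, 1], continuous (fun t : R => g t v)},
      forall t, 0 <= t <= 1 ->
        generic (map (g t) (long D)) (map (map (g t)) (loops D)) /\
        forall e f, e \in edges D -> f \in edges D ->
          (cross (mapE (g t) e) (mapE (g t) f) <-> cross e f),
      long D' = map (g 1) (long D) /\ loops D' = map (map (g 1)) (loops D)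
    & forall e f, e \in edges D -> f \in edges D -> cross e f ->
        mark D' (mapE (g 1) e) (mapE (g 1) f) = mark D e f].

(* Same plane curves, with the closed components listed in another order or
   from other starting vertices. *)
Definition relisting (D D' : diagram) : Prop :=
  perm_eq (edges D) (edges D') /\ same_marks D D' (edges D).

Definition subdivision (D D' : diagram) : Prop :=
  exists E0 e s, let c := on_edge e s in
  [/\ 0 < s < 1,
      perm_eq (edges D) (e :: E0),
      perm_eq (edges D') [:: (e.1, c), (c, e.2) & E0],
      same_marks D D' E0
    & forall e' f, e' \in [:: (e.1, c); (c, e.2)] -> f \in E0 ->
        cross e' f -> mark D' e' f = mark D e f].

(* A chart carries the square [-1,1]^2, in which the local pictures are drawn,
   onto a parallelogram in the rectangle; it may reverse the orientation of the
   plane, so that each local picture also stands for its mirror image with the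
   same over/under data. *)
Definition chart (f : pt -> pt) : Prop :=
  (exists p u v, wedge u v != 0 /\
     forall q, f q = (p.1 + q.1 * u.1 + q.2 * v.1, p.2 + q.1 * u.2 + q.2 * v.2))
  /\ forall q, -1 <= q.1 <= 1 -> -1 <= q.2 <= 1 -> in_rect (f q).

Definition strand_edges (S : seq (seq pt)) : seq edge :=
  flatten (map path_edges S).

Definition outside (f : pt -> pt) (E0 : seq edge) : Prop :=
  forall e s q, e \in E0 -> 0 <= s <= 1 -> on_edge e s = f q ->
    ~ (-1 < q.1 < 1 /\ -1 < q.2 < 1).

Definition surgery (f : pt -> pt) (E0 : seq edge) (A B : seq (seq pt))
    (D D' : diagram) : Prop :=
  [/\ chart f,
      perm_eq (edges D) (E0 ++ map (mapE f) (strand_edges A)),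
      perm_eq (edges D') (E0 ++ map (mapE f) (strand_edges B)),
      outside f E0
    & same_marks D D' E0].

Definition orient (b : bool) (l : seq pt) : seq pt := if b then rev l else l.

(* The [i]-th strand of the local picture lies at height [h i]. *)
Definition layered (h : nat -> nat) (f : pt -> pt) (S : seq (seq pt))
    (D : diagram) : Prop :=
  forall i j e e', e \in path_edges (nth [::] S i) ->
    e' \in path_edges (nth [::] S j) -> cross e e' ->
    mark D (mapE f e) (mapE f e') = if (h j < h i)%N then Over else Under.

Definition reidemeister1 (D D' : diagram) : Prop :=
  exists f E0 b,
  let A := [:: orient b [:: (-1, 0); (1, 0)]] in
  let B := [:: orient b [:: (-1, 0); (2^-1, 2^-1); (- 2^-1, 2^-1); (1, 0)]] in
  surgery f E0 A B D D' /\
  forall e e', e \in strand_edges B -> e' \in strand_edges B -> cross e e' ->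
    mark D' (mapE f e) (mapE f e') <> Virtual.

Definition reidemeister2 (D D' : diagram) : Prop :=
  exists f E0 b b' h,
  let a := orient b [:: (-1, - 2^-1); (1, - 2^-1)] in
  let A := [:: a; orient b' [:: (-1, 2^-1); (1, 2^-1)]] in
  let B := [:: a; orient b' [:: (-1, 2^-1); (0, - (3 / 4)); (1, 2^-1)]] in
  [/\ injective h, surgery f E0 A B D D' & layered h f B D'].

Definition reidemeister3 (D D' : diagram) : Prop :=
  exists f E0 b b' b'' h,
  let S x := [:: orient b [:: (-1, - 2^-1); (1, 2^-1)];
                 orient b' [:: (-1, 2^-1); (1, - 2^-1)];
                 orient b'' [:: (0, -1); (x, 0); (0, 1)]] in
  [/\ injective h, surgery f E0 (S 2^-1) (S (- 2^-1)) D D',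
      layered h f (S 2^-1) D & layered h f (S (- 2^-1)) D'].

Definition all_virtual (D : diagram) (P : seq edge) : Prop :=
  forall e e', e \in P -> e' \in edges D -> cross e e' -> mark D e e' = Virtual.

Definition detour (D D' : diagram) : Prop :=
  exists E0 a b u u',
  let P := path_edges (a :: rcons u b) in
  let P' := path_edges (a :: rcons u' b) in
  [/\ a != b,
      perm_eq (edges D) (E0 ++ P) /\ all_virtual D P,
      perm_eq (edges D') (E0 ++ P') /\ all_virtual D' P'
    & same_marks D D' E0].

Definition birth (D D' : diagram) : Prop :=
  exists l,
  [/\ long D' = long D, loops D' = l :: loops D,
      forall e f, e \in loop_edges l -> f \in edges D' -> ~ cross e f
    & same_marks D D' (edges D)].

Definition saddle (D D' : diagram) : Prop :=
  exists f E0,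
  surgery f E0
    [:: [:: (-1, - 2^-1); (1, - 2^-1)]; [:: (1, 2^-1); (-1, 2^-1)]]
    [:: [:: (-1, - 2^-1); (- 2^-1, 0); (-1, 2^-1)];
        [:: (1, 2^-1); (2^-1, 0); (1, - 2^-1)]] D D'.

Definition rewriting (D D' : diagram) : Prop :=
  [\/ relisting D D' \/ subdivision D D',
      reidemeister1 D D', reidemeister2 D D' | reidemeister3 D D' \/ detour D D'].

Inductive kind := Isotopy | Rewriting | Birth | Death | Saddle.

Definition is_birth k := if k is Birth then true else false.
Definition is_death k := if k is Death then true else false.
Definition is_saddle k := if k is Saddle then true else false.

Definition move (k : kind) (D D' : diagram) : Prop :=
  match k with
  | Isotopy => isotopy D D' \/ isotopy D' D
  | Rewriting => rewriting D D' \/ rewriting D' D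
  | Birth => birth D D'
  | Death => birth D' D
  | Saddle => saddle D D' \/ saddle D' D
  end.

Definition ncomp (D : diagram) : nat := (size (loops D)).+1.
Definition comp (D : diagram) (c : nat) : seq pt :=
  nth [::] (long D :: loops D) c.

(* The component [c] of [D] and the component [c'] of [D'] bound a common
   component of the trace of a move.  An isotopy keeps the numbering of the
   components.  Any other move fixes some vertex of each component, apart from
   the circle of a birth or death, and a vertex of [D] that is also one of [D']
   lies on the same component of the trace in both. *)
Definition linked (k : kind) (D D' : diagram) (c c' : nat) : Prop :=
  match k with
  | Isotopy => c = c'
  | _ => exists2 v, v \in comp D c & v \in comp D' c'
  end.

Definition trace (N : nat) (k : nat -> kind) (D : nat -> diagram)
    (x y : nat * nat) : Prop :=
  [/\ (x.1 < N)%N, y.1 = x.1.+1 & linked (k x.1) (D x.1) (D y.1) x.2 y.2].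

(* The nodes [(i, c)] are the components of the successive diagrams; the
   cobordism surface is the union of the traces of its moves. *)
Definition connected_movie N k D : Prop :=
  forall i c, (i <= N)%N -> (c < ncomp (D i))%N ->
    clos_refl_sym_trans _ (trace N k D) (0%N, 0%N) (i, c).

Definition count_moves (P : kind -> bool) (N : nat) (k : nat -> kind) : nat :=
  \sum_(i < N) P (k i).

Definition concordant (D D' : diagram) : Prop :=
  exists N (k : nat -> kind) (M : nat -> diagram),
  [/\ M 0%N = D /\ M N = D',
      forall i, (i <= N)%N -> wf (M i),
      forall i, (i < N)%N -> move (k i) (M i) (M i.+1),
      connected_movie N k M
    & (count_moves is_birth N k)%:Z - (count_moves is_saddle N k)%:Z
      + (count_moves is_death N k)%:Z = 0].


Lemma crst_map (A B : Type) (T : A -> A -> Prop) (T' : B -> B -> Prop)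
    (phi : A -> B) :
  (forall x y, T x y -> clos_refl_sym_trans _ T' (phi x) (phi y)) ->
  forall x y, clos_refl_sym_trans _ T x y ->
    clos_refl_sym_trans _ T' (phi x) (phi y).
Proof.
move=> H x y; elim=> {x y} [x y /H //|x|x y _|x y z _ IH1 _ IH2].
- exact: rst_refl.
- exact: rst_sym.
- exact: rst_trans IH1 IH2.
Qed.

Definition rev_kind k :=
  match k with Birth => Death | Death => Birth | _ => k end.

Lemma move_sym k D D' : move k D D' -> move (rev_kind k) D' D.
Proof. by case: k => //= -[]; by [left | right]. Qed.

Lemma linked_sym k D D' c c' : linked k D D' c c' -> linked (rev_kind k) D' D c' c.
Proof. by case: k => //= -[v]; exists v. Qed.

Lemma concordant_refl D : wf D -> loops D = [::] -> concordant D D.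
Proof.
move=> wfD lD; exists 0%N, (fun _ => Isotopy), (fun _ => D); split=> //.
  move=> i c; rewrite leqn0 /ncomp lD => /eqP-> /=.
  by case: c => // _; exact: rst_refl.
by rewrite /count_moves !big_ord0.
Qed.

Lemma concordant_sym D D' : concordant D D' -> concordant D' D.
Proof.
move=> [N [k [M [[M0 MN] wfM mvM conM cnt]]]].
exists N, (fun i => rev_kind (k (N - i.+1)%N)), (fun i => M (N - i)%N).
split=> //; first by rewrite subn0 subnn.
- by move=> i _; apply: wfM; rewrite leq_subr.
- move=> i ltiN; apply: move_sym; rewrite -[in X in move _ _ (M X)]subSS.
  by rewrite subSn //; apply: mvM; rewrite -subSn // subSS leq_subr.
- have step x y : trace N k M x y -> clos_refl_sym_trans _
      (trace N (fun i => rev_kind (k (N - i.+1)%N)) (fun i => M (N - i)%N))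
      ((N - x.1)%N, x.2) ((N - y.1)%N, y.2).
    case: x y => [i c] [j c'] [/= ltiN -> lk]; apply: rst_sym; apply: rst_step.
    split=> /=; first by rewrite ltn_subrL /=; exact: leq_ltn_trans ltiN.
      by rewrite -subSn // subSS.
    rewrite -subSn // subSS !subKn //; last exact: ltnW.
    exact: linked_sym.
  move=> i c leiN ltc.
  apply: (rst_trans _ _ _ ((N - 0)%N, 0%N)); last first.
    have := crst_map step (conM (N - i)%N c _ ltc).
    by rewrite leq_subr /= subKn //; apply.
  have := crst_map step (conM N 0%N (leqnn N) (ltn0Sn _)).
  by rewrite /= subnn; exact: rst_sym.
- have rv P Q : (forall x, P (rev_kind x) = Q x) ->
      count_moves P N (fun i => rev_kind (k (N - i.+1)%N)) = count_moves Q N k.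
    move=> PQ; rewrite /count_moves [RHS](reindex_inj rev_ord_inj) /=.
    by apply: eq_bigr => i _; rewrite PQ.
  rewrite (rv is_birth is_death); last by case.
  rewrite (rv is_saddle is_saddle); last by case.
  by rewrite (rv is_death is_birth); [rewrite -cnt; ring | case].
Qed.

Lemma concordant_trans D1 D2 D3 :
  concordant D1 D2 -> concordant D2 D3 -> concordant D1 D3.
Proof.
move=> [N [k [M [[M0 MN] wfM mvM conM cnt]]]].
move=> [N' [k' [M' [[M'0 M'N] wfM' mvM' conM' cnt']]]].
pose kk i := if (i < N)%N then k i else k' (i - N)%N.
pose MM i := if (i < N)%N then M i else M' (i - N)%N.
have MM1 i : (i <= N)%N -> MM i = M i.
  rewrite /MM; case: ltngtP => // -> _.
  by rewrite subnn M'0 MN.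
have MM2 i : MM (N + i)%N = M' i.
  by rewrite /MM ltnNge leq_addr /= addKn.
have kk1 i : (i < N)%N -> kk i = k i by rewrite /kk => ->.
have kk2 i : kk (N + i)%N = k' i by rewrite /kk ltnNge leq_addr /= addKn.
exists (N + N')%N, kk, MM; split.
- by rewrite MM1 // M0 MM2.
- move=> i lei; have [leiN|ltNi] := leqP i N; first by rewrite MM1 //; exact: wfM.
  by rewrite -(subnKC (ltnW ltNi)) MM2; apply: wfM'; rewrite leq_subLR.
- move=> i lti; have [ltiN|leNi] := ltnP i N.
    by rewrite !MM1 ?(ltnW ltiN) // kk1 //; exact: mvM.
  rewrite -(subnKC leNi) -addnS !MM2 kk2; apply: mvM'.
  by rewrite ltn_subLR.
- have step1 x y : trace N k M x y ->
      clos_refl_sym_trans _ (trace (N + N') kk MM) x y.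
    case: x y => [i c] [j c'] [/= ltiN -> lk]; apply: rst_step; split=> //=.
      exact: ltn_addr.
    by rewrite !MM1 ?(ltnW ltiN) // kk1.
  have step2 x y : trace N' k' M' x y ->
      clos_refl_sym_trans _ (trace (N + N') kk MM)
        ((N + x.1)%N, x.2) ((N + y.1)%N, y.2).
    case: x y => [i c] [j c'] [/= ltiN -> lk]; apply: rst_step; split=> //=.
    - by rewrite ltn_add2l.
    - by rewrite addnS.
    - by rewrite !MM2 kk2.
  have up1 := crst_map (phi := id) step1.
  move=> i c lei ltc; have [leiN|ltNi] := leqP i N.
    by apply: up1; apply: conM => //; rewrite -MM1.
  apply: (rst_trans _ _ _ (N, 0%N)); first by apply: up1; exact: conM.
  have eqi : i = (N + (i - N))%N by rewrite subnKC // ltnW.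
  rewrite eqi; have := crst_map step2 (conM' (i - N)%N c _ _).
  rewrite /= addn0; apply; first by rewrite leq_subLR.
  by rewrite -MM2 -eqi.
- have cat P : count_moves P (N + N') kk = (count_moves P N k + count_moves P N' k')%N.
    rewrite /count_moves big_split_ord /=; congr addn; apply: eq_bigr => i _.
      by rewrite kk1.
    by rewrite kk2.
  rewrite !cat !PoszD -[RHS]addr0 -{1}cnt -cnt'; ring.
Qed.

Definition squeeze (c : R) (q : pt) : pt := (q.1 / 2 + c, q.2).
Definition unsqueeze (c : R) (q : pt) : pt := ((q.1 - c) * 2, q.2).

Definition cat_long (l l' : seq pt) : seq pt :=
  map (squeeze 0) l ++ behead (map (squeeze 2^-1) l').

Definition concat (D E : diagram) : diagram :=
  Diagram (cat_long (long D) (long E))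
    (map (map (squeeze 0)) (loops D) ++ map (map (squeeze 2^-1)) (loops E))
    (fun e f => if e.1.1 < 2^-1
                then mark D (mapE (unsqueeze 0) e) (mapE (unsqueeze 0) f)
                else mark E (mapE (unsqueeze 2^-1) e) (mapE (unsqueeze 2^-1) f)).

Lemma squeezeK c : cancel (squeeze c) (unsqueeze c).
Proof. by case=> x y; rewrite /squeeze /unsqueeze /=; congr pair; field. Qed.

Lemma squeeze_inj c : injective (squeeze c).
Proof. exact: can_inj (squeezeK c). Qed.

Lemma mapEK c : cancel (mapE (squeeze c)) (mapE (unsqueeze c)).
Proof. by case=> a b; rewrite /mapE /= !squeezeK. Qed.

Lemma on_edge_squeeze c e s :
  on_edge (mapE (squeeze c) e) s = squeeze c (on_edge e s).
Proof. by rewrite /on_edge /squeeze /=; congr pair; field. Qed.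

Lemma wedge_squeeze c e f :
  wedge (dir (mapE (squeeze c) e)) (dir (mapE (squeeze c) f)) =
  wedge (dir e) (dir f) / 2.
Proof. by rewrite /wedge /dir /=; field. Qed.

Lemma cross_squeeze c e f :
  cross (mapE (squeeze c) e) (mapE (squeeze c) f) <-> cross e f.
Proof.
rewrite /cross (can_eq (mapEK c)); split=> -[ne [s [t [hs ht H]]]]; split=> //;
  exists s, t; split=> //; move: H; rewrite !on_edge_squeeze.
  exact: squeeze_inj.
by move->.
Qed.

Lemma path_edges_map g l : path_edges (map g l) = map (mapE g) (path_edges l).
Proof.
rewrite /path_edges behead_map; elim: l (behead l) => [|x l IH] [|y m] //=.
by rewrite IH.
Qed.

Lemma loop_edges_map g l : loop_edges (map g l) = map (mapE g) (loop_edges l).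
Proof.
rewrite /loop_edges -map_rot; elim: l (rot 1 l) => [|x l IH] [|y m] //=.
by rewrite IH.
Qed.

Lemma edges_of_map g l ls :
  edges_of (map g l) (map (map g) ls) = map (mapE g) (edges_of l ls).
Proof.
rewrite /edges_of map_cat path_edges_map map_flatten -!map_comp; congr (_ ++ flatten _).
by apply: eq_map => c /=; exact: loop_edges_map.
Qed.

Lemma path_edges_cat x s t :
  path_edges (rcons s x ++ t) = path_edges (rcons s x) ++ path_edges (x :: t).
Proof.
elim: s => [|y s IH] //=; rewrite /path_edges /=.
case: s IH => [|z s] //= IH; congr cons; exact: IH.
Qed.

Lemma edges_concat l ls l' ls' : generic l ls -> generic l' ls' ->
  perm_eq (edges_of (cat_long l l')
             (map (map (squeeze 0)) ls ++ map (map (squeeze 2^-1)) ls'))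
    (map (mapE (squeeze 0)) (edges_of l ls)
       ++ map (mapE (squeeze 2^-1)) (edges_of l' ls')).
Proof.
move=> [[m ->] _ _ _ _] [[m' ->] _ _ _ _].
rewrite -!edges_of_map /edges_of /cat_long map_cat flatten_cat.
rewrite -[ptL :: rcons m ptR]rcons_cons map_rcons [map _ (ptL :: rcons m' _)]map_cons.
have -> : squeeze 0 ptR = squeeze 2^-1 ptL by rewrite /squeeze /=; congr pair; field.
rewrite path_edges_cat -!catA perm_cat2l.
by rewrite perm_catCA.
Qed.

Lemma mem_zip_pair (T U : eqType) (s : seq T) (t : seq U) e :
  e \in zip s t -> e.1 \in s /\ e.2 \in t.
Proof.
elim: s t => [|x s IH] [|y t] //=; rewrite !inE => /orP[/eqP->|/IH[-> ->]] /=.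
  by rewrite !eqxx.
by rewrite !orbT.
Qed.

Lemma mem_path_edges x m y e : e \in path_edges (x :: rcons m y) ->
  e.1 \in x :: m /\ e.2 \in rcons m y.
Proof.
elim: m x => [|z m IH] x; rewrite /path_edges /=.
  by rewrite !inE => /eqP->; rewrite /= !eqxx.
rewrite inE => /orP[/eqP->|/IH[h1 h2]] /=; first by rewrite !inE !eqxx.
by rewrite inE h1 orbT inE h2 orbT.
Qed.

Lemma edge_ends l ls e : generic l ls -> e \in edges_of l ls ->
  [/\ e.1 \in l ++ flatten ls, e.2 \in l ++ flatten ls, e.1 != ptR & e.2 != ptL].
Proof.
move=> [[m ->] [U _] _ _ _]; rewrite /edges_of mem_cat => /orP[|].
  move/mem_path_edges => [h1 h2].
  have i1 : e.1 \in ptL :: rcons m ptR.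
    by move: h1; rewrite !inE mem_rcons inE => /orP[->|->]; rewrite ?orbT.
  have i2 : e.2 \in ptL :: rcons m ptR by rewrite inE h2 orbT.
  rewrite !mem_cat i1 i2; split=> //.
    apply/eqP => eR; move: U; rewrite cat_uniq => /andP[].
    by rewrite -rcons_cons rcons_uniq -eR h1.
  apply/eqP => eL; move: U; rewrite cat_uniq => /andP[].
  by rewrite cons_uniq -eL h2.
move=> /flattenP[_ /mapP[c cls ->]] /mem_zip_pair; rewrite mem_rot => -[h1 h2].
have f1 : e.1 \in flatten ls by apply/flattenP; exists c.
have f2 : e.2 \in flatten ls by apply/flattenP; exists c.
rewrite !mem_cat f1 f2 !orbT.
move: U; rewrite cat_uniq => /and3P[_ /hasPn H _].
split=> //.
  apply/eqP => eR; move: (H _ f1); rewrite eR.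
  by rewrite -rcons_cons mem_rcons inE eqxx.
by apply/eqP => eL; move: (H _ f2); rewrite eL inE eqxx.
Qed.

Lemma vertex_x l ls v : generic l ls -> v \in l ++ flatten ls ->
  [/\ 0 <= v.1 <= 1, v.1 = 0 -> v = ptL & v.1 = 1 -> v = ptR].
Proof.
move=> [_ _ H _ _] /H [->|->|[/andP[h1 h2] _]] /=; rewrite ?lexx ?ler01; split=> //.
- by move/eqP; rewrite eq_sym oner_eq0.
- by move/eqP; rewrite oner_eq0.
- by rewrite !ltW.
- by move=> v0; rewrite v0 ltxx in h1.
- by move=> v1; rewrite v1 ltxx in h2.
Qed.

Lemma edge_x l ls e s : generic l ls -> e \in edges_of l ls -> 0 <= s <= 1 ->
  [/\ 0 <= (on_edge e s).1 <= 1,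
      (on_edge e s).1 = 0 -> s = 0 /\ e.1 = ptL
    & (on_edge e s).1 = 1 -> s = 1 /\ e.2 = ptR].
Proof.
move=> G /(edge_ends G)[i1 i2 n1 n2] /andP[s0 s1].
have [/andP[a0 a1] aL aR] := vertex_x G i1.
have [/andP[b0 b1] bL bR] := vertex_x G i2.
have a1' : e.1.1 < 1.
  by rewrite lt_neqAle a1 andbT; apply: contra n1 => /eqP/aR->.
have b0' : 0 < e.2.1.
  by rewrite lt_neqAle b0 andbT; apply: contra n2 => /eqP/esym/bL->.
rewrite /on_edge /=; split.
- by apply/andP; split; nra.
- move=> H; have s00 : s = 0 by nra.
  by split=> //; apply: aL; move: H; rewrite s00; lra.
- move=> H; have s11 : s = 1 by nra.
  by split=> //; apply: bR; move: H; rewrite s11; lra.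
Qed.

Lemma meet_concat l ls l' ls' e f s t : generic l ls -> generic l' ls' ->
  e \in edges_of l ls -> f \in edges_of l' ls' ->
  0 <= s <= 1 -> 0 <= t <= 1 ->
  on_edge (mapE (squeeze 0) e) s = on_edge (mapE (squeeze 2^-1) f) t ->
  s = 1 /\ t = 0.
Proof.
move=> G G' he hf hs ht; rewrite !on_edge_squeeze.
move: (on_edge e s) (on_edge f t) (edge_x G he hs) (edge_x G' hf ht).
move=> p q [/andP[_ x1] _ xR] [/andP[y0 _] yL _] /(congr1 fst) /= H.
have x1' : p.1 = 1 by lra.
have y0' : q.1 = 0 by lra.
by have [-> _] := xR x1'; have [-> _] := yL y0'.
Qed.

Lemma nocross_concat l ls l' ls' e f : generic l ls -> generic l' ls' ->
  e \in edges_of l ls -> f \in edges_of l' ls' ->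
  ~ cross (mapE (squeeze 0) e) (mapE (squeeze 2^-1) f) /\
  ~ cross (mapE (squeeze 2^-1) f) (mapE (squeeze 0) e).
Proof.
move=> G G' he hf; split=> -[_ [s [t [/andP[s0 s1] /andP[t0 t1] H]]]].
  have [] := meet_concat G G' he hf _ _ H; rewrite ?ltW //.
  by move=> s1'; rewrite s1' ltxx in s1.
have [] := meet_concat G G' he hf _ _ (esym H); rewrite ?ltW //.
by move=> t1'; rewrite t1' ltxx in t1.
Qed.

Lemma generic_concat l ls l' ls' : generic l ls -> generic l' ls' ->
  generic (cat_long l l')
    (map (map (squeeze 0)) ls ++ map (map (squeeze 2^-1)) ls').
Proof.
move=> G G'; have P := edges_concat G G'.
have [[m El] [U S] V C T] := G; have [[m' El'] [U' S'] V' C' T'] := G'.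
have mid : squeeze 0 ptR = squeeze 2^-1 ptL :> pt.
  by rewrite /squeeze /=; congr pair; field.
have memV : perm_eq
    (cat_long l l' ++ flatten (map (map (squeeze 0)) ls ++ map (map (squeeze 2^-1)) ls'))
    (map (squeeze 0) (l ++ flatten ls) ++
     map (squeeze 2^-1) (behead l' ++ flatten ls')).
  rewrite /cat_long !map_cat flatten_cat -!map_flatten behead_map -!catA.
  by rewrite perm_cat2l perm_catCA.
have U'b : uniq (behead l' ++ flatten ls') /\ ptL \notin behead l' ++ flatten ls'.
  by move: U'; rewrite El' /= => /andP[-> ->].
split.
- exists (map (squeeze 0) (rcons m ptR) ++ map (squeeze 2^-1) m').
  rewrite El El' /cat_long !map_cons /= map_rcons [map _ (rcons m' _)]map_rcons.
  rewrite rcons_cat; congr (_ :: _ ++ rcons _ _); rewrite /squeeze /=.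
    by congr pair; lra.
  by congr pair; lra.
- split.
    rewrite (perm_uniq memV) cat_uniq !(map_inj_uniq (@squeeze_inj _)) U /=.
    rewrite (proj1 U'b) andbT; apply/hasPn => _ /mapP[v vV ->]; apply/negP.
    move=> /mapP[w wV] /(congr1 fst) /= H.
    have vV' : v \in l' ++ flatten ls' by rewrite El' /= inE; move: vV; rewrite El' /= => ->; rewrite orbT.
    have [/andP[w0 w1] _ _] := vertex_x G wV.
    have [/andP[v0 v1] vL _] := vertex_x G' vV'.
    have v00 : v.1 = 0 by lra.
    by move: (proj2 U'b); rewrite -(vL v00) vV.
  move=> c; rewrite mem_cat => /orP[] /mapP[d dls ->]; rewrite size_map.
    exact: S.
  exact: S'.
- move=> v; rewrite (perm_mem memV) mem_cat => /orP[] /mapP[w wV ->].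
    case: (V _ wV) => [->|->|[/andP[h1 h2] h3]].
    + by constructor 1; rewrite /squeeze /ptL /=; congr pair; lra.
    + by constructor 3; split; rewrite /=; lra.
    + by constructor 3; split=> //=; lra.
  have wV' : w \in l' ++ flatten ls' by rewrite El' /= inE; move: wV; rewrite El' /= => ->; rewrite orbT.
  case: (V' _ wV') => [wL|->|[/andP[h1 h2] h3]].
  + by move: (proj2 U'b); rewrite -wL wV.
  + by constructor 2; rewrite /squeeze /ptR /=; congr pair; lra.
  + by constructor 3; split=> //=; lra.
- move=> e f s t; rewrite !(perm_mem P) !mem_cat.
  move=> /orP[] /mapP[e' he ->] /orP[] /mapP[f' hf ->] ne hs ht H.
  + move: ne; rewrite (can_eq (mapEK _)) => ne.
    move: H; rewrite !on_edge_squeeze => /squeeze_inj H.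
    case: (C _ _ _ _ he hf ne hs ht H) => [[? ? w]|?|?].
    * by constructor 1; split=> //; rewrite wedge_squeeze mulf_neq0 // invr_neq0 // pnatr_eq0.
    * by constructor 2.
    * by constructor 3.
  + by constructor 2; exact: (meet_concat G G' he hf hs ht H).
  + by constructor 3; have [-> ->] := meet_concat G G' hf he ht hs (esym H).
  + move: ne; rewrite (can_eq (mapEK _)) => ne.
    move: H; rewrite !on_edge_squeeze => /squeeze_inj H.
    case: (C' _ _ _ _ he hf ne hs ht H) => [[? ? w]|?|?].
    * by constructor 1; split=> //; rewrite wedge_squeeze mulf_neq0 // invr_neq0 // pnatr_eq0.
    * by constructor 2.
    * by constructor 3.
- have no e f s t : e \in edges_of l ls -> f \in edges_of l' ls' ->
      0 < s < 1 -> 0 < t < 1 ->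
      on_edge (mapE (squeeze 0) e) s <> on_edge (mapE (squeeze 2^-1) f) t.
    move=> he hf /andP[s0 s1] /andP[t0 t1] H.
    have [] := meet_concat G G' he hf _ _ H; rewrite ?ltW //.
    by move=> s1'; rewrite s1' ltxx in s1.
  move=> e f g s t u; rewrite !(perm_mem P) !mem_cat.
  move=> /orP[] /mapP[e' he ->] /orP[] /mapP[f' hf ->] /orP[] /mapP[g' hg ->] un hs ht hu [H1 H2].
  + move: H1 H2; rewrite !on_edge_squeeze => /squeeze_inj H1 /squeeze_inj H2.
    apply: (T e' f' g' s t u) => //.
    by rewrite -(map_inj_uniq (can_inj (mapEK 0))).
  + by exact: no H2.
  + by exact: no H1.
  + by exact: no H1.
  + by apply: no (esym H1).
  + by apply: no (esym H1).
  + by apply: no (esym H2).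
  + move: H1 H2; rewrite !on_edge_squeeze => /squeeze_inj H1 /squeeze_inj H2.
    apply: (T' e' f' g' s t u) => //.
    by rewrite -(map_inj_uniq (can_inj (mapEK 2^-1))).
Qed.

Lemma unsqueezeK c : cancel (unsqueeze c) (squeeze c).
Proof. by case=> x y; rewrite /squeeze /unsqueeze /=; congr pair; field. Qed.

Lemma continuous_squeeze c : continuous (squeeze c).
Proof.
move=> q; rewrite /squeeze.
apply: (@cvg_pair _ _ _ (nbhs q) (nbhs (q.1 / 2 + c)) (nbhs q.2)).
  apply: (@cvgD _ _ _ _ _ (fun q : pt => q.1 / 2) (fun=> c)); last exact: cvg_cst.
  apply: (@cvgM _ _ _ _ (fun q : pt => q.1) (fun=> 2^-1)); last exact: cvg_cst.
  exact: cvg_fst.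
exact: cvg_snd.
Qed.

(* [phi], transported to the squeezed copy of the points of [V]. *)
Definition ext c (phi : pt -> pt) (V : seq pt) (w : pt) : pt :=
  if unsqueeze c w \in V then squeeze c (phi (unsqueeze c w)) else w.

Lemma ext_squeeze c phi (V : seq pt) v :
  v \in V -> ext c phi V (squeeze c v) = squeeze c (phi v).
Proof. by move=> vV; rewrite /ext squeezeK vV. Qed.

Section Embedding.
Variables (c : R) (L : seq pt -> seq pt) (G : seq edge).
Variables (mG : edge -> edge -> marking) (F : diagram -> diagram).
Let h := squeeze c.

Hypothesis longF : forall D, long (F D) = L (long D).
Hypothesis loopsF : forall D, loops (F D) = map (map h) (loops D).
Hypothesis edgesL : forall l ls, generic l ls ->
  perm_eq (edges_of (L l) (map (map h) ls)) (map (mapE h) (edges_of l ls) ++ G).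
Hypothesis genericL : forall l ls, generic l ls -> generic (L l) (map (map h) ls).
Hypothesis nocrossL : forall l ls e f, generic l ls -> e \in edges_of l ls ->
  f \in G -> ~ cross (mapE h e) f /\ ~ cross f (mapE h e).
Hypothesis markF : forall D e f, wf D -> e \in edges D ->
  mark (F D) (mapE h e) (mapE h f) = mark D e f.
Hypothesis markG : forall D e f, e \in G -> mark (F D) e f = mG e f.
Hypothesis flipG : forall e f, e \in G -> f \in G -> cross e f ->
  mG f e = flip (mG e f).
Hypothesis outG : forall e s q, e \in G -> 0 <= s <= 1 -> in_rect q ->
  on_edge e s <> h q.
Hypothesis rectF : forall q, in_rect q -> in_rect (h q).
Hypothesis subL : forall l ls v, generic l ls -> v \in l -> h v \in L l.
Hypothesis extL : forall phi l ls, generic l ls ->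
  generic (map phi l) (map (map phi) ls) ->
  map (ext c phi (l ++ flatten ls)) (L l) = L (map phi l).
Hypothesis extG : forall phi l ls e, generic l ls ->
  generic (map phi l) (map (map phi) ls) -> e \in G ->
  mapE (ext c phi (l ++ flatten ls)) e = e.

Lemma edgesF D : wf D -> perm_eq (edges (F D)) (map (mapE h) (edges D) ++ G).
Proof. by move=> [gD _]; rewrite /edges longF loopsF; exact: edgesL. Qed.

Lemma permF D X : wf D -> perm_eq (edges D) X ->
  perm_eq (edges (F D)) (map (mapE h) X ++ G).
Proof.
move=> wD P; apply: perm_trans (edgesF wD) _.
by rewrite perm_cat2r; exact: perm_map.
Qed.

Lemma permF2 D X Y : wf D -> perm_eq (edges D) (X ++ Y) ->
  perm_eq (edges (F D)) ((map (mapE h) X ++ G) ++ map (mapE h) Y).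
Proof.
move=> wD P; apply: perm_trans (permF wD P) _.
by rewrite map_cat -!catA perm_cat2l perm_catC.
Qed.

Lemma nocrossF D e f : wf D -> e \in edges D -> f \in G ->
  ~ cross (mapE h e) f /\ ~ cross f (mapE h e).
Proof. by move=> [gD _]; exact: nocrossL. Qed.

Lemma wfF D : wf D -> wf (F D).
Proof.
move=> wD; have [gD mD] := wD; split; first by rewrite longF loopsF; exact: genericL.
move=> e f; rewrite !(perm_mem (edgesF wD)) !mem_cat.
move=> /orP[/mapP[e' he ->]|he] /orP[/mapP[f' hf ->]|hf].
- by move=> /cross_squeeze cr; rewrite !markF //; exact: mD.
- by move=> cr; case: (nocrossF wD he hf) => /(_ cr).
- by move=> cr; case: (nocrossF wD hf he) => _ /(_ cr).
- by move=> cr; rewrite !markG //; exact: flipG.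
Qed.

Lemma same_marksF D D' E0 : wf D -> wf D' ->
  {subset E0 <= edges D} -> {subset E0 <= edges D'} -> same_marks D D' E0 ->
  same_marks (F D) (F D') (map (mapE h) E0 ++ G).
Proof.
move=> wD wD' s s' sm e f; rewrite !mem_cat.
move=> /orP[/mapP[e' he ->]|he] /orP[/mapP[f' hf ->]|hf].
- by move=> /cross_squeeze cr; rewrite !markF ?s ?s' //; exact: sm.
- by move=> cr; case: (nocrossF wD (s _ he) hf) => /(_ cr).
- by move=> cr; case: (nocrossF wD (s _ hf) he) => _ /(_ cr).
- by move=> cr; rewrite !markG.
Qed.

Lemma perm_subl D (X Y : seq edge) : perm_eq (edges D) (X ++ Y) ->
  {subset X <= edges D} /\ {subset Y <= edges D}.
Proof.
by move=> P; split=> e he; rewrite (perm_mem P) mem_cat he ?orbT.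
Qed.

Lemma relistingF D D' : wf D -> wf D' -> relisting D D' -> relisting (F D) (F D').
Proof.
move=> wD wD' [P sm]; split.
  apply: perm_trans (permF wD P) _; rewrite perm_sym; exact: edgesF.
move=> e f; rewrite !(perm_mem (edgesF wD)) => he hf.
by apply: (same_marksF wD wD' _ _ sm) => // x; rewrite (perm_mem P).
Qed.

Lemma subdivisionF D D' : wf D -> wf D' ->
  subdivision D D' -> subdivision (F D) (F D').
Proof.
move=> wD wD' [E0 [e [s [hs P P' sm sm']]]].
have [_ sD] := @perm_subl D [:: e] E0 P.
have [sD1 sD'] := @perm_subl D' [:: (e.1, on_edge e s); (on_edge e s, e.2)] E0 P'.
have eD : e \in edges D by rewrite (perm_mem P) inE eqxx.
exists (map (mapE h) E0 ++ G), (mapE h e), s; split=> //.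
- exact: permF wD P.
- rewrite on_edge_squeeze; exact: permF wD' P'.
- exact: same_marksF.
- move=> e' f; rewrite on_edge_squeeze => he' hf.
  have [e'' he'' Ee'] : exists2 e'', e'' \in [:: (e.1, on_edge e s); (on_edge e s, e.2)]
      & e' = mapE h e''.
    move: he'; rewrite !inE => /orP[] /eqP->.
      by exists (e.1, on_edge e s); rewrite ?inE ?eqxx.
    by exists (on_edge e s, e.2); rewrite ?inE ?eqxx ?orbT.
  have eD' := sD1 _ he''.
  move: hf; rewrite Ee' mem_cat => /orP[/mapP[f' hf ->]|hf].
    by move=> /cross_squeeze cr; rewrite !markF //; exact: sm'.
  by move=> cr; case: (nocrossF wD' eD' hf) => /(_ cr).
Qed.

Lemma surgeryF f E0 A B D D' : wf D -> wf D' ->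
  surgery f E0 A B D D' ->
  surgery (h \o f) (map (mapE h) E0 ++ G) A B (F D) (F D').
Proof.
move=> wD wD' [[[p [u [v [uv Ef]]]] fr] P P' out sm].
have [sD _] := perm_subl P; have [sD' _] := perm_subl P'.
have Emap X : map (mapE (h \o f)) X = map (mapE h) (map (mapE f) X).
  by rewrite -map_comp.
split.
- split; last by move=> q q1 q2; apply: rectF; exact: fr.
  exists (h p), (u.1 / 2, u.2), (v.1 / 2, v.2); split.
    have -> : wedge (u.1 / 2, u.2) (v.1 / 2, v.2) = wedge u v / 2.
      by rewrite /wedge /=; field.
    by rewrite mulf_neq0 // invr_neq0 // pnatr_eq0.
  by move=> q; rewrite /= Ef /h /squeeze /=; congr pair; field.
- by rewrite Emap; exact: permF2.
- by rewrite Emap; exact: permF2.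
- move=> e s q; rewrite mem_cat => /orP[/mapP[e' he ->]|he] hs /=.
    by rewrite on_edge_squeeze => /squeeze_inj; exact: out.
  move=> H [/andP[a1 a2] /andP[b1 b2]].
  by apply: (outG he hs _ H); apply: fr; rewrite ?ltW.
- exact: same_marksF.
Qed.

Lemma layeredF ht f S D : wf D ->
  {subset map (mapE f) (strand_edges S) <= edges D} ->
  layered ht f S D -> layered ht (h \o f) S (F D).
Proof.
move=> wD sub lay i j e e' he he' cr.
have mem k x : x \in path_edges (nth [::] S k) -> mapE f x \in edges D.
  move=> hx; apply: sub; apply: map_f; apply/flattenP.
  exists (path_edges (nth [::] S k)) => //; apply: map_f; apply: mem_nth.
  by rewrite ltnNge; apply/negP => le; move: hx; rewrite nth_default.
by rewrite -(lay i j e e' he he' cr) -[RHS](markF _ wD (mem _ _ he)).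
Qed.

Lemma detourF D D' : wf D -> wf D' -> detour D D' -> detour (F D) (F D').
Proof.
move=> wD wD' [E0 [a [b [u [u' [ab [P vP] [P' vP'] sm]]]]]].
have Em w : path_edges (h a :: rcons (map h w) (h b)) =
    map (mapE h) (path_edges (a :: rcons w b)).
  by rewrite -path_edges_map /= map_rcons.
have vF X Q : wf X -> {subset Q <= edges X} -> all_virtual X Q ->
    all_virtual (F X) (map (mapE h) Q).
  move=> wX sQ vQ _ e' /mapP[e he ->]; rewrite (perm_mem (edgesF wX)) mem_cat.
  move=> /orP[/mapP[f hf ->]|hf] cr.
    by move: cr => /cross_squeeze cr; rewrite markF ?sQ //; exact: vQ.
  by case: (nocrossF wX (sQ _ he) hf) => /(_ cr).
have [sD sDP] := perm_subl P; have [sD' sDP'] := perm_subl P'.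
exists (map (mapE h) E0 ++ G), (h a), (h b), (map h u), (map h u').
rewrite !Em; split.
- by rewrite (can_eq (squeezeK c)).
- by split; [exact: permF2 | exact: vF].
- by split; [exact: permF2 | exact: vF].
- exact: same_marksF.
Qed.

Lemma birthF D D' : wf D -> wf D' -> birth D D' -> birth (F D) (F D').
Proof.
move=> wD wD' [l [El Els nc sm]]; exists (map h l).
have sD' : {subset edges D <= edges D'}.
  by move=> e; rewrite /edges /edges_of El Els /= !mem_cat => /orP[->//|->]; rewrite !orbT.
have sl : {subset loop_edges l <= edges D'}.
  by move=> e he; rewrite /edges /edges_of Els /= !mem_cat he orbT.
split.
- by rewrite !longF El.
- by rewrite !loopsF Els.
- move=> e f; rewrite loop_edges_map => /mapP[e' he ->].
  rewrite (perm_mem (edgesF wD')) mem_cat => /orP[/mapP[f' hf ->]|hf] cr.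
    by move: cr => /cross_squeeze cr; exact: (nc _ _ he hf cr).
  by case: (nocrossF wD' (sl _ he) hf) => /(_ cr).
- move=> e f; rewrite !(perm_mem (edgesF wD)); exact: same_marksF.
Qed.

Lemma isotopyF D D' : wf D -> wf D' -> isotopy D D' -> isotopy (F D) (F D').
Proof.
move=> wD wD' [g [g0 gc gg [El Els] gm]]; have [gD mD] := wD.
pose V := vertices D.
have endsV e : e \in edges D -> e.1 \in V /\ e.2 \in V.
  by move/(edge_ends gD) => [].
have extE t e : e \in edges D ->
    mapE (ext c (g t) V) (mapE h e) = mapE h (mapE (g t) e).
  by move=> /endsV[h1 h2]; rewrite /mapE /= !ext_squeeze.
have extls t : map (map (ext c (g t) V)) (loops (F D)) =
    map (map h) (map (map (g t)) (loops D)).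
  rewrite loopsF -!map_comp; apply/eq_in_map => l hl /=.
  rewrite -!map_comp; apply/eq_in_map => v hv /=; apply: ext_squeeze.
  by rewrite mem_cat; apply/orP; right; apply/flattenP; exists l.
have extl t : 0 <= t <= 1 -> map (ext c (g t) V) (long (F D)) = L (map (g t) (long D)).
  by move=> /gg[ggt _]; rewrite longF; exact: (extL gD ggt).
have extg t e : 0 <= t <= 1 -> e \in G -> mapE (ext c (g t) V) e = e.
  by move=> /gg[ggt _] he; exact: (extG gD ggt he).
have h01 : 0 <= (1 : R) <= 1 by rewrite ler01 lexx.
exists (fun t => ext c (g t) V); split.
- by move=> w; rewrite /ext; case: ifP => // _; rewrite g0 unsqueezeK.
- move=> w _; rewrite /ext; case wV: (unsqueeze c w \in V).
    move=> t; apply: (@continuous_comp _ _ _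
      (from_subspace `[0, 1] (fun t : R => g t (unsqueeze c w))) (squeeze c) t).
      exact: gc.
    exact: continuous_squeeze.
  by move=> t; exact: cvg_cst.
- move=> t ht; have [ggt gcr] := gg t ht; rewrite extl // extls; split.
    exact: genericL.
  move=> e f; rewrite !(perm_mem (edgesF wD)) !mem_cat.
  have mapg e' : e' \in edges D ->
      mapE (g t) e' \in edges_of (map (g t) (long D)) (map (map (g t)) (loops D)).
    by move=> he; rewrite edges_of_map map_f.
  move=> /orP[/mapP[e' he ->]|he] /orP[/mapP[f' hf ->]|hf].
  + rewrite !extE //; split=> /cross_squeeze H; apply/cross_squeeze; exact/gcr.
  + rewrite extE // extg //.
    have [n1 _] := nocrossF wD he hf.
    by have [n2 _] := nocrossL ggt (mapg _ he) hf; split.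
  + rewrite extE // extg //.
    have [_ n1] := nocrossF wD hf he.
    by have [_ n2] := nocrossL ggt (mapg _ hf) he; split.
  + by rewrite !extg.
- by rewrite extl // extls longF loopsF El Els.
- move=> e f; rewrite !(perm_mem (edgesF wD)) !mem_cat.
  move=> /orP[/mapP[e' he ->]|he] /orP[/mapP[f' hf ->]|hf].
  + move=> /cross_squeeze cr; rewrite !extE // !markF //; first exact: gm.
    by rewrite /edges El Els edges_of_map map_f.
  + by move=> cr; case: (nocrossF wD he hf) => /(_ cr).
  + by move=> cr; case: (nocrossF wD hf he) => _ /(_ cr).
  + by move=> cr; rewrite !extg // !markG.
Qed.

Lemma rewritingF D D' : wf D -> wf D' -> rewriting D D' -> rewriting (F D) (F D').
Proof.
move=> wD wD' [[H|H]|H|H|[H|H]].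
- by constructor 1; left; exact: relistingF.
- by constructor 1; right; exact: subdivisionF.
- constructor 2; case: H => f [E0 [b [sg nv]]].
  exists (h \o f), (map (mapE h) E0 ++ G), b; split; first exact: surgeryF.
  move=> e e' he he' cr; case: sg => _ _ P' _ _.
  have [_ sub] := perm_subl P'.
  rewrite -[mapE _ e]/(mapE h (mapE f e)) -[mapE _ e']/(mapE h (mapE f e')).
  rewrite markF //; first exact: nv.
  by apply: sub; exact: map_f.
- constructor 3; case: H => f [E0 [b [b' [ht [ih sg lay]]]]].
  exists (h \o f), (map (mapE h) E0 ++ G), b, b', ht; split=> //.
    exact: surgeryF.
  by apply: layeredF => //; case: sg => _ _ /perm_subl[].
- constructor 4; left; case: H => f [E0 [b [b' [b'' [ht [ih sg lay lay']]]]]].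
  exists (h \o f), (map (mapE h) E0 ++ G), b, b', b'', ht; split=> //.
  + exact: surgeryF.
  + by apply: layeredF => //; case: sg => _ /perm_subl[].
  + by apply: layeredF => //; case: sg => _ _ /perm_subl[].
- by constructor 4; right; exact: detourF.
Qed.

Lemma saddleF D D' : wf D -> wf D' -> saddle D D' -> saddle (F D) (F D').
Proof.
move=> wD wD' [f [E0 H]]; exists (h \o f), (map (mapE h) E0 ++ G).
exact: surgeryF.
Qed.

Lemma moveF k D D' : wf D -> wf D' -> move k D D' -> move k (F D) (F D').
Proof.
move=> wD wD'; case: k => /=.
- by case=> H; [left | right]; exact: isotopyF.
- by case=> H; [left | right]; exact: rewritingF.
- exact: birthF.
- exact: birthF.
- by case=> H; [left | right]; exact: saddleF.
Qed.

Lemma linkedF k D D' i j : wf D -> wf D' ->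
  linked k D D' i j -> linked k (F D) (F D') i j.
Proof.
have compF X n v : wf X -> v \in comp X n -> h v \in comp (F X) n.
  move=> [gX _]; rewrite /comp longF loopsF; case: n => [|n] /=.
    exact: subL gX.
  have [lt|ge] := ltnP n (size (loops X)); last by rewrite nth_default.
  by rewrite (nth_map [::]) // => hv; exact: map_f.
move=> wD wD'; case: k => //= -[v hv hv'].
all: by exists (h v); exact: compF.
Qed.

Lemma concordantF D D' : concordant D D' -> concordant (F D) (F D').
Proof.
move=> [N [k [M [[M0 MN] wfM mvM conM cnt]]]].
exists N, k, (fun i => F (M i)); split=> //.
- by rewrite M0 MN.
- by move=> i /wfM; exact: wfF.
- by move=> i ltiN; apply: moveF; [apply: wfM; exact: ltnW | exact: wfM | exact: mvM].
- move=> i n leiN; rewrite /ncomp loopsF size_map => ltn.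
  apply: (crst_map (phi := id)) (conM i n leiN ltn) => -[x a] [y b].
  case=> /= ltx Ey lk; apply: rst_step; split=> //=.
  by apply: linkedF => //; apply: wfM; [exact: ltnW | rewrite Ey].
Qed.

End Embedding.

Lemma ext0_fix phi l ls l' ls' v : generic l ls ->
  generic (map phi l) (map (map phi) ls) -> generic l' ls' ->
  v \in l' ++ flatten ls' ->
  ext 0 phi (l ++ flatten ls) (squeeze 2^-1 v) = squeeze 2^-1 v.
Proof.
move=> G Gp G' vV'; rewrite /ext; case: ifP => // wV.
have [/andP[w0 w1] _ _] := vertex_x G wV.
have [/andP[v0 v1] vL _] := vertex_x G' vV'.
have v00 : v.1 = 0 by move: w1; rewrite /unsqueeze /squeeze /=; lra.
have -> : v = ptL by exact: vL.
have -> : unsqueeze 0 (squeeze 2^-1 ptL) = ptR.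
  by rewrite /unsqueeze /squeeze /=; congr pair; field.
have [[m El] _ _ _ _] := G; have [[m' El'] _ _ _ _] := Gp.
have -> : phi ptR = ptR.
  move: El'; rewrite El map_cons map_rcons => -[_ /rcons_inj[_]].
  by [].
by rewrite /squeeze /=; congr pair; field.
Qed.

Lemma extR_fix phi l ls l' ls' v : generic l ls ->
  generic (map phi l) (map (map phi) ls) -> generic l' ls' ->
  v \in l' ++ flatten ls' ->
  ext 2^-1 phi (l ++ flatten ls) (squeeze 0 v) = squeeze 0 v.
Proof.
move=> G Gp G' vV'; rewrite /ext; case: ifP => // wV.
have [/andP[w0 w1] _ _] := vertex_x G wV.
have [/andP[v0 v1] _ vR] := vertex_x G' vV'.
have v11 : v.1 = 1 by move: w0; rewrite /unsqueeze /squeeze /=; lra.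
have -> : v = ptR by exact: vR.
have -> : unsqueeze 2^-1 (squeeze 0 ptR) = ptL.
  by rewrite /unsqueeze /squeeze /=; congr pair; field.
have [[m El] _ _ _ _] := G; have [[m' El'] _ _ _ _] := Gp.
have -> : phi ptL = ptL.
  by move: El'; rewrite El map_cons => -[].
by rewrite /squeeze /=; congr pair; field.
Qed.

Lemma rect_squeeze c q : 0 <= c <= 2^-1 -> in_rect q -> in_rect (squeeze c q).
Proof.
by move=> /andP[c0 c1] [/andP[h1 h2] h3]; split=> //=; apply/andP; split; lra.
Qed.

Lemma mark_left D E e f : wf D -> e \in edges D ->
  mark (concat D E) (mapE (squeeze 0) e) (mapE (squeeze 0) f) = mark D e f.
Proof.
move=> [gD _] he; rewrite /= !mapEK.
have [i1 _ n1 _] := edge_ends gD he.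
have [/andP[_ x1] _ xR] := vertex_x gD i1.
case: ifP => // /negbT; rewrite -leNgt => le.
have x11 : e.1.1 = 1 by lra.
by move: n1; rewrite (xR x11) eqxx.
Qed.

Lemma mark_right D E e f : wf E -> e \in edges E ->
  mark (concat D E) (mapE (squeeze 2^-1) e) f =
  mark E e (mapE (unsqueeze 2^-1) f).
Proof.
move=> [gE _] he; rewrite /= !mapEK.
have [i1 _ _ _] := edge_ends gE he.
have [/andP[x0 _] _ _] := vertex_x gE i1.
by case: ifP => // lt; exfalso; lra.
Qed.

Lemma mark_left' D E e f : wf D -> e \in edges D ->
  mark (concat D E) (mapE (squeeze 0) e) f = mark D e (mapE (unsqueeze 0) f).
Proof.
move=> wD he; rewrite -(mark_left E (mapE (unsqueeze 0) f) wD he) /= !mapEK.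
by rewrite [mapE (squeeze 0) (mapE _ f)](_ : _ = f) //; case: f => a b;
   rewrite /mapE /= !unsqueezeK.
Qed.

Lemma edge_x01 D e s : wf D -> e \in edges D -> 0 <= s <= 1 ->
  0 <= (on_edge e s).1 <= 1.
Proof. by move=> [gD _] he hs; have [] := edge_x gD he hs. Qed.

Lemma concat_left D D' E : wf E -> loops E = [::] ->
  concordant D D' -> concordant (concat D E) (concat D' E).
Proof.
move=> wE lE; have [gE mE] := wE.
apply: (@concordantF 0 (fun l => cat_long l (long E))
  (map (mapE (squeeze 2^-1)) (edges E))
  (fun e f => mark E (mapE (unsqueeze 2^-1) e) (mapE (unsqueeze 2^-1) f))
  (fun X => concat X E)).
- by [].
- by move=> X /=; rewrite lE cats0.
- by move=> l ls G; have := edges_concat G gE; rewrite lE cats0 /edges lE.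
- by move=> l ls G; have := generic_concat G gE; rewrite lE cats0.
- by move=> l ls e f G he /mapP[f' hf ->]; exact: nocross_concat G gE he hf.
- by move=> X e f wX he; exact: mark_left.
- by move=> X e f /mapP[e' he ->]; rewrite mark_right // mapEK.
- move=> _ _ /mapP[e he ->] /mapP[f hf ->] /cross_squeeze cr.
  by rewrite !mapEK; exact: mE.
- move=> _ s q /mapP[e he ->] hs [/andP[q0 q1] _]; rewrite on_edge_squeeze.
  have := edge_x01 wE he hs; move: (on_edge e s) => p /andP[p0 p1].
  move=> H; have {}H : p.1 / 2 + 2^-1 = q.1 / 2 + 0 :> R := congr1 fst H.
  suff : (0 : R) < 0 by rewrite ltxx.
  by lra.
- by move=> q; apply: rect_squeeze; rewrite lexx invr_ge0 ler0n.
- by move=> l ls v _ hv; rewrite /cat_long mem_cat map_f.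
- move=> phi l ls G Gp; rewrite /cat_long map_cat; congr cat.
    rewrite -!map_comp; apply/eq_in_map => v hv /=; apply: ext_squeeze.
    by rewrite mem_cat hv.
  rewrite behead_map -[RHS]map_id; apply/eq_in_map => _ /mapP[v hv ->].
  apply: (ext0_fix G Gp gE); rewrite mem_cat; apply/orP; left; exact: mem_behead.
- move=> phi l ls _ G Gp /mapP[e he ->].
  have [i1 i2 _ _] := edge_ends gE he.
  by rewrite /mapE /= !(ext0_fix G Gp gE).
Qed.

Lemma concat_right D D' E : wf E -> loops E = [::] ->
  concordant D D' -> concordant (concat E D) (concat E D').
Proof.
move=> wE lE; have [gE mE] := wE.
apply: (@concordantF 2^-1 (fun l => cat_long (long E) l)
  (map (mapE (squeeze 0)) (edges E))
  (fun e f => mark E (mapE (unsqueeze 0) e) (mapE (unsqueeze 0) f))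
  (fun X => concat E X)).
- by [].
- by move=> X /=; rewrite lE.
- move=> l ls G; have := edges_concat gE G; rewrite lE /= /edges lE => P.
  by apply: perm_trans P _; rewrite perm_catC.
- by move=> l ls G; have := generic_concat gE G; rewrite lE.
- move=> l ls e f G he /mapP[f' hf ->].
  by have [] := nocross_concat gE G hf he; split.
- by move=> X e f wX he; rewrite mark_right // mapEK.
- by move=> X e f /mapP[e' he ->]; rewrite mark_left' // mapEK.
- move=> _ _ /mapP[e he ->] /mapP[f hf ->] /cross_squeeze cr.
  by rewrite !mapEK; exact: mE.
- move=> _ s q /mapP[e he ->] hs [/andP[q0 q1] _]; rewrite on_edge_squeeze.
  have := edge_x01 wE he hs; move: (on_edge e s) => p /andP[p0 p1].
  move=> H; have {}H : p.1 / 2 + 0 = q.1 / 2 + 2^-1 :> R := congr1 fst H.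
  suff : (0 : R) < 0 by rewrite ltxx.
  by lra.
- by move=> q; apply: rect_squeeze; rewrite lexx invr_ge0 ler0n.
- move=> l ls v [[m ->] _ _ _ _] hv; have [[m' Em'] _ _ _ _] := gE.
  have mid : squeeze 2^-1 ptL = squeeze 0 ptR :> pt.
    by rewrite /squeeze /=; congr pair; field.
  rewrite /cat_long behead_map mem_cat.
  move: hv; rewrite inE => /orP[/eqP->|hv]; last by rewrite [X in _ || X]map_f ?orbT.
  by rewrite mid map_f // Em' -rcons_cons mem_rcons inE eqxx.
- move=> phi l ls G Gp; rewrite /cat_long map_cat; congr cat.
    rewrite -[RHS]map_id; apply/eq_in_map => _ /mapP[v hv ->].
    by apply: (extR_fix G Gp gE); rewrite mem_cat hv.
  rewrite !behead_map -!map_comp; apply/eq_in_map => v hv /=; apply: ext_squeeze.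
  by rewrite mem_cat (mem_behead hv).
- move=> phi l ls _ G Gp /mapP[e he ->].
  have [i1 i2 _ _] := edge_ends gE he.
  by rewrite /mapE /= !(extR_fix G Gp gE).
Qed.

Lemma wf_concat D E : wf D -> wf E -> wf (concat D E).
Proof.
move=> wD wE; have [gD mD] := wD; have [gE mE] := wE.
split; first exact: generic_concat.
move=> e f; rewrite !(perm_mem (edges_concat gD gE)) !mem_cat.
move=> /orP[/mapP[e' he ->]|/mapP[e' he ->]] /orP[/mapP[f' hf ->]|/mapP[f' hf ->]].
- by move=> /cross_squeeze cr; rewrite !mark_left //; exact: mD.
- by move=> cr; case: (nocross_concat gD gE he hf) => /(_ cr).
- by move=> cr; case: (nocross_concat gD gE hf he) => _ /(_ cr).
- by move=> /cross_squeeze cr; rewrite !mark_right // !mapEK; exact: mE.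
Qed.

Definition long_knot := {D : diagram | wf D /\ loops D = [::]}.

HB.instance Definition _ := gen_eqMixin long_knot.
HB.instance Definition _ := gen_choiceMixin long_knot.

Lemma concat_subproof (K K' : long_knot) :
  wf (concat (sval K) (sval K')) /\ loops (concat (sval K) (sval K')) = [::].
Proof.
case: K K' => [D [wD lD]] [E [wE lE]] /=; split; first exact: wf_concat.
by rewrite lD lE.
Qed.

Definition concatenation (K K' : long_knot) : long_knot :=
  exist _ (concat (sval K) (sval K')) (concat_subproof K K').

Definition concb (K K' : long_knot) : bool := `[< concordant (sval K) (sval K') >].

Lemma concb_refl : reflexive concb.
Proof. by case=> D [wD lD]; apply/asboolP; exact: concordant_refl. Qed.

Lemma concb_sym : symmetric concb.
Proof. by move=> K K'; apply/asbool_equiv_eq; split; exact: concordant_sym. Qed.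

Lemma concb_trans : transitive concb.
Proof.
by move=> K' K K'' /asboolP h1 /asboolP h2; apply/asboolP; exact: concordant_trans h2.
Qed.

Canonical conc_equiv := EquivRel concb concb_refl concb_sym concb_trans.

(* Isotopies and Reidemeister and detour moves are themselves concordances, so
   classes of diagrams and classes of long virtual knots are the same. *)
Definition VC := {eq_quot conc_equiv}.
HB.instance Definition _ := EqQuotient.on VC.
HB.instance Definition _ := Choice.on VC.

(* Well defined by [pi_VC_mul] below. *)
Definition VC_mul : VC -> VC -> VC := lift_op2 VC concatenation.

Lemma pi_VC_mul : {morph \pi_VC : K K' / concatenation K K' >-> VC_mul K K'}.
Proof.
move=> K K'; unlock VC_mul; apply/eqmodP; rewrite /=.
have cr (X : long_knot) : concordant (sval X) (sval (repr (\pi_VC X))).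
  by apply/asboolP; apply/(@eqmodP _ conc_equiv); rewrite reprK.
apply/asboolP; case: (svalP K') => wK' lK'; case: (svalP (repr (\pi_VC K))) => wK lK.
apply: concordant_trans; first exact: concat_left (cr K).
exact: concat_right (cr K').
Qed.

End Diagrams.

(* Main.v *)
Require Import Defs.
From HB Require Import structures.
From Stdlib Require Import Relation_Operators.
From mathcomp Require Import all_boot all_order all_algebra.
From mathcomp Require Import generic_quotient.
From mathcomp Require Import ring lra zify.
From mathcomp Require Import all_classical all_reals topology normedtype.

(** Two long knots are exhibited for which a numerical concordance invariant takes
    the value 0 on their concatenation in one order and 2 in the other.

    The invariant.  Every strand carries a level [K], which changes by the sign
    [sgn e g] each time the strand [e] crosses another strand [g] at a classical
    crossing, whether over or under.  The relative index of a crossing is the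
    difference of the levels of its two strands there; it is 0 at a kink, equal at
    the two crossings of a poke, and additive around a triangle.  Passing under a
    strand at a crossing of index [j] changes, by the sign of the crossing, a further
    level of the strand, called [A] for [j = 1] and [B] for [j = -1].  The invariant [sC] adds, over the
    crossings of index 2 where [e] passes under [g], the signed difference of the
    level [A] of [e] and the level [B] of [g], and, over the crossings of index 1,
    the signed level [A] of [g].  The combination is dictated by the third
    Reidemeister move: there three crossings have indices [p], [q], [p + q], the
    levels seen by the crossings change with the order in which the strands meet,
    and these changes cancel ([tri_alg]).

    Levels as potentials.  A level of a diagram is a function on its vertices with a
    prescribed increment along each edge, a potential.  On the long component it is
    determined by its value 0 at the left end.  On a circle it need not exist, and
    if it does it is determined up to a constant.  A level is followed through a
    movie as follows.  Each move is read as a map from the components of one of the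
    two diagrams, the finer one, to those of the other; the increments around a
    component add up along this map.  Consider the graph whose nodes are the circles
    occurring in the movie and whose edges are the circles of the finer sides of the
    moves.  The condition on the numbers of births, saddles and deaths says that it
    has as many nodes as edges, and connectedness of the surface says that its
    incidence matrix has trivial kernel.  The matrix is thus invertible.  One
    reading of this is that the increments around every circle sum to 0, so that
    potentials exist; the other is that their constants can be adjusted so that the
    potentials agree across every move ([movie_potentials]).  This is applied to
    [K], then to [A] and [B], whose increments depend on [K].

    Invariance.  A saddle, a birth and an isotopy do not affect the crossings.  Any
    other move replaces one strand by another with the same end points and the same
    total increment, and keeps the increments of all other edges; this is checked
    for each of them ([relisting_step], [subdivision_balanced], the lemmas
    [reidemeister1_step] to [reidemeister3_step], [detour_step]).  Hence
    [concordance_invariance].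

    The example.  The levels of a concatenation run through the first factor and
    then through the second.  Of the knots [marks_a] and [marks_b], the first ends
    with the levels it began with and has a negative crossing of index 2, where it
    contributes the level [B]; the second raises [B] by 2 and contributes nothing.
    So the first contributes 2 after the second, and 0 before it. *)

Set Implicit Arguments.
Unset Strict Implicit.
Unset Printing Implicit Defensive.

Import Order.TTheory GRing.Theory Num.Theory.
Import numFieldNormedType.Exports.

Local Open Scope classical_set_scope.
Local Open Scope ring_scope.

(* The name [comp] by itself denotes the composition of functions. *)
Local Notation component := Defs.comp.

(** * Crossings and the levels of a strand *)

(** The definitions make sense over any ordered domain, so that on a picture with
    integer coordinates the same formulas can be evaluated by computation. *)
Section Levels.
Variable T : realDomainType.
Notation tpt := (T * T)%type.
Notation tedge := (tpt * tpt)%type.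

Definition vec (e : tedge) : tpt := (e.2.1 - e.1.1, e.2.2 - e.1.2).
Definition det (u v : tpt) : T := u.1 * v.2 - u.2 * v.1.
(** The determinants [turn e g] and [lead e g] are the denominator and the
    numerator of the parameter along [e] of its intersection with the line of [g].
    Keeping both avoids division. *)
Definition turn (e g : tedge) : T := det (vec e) (vec g).
Definition lead (e g : tedge) : T := det (vec (e.1, g.1)) (vec g).
(** Both intersection parameters lie strictly between 0 and 1, after multiplication
    by the square of the common denominator. *)
Definition xing (e g : tedge) : bool :=
  (0 < lead e g * turn e g < turn e g ^+ 2) &&
  (0 < lead g e * turn g e < turn g e ^+ 2).
(** Two parameters along [e] are compared after multiplication by both
    denominators; the test is on the sign of their product. *)
Definition before (e g h : tedge) : bool :=
  if 0 < turn e g * turn e h then lead e g * turn e h < lead e h * turn e g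
  else lead e h * turn e g < lead e g * turn e h.
Definition sgn (e g : tedge) : T := Num.sg (turn e g).

(** The value, just before the crossing of [e] with [h], of the level whose values
    at the vertices are [F] and whose jumps at the crossings are [z]. *)
Definition level (E : seq tedge) (z : tedge -> tedge -> T) (F : tpt -> T)
    (e h : tedge) : T :=
  F e.1 + \sum_(g <- E | xing e g && before e g h) z e g.
Definition rise (E : seq tedge) (z : tedge -> tedge -> T) (e : tedge) : T :=
  \sum_(g <- E | xing e g) z e g.
Definition pot (E : seq tedge) (t : tedge -> T) (F : tpt -> T) : Prop :=
  forall e, e \in E -> F e.2 = F e.1 + t e.

Section Jumps.
Variables (E : seq tedge) (m : tedge -> tedge -> marking).

Definition jumpK (e g : tedge) : T := if m e g is Virtual then 0 else sgn e g.
(** The level of [g] before the crossing minus the level of [e] after it. With this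
    choice the index is antisymmetric in the two strands. *)
Definition relidx (K : tpt -> T) (e g : tedge) : T :=
  level E jumpK K g e - level E jumpK K e g - sgn e g.
Definition jumpA (j : T) (K : tpt -> T) (e g : tedge) : T :=
  if m e g is Under then if relidx K e g == j then sgn e g else 0 else 0.
Definition levelA (j : T) K (A : tpt -> T) e g := level E (jumpA j K) A e g.
(** The contribution of a crossing to the invariant. Only these two combinations of
    levels and indices survive the triangle move, see [tri_alg]. *)
Definition jumpC (K A B : tpt -> T) (e g : tedge) : T :=
  if m e g is Under then
    sgn e g * ((if relidx K e g == 2%:R
                then levelA 1 K A e g - levelA (-1) K B g e else 0)
               + (if relidx K e g == 1 then levelA 1 K A g e else 0))
  else 0.
Definition riseK := rise E jumpK.
Definition riseA j K := rise E (jumpA j K).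
Definition riseC K A B := rise E (jumpC K A B).
Definition sumC K A B := \sum_(e <- E) riseC K A B e.

Lemma jumpK_virtual e g : m e g = Virtual -> jumpK e g = 0.
Proof. by rewrite /jumpK => ->. Qed.
Lemma jumpA_virtual j K e g : m e g = Virtual -> jumpA j K e g = 0.
Proof. by rewrite /jumpA => ->. Qed.
Lemma jumpC_virtual K A B e g : m e g = Virtual -> jumpC K A B e g = 0.
Proof. by rewrite /jumpC => ->. Qed.

End Jumps.

Lemma det_swap u v : det u v = - det v u.
Proof. by rewrite /det; ring. Qed.
Lemma turn_swap e g : turn e g = - turn g e.
Proof. exact: det_swap. Qed.
Lemma sgn_swap e g : sgn e g = - sgn g e.
Proof. by rewrite /sgn turn_swap sgrN. Qed.
Lemma turn_self e : turn e e = 0.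
Proof. by rewrite /turn /det; ring. Qed.
Lemma xingC e g : xing e g = xing g e.
Proof. by rewrite /xing andbC. Qed.
Lemma xing_turn e g : xing e g -> turn e g != 0.
Proof.
move=> /andP[/andP[h1 h2] _]; apply/eqP => h; move: h1.
by rewrite h mulr0 ltxx.
Qed.
Lemma xing_self e : xing e e = false.
Proof. by apply/negP => /xing_turn; rewrite turn_self eqxx. Qed.
Lemma xing_neq e g : xing e g -> e != g.
Proof. by apply: contraTN => /eqP->; rewrite xing_self. Qed.

Section Outer.
Variables (E E' E0 S S' : seq tedge).
Hypothesis P : perm_eq E (E0 ++ S).
Hypothesis P' : perm_eq E' (E0 ++ S').

(** Sums over all edges split into a part over [E0], common to both diagrams, and a
    part over [S] or [S'], which vanishes. *)
Lemma level_outer z z' F F' :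
  (forall e g, e \in E0 -> g \in E0 -> xing e g -> z e g = z' e g) ->
  (forall e g, e \in E0 -> g \in S -> xing e g -> z e g = 0) ->
  (forall e g, e \in E0 -> g \in S' -> xing e g -> z' e g = 0) ->
  (forall e, e \in E0 -> F e.1 = F' e.1) ->
  (forall e h, e \in E0 -> level E z F e h = level E' z' F' e h) /\
  (forall e, e \in E0 -> rise E z e = rise E' z' e).
Proof.
move=> zz z0 z0' FF.
have aux p e : e \in E0 -> \sum_(g <- E | xing e g && p g) z e g =
    \sum_(g <- E' | xing e g && p g) z' e g.
  move=> he; rewrite (perm_big _ P) (perm_big _ P') !big_cat /=.
  rewrite [X in _ + X = _]big1_seq; last first.
    by move=> g /andP[/andP[x _] hg]; exact: z0.
  rewrite [X in _ = _ + X]big1_seq; last first.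
    by move=> g /andP[/andP[x _] hg]; exact: z0'.
  rewrite !addr0 big_seq_cond [RHS]big_seq_cond; apply: eq_bigr => g.
  by move=> /andP[hg /andP[x _]]; exact: zz.
split=> [e h he|e he]; first by rewrite /level FF // aux.
by rewrite /rise; have := aux predT e he; under eq_bigl do rewrite andbT;
   under [in RHS]eq_bigl do rewrite andbT.
Qed.

Variables m m' : tedge -> tedge -> marking.
Hypothesis mm : forall e g, e \in E0 -> g \in E0 -> xing e g -> m e g = m' e g.
Hypothesis mS : forall e g, e \in E0 -> g \in S -> xing e g -> m e g = Virtual.
Hypothesis mS' : forall e g, e \in E0 -> g \in S' -> xing e g -> m' e g = Virtual.

Definition agree0 (F F' : tpt -> T) := forall e, e \in E0 -> F e.1 = F' e.1.

Lemma outerK K K' : agree0 K K' ->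
  (forall e h, e \in E0 -> level E (jumpK m) K e h = level E' (jumpK m') K' e h) /\
  (forall e, e \in E0 -> riseK E m e = riseK E' m' e).
Proof.
move=> KK; apply: level_outer => //.
- by move=> e g he hg x; rewrite /jumpK mm.
- by move=> e g he hg x; exact/jumpK_virtual/mS.
- by move=> e g he hg x; exact/jumpK_virtual/mS'.
Qed.

Lemma outer_relidx K K' e g : agree0 K K' -> e \in E0 -> g \in E0 ->
  relidx E m K e g = relidx E' m' K' e g.
Proof. by move=> /outerK[H _] he hg; rewrite /relidx !H. Qed.

Lemma outerA j K K' A A' : agree0 K K' -> agree0 A A' ->
  (forall e h, e \in E0 -> levelA E m j K A e h = levelA E' m' j K' A' e h) /\
  (forall e, e \in E0 -> riseA E m j K e = riseA E' m' j K' e).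
Proof.
move=> KK AA; apply: level_outer => //.
- by move=> e g he hg x; rewrite /jumpA mm // (outer_relidx KK).
- by move=> e g he hg x; exact/jumpA_virtual/mS.
- by move=> e g he hg x; exact/jumpA_virtual/mS'.
Qed.

Lemma outerC K K' A A' B B' : agree0 K K' -> agree0 A A' -> agree0 B B' ->
  forall e, e \in E0 -> riseC E m K A B e = riseC E' m' K' A' B' e.
Proof.
move=> KK AA BB.
have [] // := @level_outer (jumpC E m K A B) (jumpC E' m' K' A' B') K K'.
- move=> e g he hg x; rewrite /jumpC mm // (outer_relidx KK) //.
  have [HA _] := outerA 1 KK AA; have [HB _] := outerA (-1) KK BB.
  by rewrite !HA // HB.
- by move=> e g he hg x; exact/jumpC_virtual/mS.
- by move=> e g he hg x; exact/jumpC_virtual/mS'.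
Qed.

End Outer.
End Levels.

(** * Diagrams read in integer coordinates *)

(** Up to the sign of its determinant an affine chart preserves all the
    combinatorics of crossings, so that questions on a local picture become
    computations with integers. *)
Section Pictures.
Variable R : realType.
Notation pt := (R * R)%type.
Notation edge := (pt * pt)%type.
Notation ipt := (int * int)%type.
Notation iedge := (ipt * ipt)%type.

Variables (p u v : pt).
Hypothesis uv : det u v != 0.

Definition aff (q : ipt) : pt :=
  (p.1 + q.1%:~R * u.1 + q.2%:~R * v.1, p.2 + q.1%:~R * u.2 + q.2%:~R * v.2).
Definition affE (e : iedge) : edge := (aff e.1, aff e.2).

Lemma turn_aff e g : turn (affE e) (affE g) = det u v * (turn e g)%:~R.
Proof. by rewrite /turn /vec /det /affE /aff /=; ring. Qed.

Lemma lead_aff e g : lead (affE e) (affE g) = det u v * (lead e g)%:~R.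
Proof. by rewrite /lead /vec /det /affE /aff /=; ring. Qed.

Let uv2 : 0 < det u v ^+ 2.
Proof. by rewrite lt_def sqr_ge0 sqrf_eq0 uv. Qed.

Lemma ltr_scale (a b : int) (x y c : R) : 0 < c -> x = c * a%:~R -> y = c * b%:~R ->
  (x < y) = (a < b).
Proof. by move=> c0 -> ->; rewrite ltr_pM2l // ltr_int. Qed.

Lemma xing_aff e g : xing (affE e) (affE g) = xing e g.
Proof.
have aux e' g' :
    (0 < lead (affE e') (affE g') * turn (affE e') (affE g')
       < turn (affE e') (affE g') ^+ 2) =
    (0 < lead e' g' * turn e' g' < turn e' g' ^+ 2).
  rewrite !lead_aff !turn_aff; congr andb.
    by apply: (ltr_scale uv2); [rewrite mulr0 | rewrite intrM; ring].
  by apply: (ltr_scale uv2); [rewrite intrM | rewrite expr2 intrM]; ring.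
by rewrite /xing !aux.
Qed.

Lemma before_aff e g h :
  before (affE e) (affE g) (affE h) = before e g h.
Proof.
rewrite /before !lead_aff !turn_aff.
have -> : (0 < det u v * (turn e g)%:~R * (det u v * (turn e h)%:~R)) =
    (0 < turn e g * turn e h).
  by apply: (ltr_scale uv2); [rewrite mulr0 | rewrite intrM; ring].
by case: ifP => _; apply: (ltr_scale uv2); rewrite intrM; ring.
Qed.

Lemma sgn_aff e g : sgn (affE e) (affE g) = Num.sg (det u v) * (sgn e g)%:~R.
Proof. by rewrite /sgn turn_aff sgrM -intr_sg. Qed.

Lemma aff_inj : injective aff.
Proof.
move=> [a b] [c d] [h1 h2].
have e1 : det u v * (a - c)%:~R = 0.
  by move: h1 h2; rewrite /det /= => h1 h2; rewrite intrB;
     transitivity ((p.1 + a%:~R * u.1 + b%:~R * v.1 - (p.1 + c%:~R * u.1 + d%:~R * v.1)) * v.2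
       - (p.2 + a%:~R * u.2 + b%:~R * v.2 - (p.2 + c%:~R * u.2 + d%:~R * v.2)) * v.1);
     [ring | rewrite h1 h2; ring].
have e2 : det u v * (b - d)%:~R = 0.
  by move: h1 h2; rewrite /det /= => h1 h2; rewrite intrB;
     transitivity ((p.2 + a%:~R * u.2 + b%:~R * v.2 - (p.2 + c%:~R * u.2 + d%:~R * v.2)) * u.1
       - (p.1 + a%:~R * u.1 + b%:~R * v.1 - (p.1 + c%:~R * u.1 + d%:~R * v.1)) * u.2);
     [ring | rewrite h1 h2; ring].
move/eqP: e1; rewrite mulf_eq0 (negbTE uv) intr_eq0 subr_eq0 => /eqP->.
by move/eqP: e2; rewrite mulf_eq0 (negbTE uv) intr_eq0 subr_eq0 => /eqP->.
Qed.

Variables (E E0 : seq edge) (S : seq iedge).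
Hypothesis P : perm_eq E (E0 ++ map affE S).
Hypothesis nox : forall e g, e \in S -> g \in E0 -> ~~ xing (affE e) g.

(** The picture [S] fills a part of the diagram that the other edges do not cross,
    whence sums over all edges reduce to sums over [S]. *)
Lemma block_sum (z : edge -> edge -> R) (q : pred edge) e : e \in S ->
  \sum_(g <- E | xing (affE e) g && q g) z (affE e) g =
  \sum_(g <- [seq g <- S | xing e g && q (affE g)]) z (affE e) (affE g).
Proof.
move=> he; rewrite (perm_big _ P) big_cat /= big1_seq ?add0r; last first.
  by move=> g /andP[/andP[x _]] /(nox he); rewrite x.
by rewrite big_map big_filter; apply: eq_bigl => g; rewrite xing_aff.
Qed.

Lemma level_block (z : edge -> edge -> R) (F : pt -> R) e h : e \in S ->
  level E z F (affE e) (affE h) = F (aff e.1) +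
  \sum_(g <- [seq g <- S | xing e g && before e g h]) z (affE e) (affE g).
Proof.
move=> he; rewrite /level block_sum //; congr (_ + _).
by apply: congr_big => //; apply: eq_filter => g; rewrite before_aff.
Qed.

Lemma rise_block (z : edge -> edge -> R) e : e \in S ->
  rise E z (affE e) = \sum_(g <- [seq g <- S | xing e g]) z (affE e) (affE g).
Proof.
move=> he; rewrite /rise; have := @block_sum z predT e he.
under eq_bigl do rewrite andbT; move=> ->; apply: congr_big => //.
by apply: eq_filter => g; rewrite andbT.
Qed.

End Pictures.

(** * The components of a diagram *)

Section Components.
Variable R : realType.
Notation pt := (R * R)%type.
Notation edge := (pt * pt)%type.
Notation diagram := (diagram R).

Definition conn (E : seq edge) : pt -> pt -> Prop :=
  clos_refl_sym_trans pt (fun v w => (v, w) \in E).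

Lemma conn_step E e : e \in E -> conn E e.1 e.2.
Proof. by move=> he; apply: rst_step; rewrite -surjective_pairing. Qed.
Lemma conn_sub E E' v w : {subset E <= E'} -> conn E v w -> conn E' v w.
Proof.
by move=> s; apply: (@crst_map _ _ _ _ id) => x y h; apply: rst_step; exact: s.
Qed.
Lemma conn_map E E' (rho : pt -> pt) v w :
  (forall e, e \in E -> conn E' (rho e.1) (rho e.2)) ->
  conn E v w -> conn E' (rho v) (rho w).
Proof. by move=> H; apply: crst_map => x y; exact: (H (x, y)). Qed.
Lemma conn_fun E (A : Type) (f : pt -> A) v w :
  (forall e, e \in E -> f e.1 = f e.2) -> conn E v w -> f v = f w.
Proof.
move=> H; elim=> [x y /H //|//|x y _ -> //|x y z _ -> _ -> //].
Qed.

Lemma path_edges_cons x y (l : seq pt) :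
  path_edges (x :: y :: l) = (x, y) :: path_edges (y :: l).
Proof. by []. Qed.

Lemma conn_path (l : seq pt) x v : v \in x :: l -> conn (path_edges (x :: l)) x v.
Proof.
elim: l x => [|y l IH] x; first by rewrite inE => /eqP->; exact: rst_refl.
rewrite inE => /orP[/eqP->|/IH c]; first exact: rst_refl.
apply: (rst_trans _ _ _ y); first by apply: rst_step; rewrite path_edges_cons inE eqxx.
by apply: conn_sub c => e he; rewrite path_edges_cons inE he orbT.
Qed.

Lemma path_edges_cat_sub (l l1 : seq pt) e : e \in path_edges l -> e \in path_edges (l ++ l1).
Proof.
elim: l => [|x [|y l] IH] //; rewrite path_edges_cons inE => /orP[/eqP->|/IH h].
  by rewrite /= path_edges_cons inE eqxx.
by rewrite /= path_edges_cons inE; apply/orP; right.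
Qed.

Lemma loop_edgesE x (l : seq pt) :
  loop_edges (x :: l) = path_edges (x :: rcons l x).
Proof.
rewrite /loop_edges /path_edges rot1_cons.
rewrite [behead _]/=.
have zr (s t : seq pt) z : size t = size s -> zip (rcons s z) t = zip s t.
  by elim: s t => [|a s IH] [|b t] //= [/IH->].
by rewrite -rcons_cons zr // size_rcons.
Qed.

Lemma unzip1_path x (l : seq pt) : unzip1 (path_edges (x :: l)) = belast x l.
Proof. by elim: l x => [//|y l IH] x; rewrite path_edges_cons /= IH. Qed.
Lemma unzip2_path x (l : seq pt) : unzip2 (path_edges (x :: l)) = l.
Proof. by elim: l x => [//|y l IH] x; rewrite path_edges_cons /= IH. Qed.
Lemma unzip1_loop (l : seq pt) : unzip1 (loop_edges l) = l.
Proof. by case: l => [//|x l]; rewrite loop_edgesE unzip1_path belast_rcons. Qed.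
Lemma unzip2_loop (l : seq pt) : unzip2 (loop_edges l) = rot 1 l.
Proof. by case: l => [//|x l]; rewrite loop_edgesE unzip2_path rot1_cons. Qed.

(** The number of the component through a vertex, in the numbering of the
    cobordism: 0 for the long component, then the circles. *)
Definition cidx (D : diagram) (v : pt) : nat :=
  find (fun l : seq pt => v \in l) (long D :: loops D).

Definition gen (D : diagram) := generic (long D) (loops D).

Section OneDiagram.
Variable D : diagram.
Hypothesis G : gen D.

Lemma long_shape : exists m, long D = (ptL R) :: rcons m (ptR R).
Proof. by case: G. Qed.

Lemma uniq_starts : uniq (unzip1 (edges D)).
Proof.
have [[m El] [U _] _ _ _] := G.
have -> : unzip1 (edges D) = ptL R :: m ++ flatten (loops D).
  rewrite /edges /edges_of /unzip1 map_cat El -[map _ _]/(unzip1 _) unzip1_path.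
  rewrite belast_rcons /= map_flatten -map_comp; congr (_ :: _ ++ flatten _).
  by rewrite -[RHS]map_id; apply: eq_map => l /=; exact: unzip1_loop.
apply: subseq_uniq U; rewrite El /=; rewrite eqxx cat_rcons.
by apply: cat_subseq => //; exact: subseq_cons.
Qed.

Lemma perm_ends : perm_eq (ptL R :: unzip2 (edges D)) (vertices D).
Proof.
have [[m El] _ _ _ _] := G.
rewrite /vertices /edges /edges_of /unzip2 map_cat El -[map _ _]/(unzip2 _) unzip2_path.
rewrite /= perm_cons perm_cat2l map_flatten -map_comp.
elim: (loops D) => //= l ls IH; apply: perm_cat => //.
by have := unzip2_loop l; rewrite /unzip2 /= => ->; rewrite perm_rot.
Qed.

Lemma uniq_ends : uniq (unzip2 (edges D)).
Proof.
have [_ [U _] _ _ _] := G.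
by move: U; rewrite -/(vertices D) -(perm_uniq perm_ends) /= => /andP[].
Qed.

Lemma end_neqL e : e \in edges D -> e.2 != ptL R.
Proof. by move=> he; have [] := edge_ends G he. Qed.
Lemma edge_vertices e : e \in edges D -> e.1 \in vertices D /\ e.2 \in vertices D.
Proof. by move=> he; have [] := edge_ends G he. Qed.

Lemma comps_flatten : vertices D = flatten (long D :: loops D).
Proof. by []. Qed.

Lemma has_comp v : (v \in vertices D) = has (fun l : seq pt => v \in l) (long D :: loops D).
Proof.
rewrite comps_flatten; apply/flattenP/hasP => -[l h1 h2]; by exists l.
Qed.

Lemma cidx_lt v : (v \in vertices D) = (cidx D v < ncomp D)%N.
Proof. by rewrite has_comp has_find. Qed.

Lemma cidx_mem v : v \in vertices D -> v \in component D (cidx D v).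
Proof. by rewrite has_comp => h; exact: (nth_find [::] h). Qed.

(** Uniqueness of the vertices makes the components disjoint. *)
Lemma mem_comp v c : v \in component D c -> v \in vertices D /\ cidx D v = c.
Proof.
move=> h.
have ltc : (c < ncomp D)%N.
  by rewrite ltnNge; apply/negP => le; move: h; rewrite /Defs.comp nth_default.
have hv : v \in vertices D.
  by rewrite comps_flatten; apply/flattenP; exists (component D c) => //; apply: mem_nth.
split=> //.
have [_ [U _] _ _ _] := G; move: U; rewrite -/(vertices D) comps_flatten.
have := cidx_mem hv; have := hv; rewrite cidx_lt.
move: h ltc; rewrite /Defs.comp /ncomp; move: (cidx D v) c.
have -> : (size (loops D)).+1 = size (long D :: loops D) by [].
elim: (long D :: loops D) => [|l s IH] [|a] [|b] //= hb lb la ha; rewrite cat_uniq.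
- case/and3P => _ /hasPn /(_ v) H _; exfalso; move: (H); rewrite ha => /(_ _)/negP[] //.
  by apply/flattenP; exists (nth [::] s b) => //; exact: mem_nth.
- case/and3P => _ /hasPn /(_ v) H _; exfalso; move: (H); rewrite hb => /(_ _)/negP[] //.
  by apply/flattenP; exists (nth [::] s a) => //; exact: mem_nth.
- by case/and3P => _ _ /(IH _ _ hb lb la ha) ->.
Qed.

Lemma loop_sub l : l \in loops D -> {subset loop_edges l <= edges D}.
Proof.
move=> hl e he; rewrite mem_cat; apply/orP; right; apply/flattenP.
by exists (loop_edges l) => //; exact: map_f.
Qed.

Definition comp_edges (c : nat) : seq edge :=
  if c is c'.+1 then loop_edges (component D c) else path_edges (long D).

Lemma edges_comp e : e \in edges D -> exists2 c, (c < ncomp D)%N & e \in comp_edges c.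
Proof.
rewrite mem_cat => /orP[he|/flattenP[_ /mapP[l hl ->] he]]; first by exists 0%N.
exists (index l (loops D)).+1; first by rewrite ltnS index_mem.
by rewrite /comp_edges /Defs.comp /= nth_index.
Qed.

Lemma comp_edges_mem c e : e \in comp_edges c -> e.1 \in component D c /\ e.2 \in component D c.
Proof.
case: c => [|c] /=; last by move/mem_zip_pair; rewrite mem_rot.
by move/mem_zip_pair => -[h1 h2]; split=> //; exact: mem_behead.
Qed.

Lemma comp_edges_sub c e : (c < ncomp D)%N -> e \in comp_edges c -> e \in edges D.
Proof.
case: c => [|c] hc /=; first by rewrite mem_cat => ->.
by apply: loop_sub; exact: mem_nth.
Qed.

Lemma edge_cidx e : e \in edges D -> cidx D e.1 = cidx D e.2.
Proof.
by move=> /edges_comp[c _ /comp_edges_mem[/mem_comp[_ ->] /mem_comp[_ ->]]].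
Qed.

Lemma conn_cidx v w : conn (edges D) v w -> cidx D v = cidx D w.
Proof. by apply: conn_fun => e; exact: edge_cidx. Qed.

Definition chead (c : nat) : pt := head (ptL R) (component D c).

Lemma comp_nonempty c : (c < ncomp D)%N -> exists x l, component D c = x :: l.
Proof.
case: c => [_|c]; first by have [m E] := long_shape; exists (ptL R), (rcons m (ptR R)).
rewrite /ncomp ltnS => hc; have [_ [_ S] _ _ _] := G.
have := S _ (mem_nth [::] hc); rewrite /Defs.comp /=.
by case: (nth _ _ _) => // x l _; exists x, l.
Qed.

Lemma chead_mem c : (c < ncomp D)%N -> chead c \in component D c.
Proof.
by move=> /comp_nonempty[x [l]]; rewrite /chead => ->; rewrite inE eqxx.
Qed.

Lemma conn_chead v : v \in vertices D -> conn (edges D) (chead (cidx D v)) v.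
Proof.
move=> hv; have hc := hv; rewrite cidx_lt in hc.
have := cidx_mem hv; have [x [l El]] := comp_nonempty hc.
rewrite /chead El => h; apply: conn_sub (conn_path h) => e he.
apply: (comp_edges_sub hc); rewrite /comp_edges.
case: (cidx D v) El => [|c] El; first by move: El; rewrite /Defs.comp /= => ->.
by rewrite El loop_edgesE -rcons_cons -cats1 path_edges_cat_sub.
Qed.

(** Together with [conn_cidx] this identifies components with classes of the
    relation [conn], which are easier to follow through a change of edges than
    positions in lists. *)
Lemma cidx_conn v w : v \in vertices D -> w \in vertices D ->
  cidx D v = cidx D w -> conn (edges D) v w.
Proof.
move=> hv hw E; apply: (rst_trans _ _ _ (chead (cidx D v))).
  by apply: rst_sym; exact: conn_chead.
by rewrite E; exact: conn_chead.
Qed.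

Lemma cidx_vertices v w : cidx D v = cidx D w -> (v \in vertices D) = (w \in vertices D).
Proof. by rewrite !cidx_lt => ->. Qed.

Lemma ptL_long : ptL R \in component D 0.
Proof. by have [m E] := long_shape; rewrite /Defs.comp /= E inE eqxx. Qed.
Lemma ptL_vertex : ptL R \in vertices D. Proof. by case: (mem_comp ptL_long). Qed.
Lemma cidxL : cidx D (ptL R) = 0%N. Proof. by case: (mem_comp ptL_long). Qed.

Lemma chead_cidx c : (c < ncomp D)%N -> chead c \in vertices D /\ cidx D (chead c) = c.
Proof. by move=> /chead_mem/mem_comp. Qed.

End OneDiagram.

Lemma uniq_edges (D : diagram) : gen D -> uniq (edges D).
Proof. by move=> /uniq_starts; exact: map_uniq. Qed.

(** The map of components induced by a map [rho] of vertices that sends edges to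
    connected pairs; by [comp_mapE] any vertex may replace the first one. *)
Definition comp_map (X Y : diagram) (rho : pt -> pt) (c : nat) : nat :=
  cidx Y (rho (chead X c)).

Record carries (X Y : diagram) (rho : pt -> pt) : Prop := Carries {
  carries_vertex : forall v, v \in vertices X -> rho v \in vertices Y;
  carries_edge : forall e, e \in edges X -> conn (edges Y) (rho e.1) (rho e.2);
  carriesL : rho (ptL R) = ptL R }.

Lemma comp_mapE X Y rho v : gen X -> gen Y -> carries X Y rho -> v \in vertices X ->
  comp_map X Y rho (cidx X v) = cidx Y (rho v).
Proof.
move=> GX GY [_ H _] hv; apply: conn_cidx => //.
by apply: conn_map H _; exact: conn_chead.
Qed.

Lemma comp_map0 X Y rho : gen X -> gen Y -> carries X Y rho -> comp_map X Y rho 0 = 0%N.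
Proof.
move=> GX GY C; rewrite -{1}(cidxL GX) comp_mapE //; last exact: ptL_vertex.
by rewrite (carriesL C) cidxL.
Qed.

Lemma comp_map_lt X Y rho c : gen X -> gen Y -> carries X Y rho -> (c < ncomp X)%N ->
  (comp_map X Y rho c < ncomp Y)%N.
Proof.
move=> GX GY C /(chead_cidx GX)[h _]; rewrite -cidx_lt //; exact: (carries_vertex C).
Qed.

End Components.

(** * Square systems and potentials on one diagram *)

Section SquareSystem.
Variables (F : fieldType) (V E : eqType) (vs : seq V) (es : seq E).
Variable B : V -> E -> F.

(** For a square matrix, triviality of the left kernel gives at once uniqueness for
    one system and existence for the transposed one. *)
Lemma square_system : size vs = size es -> uniq vs -> uniq es ->
  (forall phi : V -> F, (forall e, e \in es -> \sum_(v <- vs) phi v * B v e = 0) ->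
     forall v, v \in vs -> phi v = 0) ->
  (forall y : E -> F, (forall v, v \in vs -> \sum_(e <- es) B v e * y e = 0) ->
     forall e, e \in es -> y e = 0) /\
  (forall d : E -> F, exists phi : V -> F,
     forall e, e \in es -> \sum_(v <- vs) phi v * B v e = d e).
Proof.
move=> sz uv ue ker.
case: vs es sz uv ue ker => [|v0 vs'] [|e0 es'] //.
  by move=> _ _ _ _; split=> // d; exists (fun=> 0).
set vv := v0 :: vs'; set ee := e0 :: es' => sz uv ue ker.
pose n := size vv.
have ltE i : (i < n)%N -> (i < size ee)%N by rewrite /n sz.
pose A : 'M[F]_n := \matrix_(i, j) B (nth v0 vv i) (nth e0 ee j).
have sumV (f : V -> F) : \sum_(v <- vv) f v = \sum_(i < n) f (nth v0 vv i).
  by rewrite (big_nth v0) big_mkord.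
have sumE (f : E -> F) : \sum_(e <- ee) f e = \sum_(i < n) f (nth e0 ee i).
  by rewrite (big_nth e0) big_mkord /n sz.
have Au : A \in unitmx.
  rewrite -row_free_unit; apply: inj_row_free => u uA.
  pose phi v := if insub (index v vv) is Some i then u 0 i else 0.
  have phiE (i : 'I_n) : phi (nth v0 vv i) = u 0 i.
    by rewrite /phi index_uniq // insubT //= => h; congr (u 0 _); exact: val_inj.
  apply/rowP => i; rewrite mxE -phiE; apply: ker; last exact: mem_nth.
  move=> e he; have hi : (index e ee < n)%N by rewrite /n sz index_mem.
  move/rowP/(_ (Ordinal hi)): uA; rewrite !mxE => uA; rewrite sumV -[RHS]uA.
  by apply: eq_bigr => j _; rewrite phiE mxE /= nth_index.
split=> [y hy e he|d].
  pose Y : 'cV[F]_n := \col_j y (nth e0 ee j).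
  have AY : A *m Y = 0.
    apply/colP => i; rewrite !mxE -[RHS](hy (nth v0 vv i)); last exact: mem_nth.
    by rewrite sumE; apply: eq_bigr => j _; rewrite !mxE.
  have Y0 : Y = 0 by rewrite -[Y](mulKmx Au) AY mulmx0.
  have hi : (index e ee < n)%N by rewrite /n sz index_mem.
  by move/colP/(_ (Ordinal hi)): Y0; rewrite !mxE /= nth_index.
have [u uA] : exists u : 'rV[F]_n, u *m A = \row_j d (nth e0 ee j).
  by exists ((\row_j d (nth e0 ee j)) *m invmx A); rewrite mulmxKV.
pose phi v := if insub (index v vv) is Some i then u 0 i else 0.
have phiE (i : 'I_n) : phi (nth v0 vv i) = u 0 i.
  by rewrite /phi index_uniq // insubT //= => h; congr (u 0 _); exact: val_inj.
exists phi => e he; have hi : (index e ee < n)%N by rewrite /n sz index_mem.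
move/rowP/(_ (Ordinal hi)): uA; rewrite !mxE /= nth_index // => <-.
by rewrite sumV; apply: eq_bigr => j _; rewrite phiE !mxE /= nth_index.
Qed.

Lemma sum_delta (r : seq V) (phi : V -> F) w : uniq r ->
  \sum_(v <- r) phi v * (v == w)%:R = if w \in r then phi w else 0.
Proof.
move=> ur; case: ifP => hw; last first.
  rewrite big1_seq // => v /= hv; case: eqP => [vw|]; last by rewrite mulr0.
  by move: hw; rewrite -vw hv.
rewrite (bigD1_seq w) //= eqxx mulr1 big1 ?addr0 // => v /negbTE->.
by rewrite mulr0.
Qed.
End SquareSystem.

Section Potentials.
Variable R : realType.
Notation pt := (R * R)%type.
Notation edge := (pt * pt)%type.
Notation diagram := (diagram R).

(** The total increment around a component; on a circle it is the obstruction to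
    the existence of a potential. *)
Definition holonomy (D : diagram) (t : edge -> R) (c : nat) : R :=
  \sum_(e <- edges D | cidx D e.1 == c) t e.

Lemma holonomy_loop D t c : gen D -> (c < size (loops D))%N ->
  holonomy D t c.+1 = \sum_(e <- loop_edges (nth [::] (loops D) c)) t e.
Proof.
move=> G hc.
have long0 e : e \in path_edges (long D) -> cidx D e.1 = 0%N.
  by move=> he; have [/(mem_comp G)[]] := @comp_edges_mem R D 0 e he.
rewrite /holonomy /edges /edges_of big_cat /= big1_seq ?add0r; last first.
  by move=> e /andP[/eqP h /long0]; rewrite h.
have idxl i e : (i < size (loops D))%N -> e \in loop_edges (nth [::] (loops D) i) ->
    cidx D e.1 = i.+1.
  by move=> hi he; have [/(mem_comp G)[]] := @comp_edges_mem R D i.+1 e he.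
rewrite big_flatten /= big_map (big_nth [::]) big_mkord.
rewrite (bigD1 (Ordinal hc)) //= [X in _ + X]big1 ?addr0; last first.
  move=> i /eqP ne; rewrite big1_seq // => e /andP[/eqP h].
  move=> /(idxl _ _ (ltn_ord i)); rewrite h => -[ci].
  by case: ne; apply: val_inj.
rewrite big_seq_cond [RHS]big_seq; apply: eq_bigl => e.
by apply/andP/idP => [[]//|he]; split=> //; rewrite (idxl _ _ hc he).
Qed.

Definition prefix_sum (E : seq edge) (t : edge -> R) (i : nat) : R :=
  \sum_(e <- take i E) t e.

Lemma prefix_sumS E t i e0 : (i < size E)%N ->
  prefix_sum E t i.+1 = prefix_sum E t i + t (nth e0 E i).
Proof. by move=> hi; rewrite /prefix_sum (take_nth e0) // -cats1 big_cat big_seq1. Qed.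

Lemma uniq_comp (D : diagram) c : gen D -> (c < ncomp D)%N -> uniq (component D c).
Proof.
move=> [_ [U _] _ _ _]; move: U; rewrite -/(vertices D) comps_flatten.
rewrite /Defs.comp /ncomp -[(size _).+1]/(size (long D :: loops D)).
elim: (long D :: loops D) c => [//|l s IH] [|c] /=; rewrite cat_uniq => /and3P[U1 _ U2] //.
by rewrite ltnS; exact: IH.
Qed.

(** Partial sums of the increments along each component; around a circle they close
    up because the holonomy vanishes. *)
Lemma pot_exists D t : gen D ->
  (forall c, (c < size (loops D))%N -> holonomy D t c.+1 = 0) ->
  exists F, pot (edges D) t F /\ F (ptL R) = 0.
Proof.
move=> G H0.
pose F v := let c := cidx D v in
  prefix_sum (comp_edges D c) t (index v (component D c)).
exists F; split; last first.
  rewrite /F (cidxL G); have [m E] := long_shape G.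
  by rewrite /Defs.comp /= E /= eqxx /prefix_sum take0 big_nil.
have ucomp c : (c < ncomp D)%N -> uniq (component D c) by exact: uniq_comp.
move=> e he; have [c hc hec] := edges_comp he.
have [/(mem_comp G)[_ E1] /(mem_comp G)[_ E2]] := comp_edges_mem hec.
rewrite /F E1 E2; have uc := ucomp c hc.
have [x0 [l El]] := comp_nonempty G hc.
have sz : size (comp_edges D c) = size l \/
    (size (comp_edges D c) = (size l).+1 /\ exists c', c = c'.+1).
  case: c {hc E1 E2 uc} hec El => [|c] hec El; [left|right; split; last by exists c].
    by move: El; rewrite /Defs.comp /comp_edges /= => ->; rewrite size_zip /= minnC; apply/minn_idPl.
  by rewrite /= size_zip size_rot minnn El.
have nthE i : (i < size (comp_edges D c))%N ->
    nth (x0, x0) (comp_edges D c) i =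
    (nth x0 (component D c) i, nth x0 (component D c) (if i == size l then 0 else i.+1)).
  case: c {hc E1 E2 uc hec} sz El => [|c] sz El.
    move: El sz; rewrite /Defs.comp /comp_edges /= => El sz hi.
    have hi' : (i < size l)%N by case: sz hi => [->|[_ [//]]].
    rewrite /path_edges El nth_zip_cond ifT /= ?(ltn_eqF hi') //.
    by rewrite size_zip leq_min /= hi' ltnS ltnW.
  move=> hi; rewrite /= /loop_edges nth_zip ?size_rot //; congr pair.
  rewrite El rot1_cons nth_rcons; case: ltngtP => //= hl.
    by move: hi; rewrite /= size_zip size_rot minnn El /= ltnS leqNgt hl.
pose i := index e (comp_edges D c).
have hi : (i < size (comp_edges D c))%N by rewrite index_mem.
have Ee : e = nth (x0, x0) (comp_edges D c) i by rewrite nth_index.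
have hil : (i < size (component D c))%N.
  by rewrite El /=; case: sz hi => [->|[-> _]] //; exact: ltnW.
have I1 : index e.1 (component D c) = i.
  by rewrite Ee nthE //= index_uniq.
rewrite I1; case: (altP (i =P size l)) => hl.
  (* The closing edge of a circle, which returns to its first vertex. *)
  have [szE|[szE [c' Ec]]] := sz; first by move: hi; rewrite szE hl ltnn.
  have -> : index e.2 (component D c) = 0%N.
    by rewrite Ee nthE //= hl eqxx El /= eqxx.
  rewrite {1}Ee -prefix_sumS // hl -szE.
  rewrite /prefix_sum take0 big_nil take_size Ec.
  by rewrite Ec ltnS in hc; rewrite -[RHS](holonomy_loop t G hc) H0.
have -> : index e.2 (component D c) = i.+1.
  rewrite Ee nthE //= (negbTE hl) index_uniq // El /= ltnS ltn_neqAle hl.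
  by move: hil; rewrite El ltnS.
by rewrite {1}Ee -prefix_sumS.
Qed.

End Potentials.

(** * Potentials along a movie *)

Section Movie.
Variable R : realType.
Notation pt := (R * R)%type.
Notation edge := (pt * pt)%type.
Notation diagram := (diagram R).

(** Of the two diagrams of a move, the components of the finer one map to those of
    the coarser one: at a saddle, the side with one component more; at a birth, the
    side before it, whose components persist. *)
Definition finer (b : bool) (D D' : diagram) := if b then D' else D.
Definition coarser (b : bool) (D D' : diagram) := if b then D else D'.

(** The topology of one move [k] from [D] to [D']. The map [rho] of vertices, from
    the finer to the coarser diagram, induces a map of components that tells which
    of them bound a common component of the trace. The vertices [kept] are those at
    which potentials on the two sides can be compared. By the last field the number
    of circles of the finer side is the average of the numbers before and after the
    move, corrected by the kind of move. *)
Record topo (k : kind) (D D' : diagram) (b : bool) (rho : pt -> pt)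
    (kept : pt -> Prop) : Prop := Topo {
  topo_carries : carries (finer b D D') (coarser b D D') rho;
  topo_keptL : kept (ptL R);
  topo_kept : forall v, kept v -> v \in vertices (finer b D D');
  topo_linked : forall c c', linked k D D' c c' ->
    (c < ncomp D)%N = (c' < ncomp D')%N /\
    ((c < ncomp D)%N ->
     let pi := comp_map (finer b D D') (coarser b D D') rho in
     if b then c = pi c' else c' = pi c);
  topo_count : ((size (loops (finer b D D'))).*2 + is_birth k + is_death k =
    size (loops D) + size (loops D') + is_saddle k)%N }.

(** The increments [tX] and [tY] are compatible with the map of components.
    Potentials on the two sides then differ by a constant on each component of the
    finer diagram. *)
Record conserved (X Y : diagram) (rho : pt -> pt) (kept : pt -> Prop)
    (tX tY : edge -> R) : Prop := Conserved {
  conserved_holonomy : forall y, holonomy Y tY y =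
    \sum_(e <- edges X | cidx Y (rho e.1) == y) tX e;
  conserved_pot : forall F F', pot (edges X) tX F -> pot (edges Y) tY F' ->
    forall v w, kept v -> kept w -> cidx X v = cidx X w ->
    F v - F' (rho v) = F w - F' (rho w) }.

Variables (N : nat) (k : nat -> kind) (M : nat -> diagram).
Hypothesis gM : forall i, (i <= N)%N -> gen (M i).
Hypothesis M0 : loops (M 0%N) = [::].
Hypothesis MN : loops (M N) = [::].
Hypothesis conM : connected_movie N k M.
Hypothesis cnt : (count_moves is_birth N k)%:Z - (count_moves is_saddle N k)%:Z
      + (count_moves is_death N k)%:Z = 0.
Variables (b : nat -> bool) (rho : nat -> pt -> pt) (kept : nat -> pt -> Prop).
Hypothesis tM : forall i, (i < N)%N ->
  topo (k i) (M i) (M i.+1) (b i) (rho i) (kept i).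

Let xi j := if b j then j.+1 else j.
Let yi j := if b j then j else j.+1.
Let pi j := comp_map (M (xi j)) (M (yi j)) (rho j).
Let nl i := size (loops (M i)).

Lemma finerE j : finer (b j) (M j) (M j.+1) = M (xi j).
Proof. by rewrite /finer /xi; case: (b j). Qed.
Lemma coarserE j : coarser (b j) (M j) (M j.+1) = M (yi j).
Proof. by rewrite /coarser /yi; case: (b j). Qed.

Lemma xi_le j : (j < N)%N -> (xi j <= N)%N.
Proof. by rewrite /xi; case: (b j) => // /ltnW. Qed.
Lemma yi_le j : (j < N)%N -> (yi j <= N)%N.
Proof. by rewrite /yi; case: (b j) => // /ltnW. Qed.

Lemma carriesM j : (j < N)%N -> carries (M (xi j)) (M (yi j)) (rho j).
Proof. by move=> /tM/topo_carries; rewrite finerE coarserE. Qed.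

Lemma pi0 j : (j < N)%N -> pi j 0 = 0%N.
Proof.
move=> hj; apply: comp_map0 (carriesM hj); apply: gM; [exact: xi_le | exact: yi_le].
Qed.

Let vs : seq (nat * nat) := [seq (i, c) | i <- iota 0 N.+1, c <- iota 1 (nl i)].
Let es : seq (nat * nat) := [seq (j, x) | j <- iota 0 N, x <- iota 1 (nl (xi j))].

Lemma iota0 n : iota 0 n = index_iota 0 n.
Proof. by rewrite /index_iota subn0. Qed.

Lemma mem_vs i c : ((i, c) \in vs) = [&& (i <= N)%N, (0 < c)%N & (c < ncomp (M i))%N].
Proof.
apply/allpairsPdep/idP => [[i' [c' [h1 h2 [-> ->]]]]|/and3P[h1 h2 h3]].
  by move: h1 h2; rewrite !mem_iota add0n add1n ltnS => /andP[_ ->] /andP[-> ->].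
by exists i, c; rewrite !mem_iota add0n add1n ltnS h1 h2.
Qed.

Lemma mem_es j x : ((j, x) \in es) = [&& (j < N)%N, (0 < x)%N & (x < ncomp (M (xi j)))%N].
Proof.
apply/allpairsPdep/idP => [[i' [c' [h1 h2 [-> ->]]]]|/and3P[h1 h2 h3]].
  by move: h1 h2; rewrite !mem_iota add0n add1n => /andP[_ ->] /andP[-> ->].
by exists j, x; rewrite !mem_iota add0n add1n h1 h2.
Qed.

Lemma uniq_vs : uniq vs.
Proof.
by apply: allpairs_uniq_dep; rewrite ?iota_uniq //;
   [move=> *; exact: iota_uniq | move=> [a c] [a' c'] _ _ [-> ->]].
Qed.
Lemma uniq_es : uniq es.
Proof.
by apply: allpairs_uniq_dep; rewrite ?iota_uniq //;
   [move=> *; exact: iota_uniq | move=> [a c] [a' c'] _ _ [-> ->]].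
Qed.

(** The movie begins and ends without circles, and the numbers of births, saddles
    and deaths balance. *)
Lemma size_vs : size vs = size es.
Proof.
have -> : size vs = (\sum_(i < N.+1) nl i)%N.
  rewrite size_allpairs_dep sumnE big_map iota0 big_mkord.
  by apply: eq_bigr => i _; rewrite size_iota.
have -> : size es = (\sum_(i < N) nl (xi i))%N.
  rewrite size_allpairs_dep sumnE big_map iota0 big_mkord.
  by apply: eq_bigr => i _; rewrite size_iota.
have nl0 : nl 0 = 0%N by rewrite /nl M0.
have nlN : nl N = 0%N by rewrite /nl MN.
have E : (\sum_(i < N) ((nl (xi i)).*2 + is_birth (k i) + is_death (k i)) =
          \sum_(i < N) (nl i + nl i.+1 + is_saddle (k i)))%N.
  apply: eq_bigr => i _; have := topo_count (tM (ltn_ord i)).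
  by rewrite finerE.
have bal : (count_moves is_birth N k + count_moves is_death N k)%N = count_moves is_saddle N k.
  move: cnt; lia.
have S1 : (\sum_(i < N) nl i = \sum_(i < N.+1) nl i)%N.
  by rewrite [RHS]big_ord_recr /= nlN addn0.
have S2 : (\sum_(i < N) nl i.+1 = \sum_(i < N.+1) nl i)%N.
  by rewrite [RHS]big_ord_recl /= nl0 add0n.
move: E; rewrite !big_split /= S1 S2.
have -> : (\sum_(i < N) (nl (xi i)).*2 = (\sum_(i < N) nl (xi i)).*2)%N.
  by rewrite -mul2n big_distrr /=; apply: eq_bigr => i _; rewrite mul2n.
move: bal; rewrite /count_moves -addnn.
move: (\sum_(i < N) nl (xi i))%N (\sum_(i < N.+1) nl i)%N (\sum_(i < N) is_birth (k i))%N
  (\sum_(i < N) is_death (k i))%N (\sum_(i < N) is_saddle (k i))%N; lia.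
Qed.

(** The incidence matrix of the graph with nodes the circles of all diagrams and
    edges the circles of the finer sides. The long component is left out; an edge
    that leads to it has only one end. *)
Let B (v e : nat * nat) : R := (v == (xi e.1, e.2))%:R - (v == (yi e.1, pi e.1 e.2))%:R.

Lemma sum_B (phi : nat * nat -> R) e : e \in es ->
  \sum_(v <- vs) phi v * B v e = phi (xi e.1, e.2) -
    (if (yi e.1, pi e.1 e.2) \in vs then phi (yi e.1, pi e.1 e.2) else 0).
Proof.
case: e => j x; rewrite mem_es => /and3P[hj x0 hx] /=.
under eq_bigr do rewrite mulrBr.
rewrite sumrB !sum_delta ?uniq_vs // mem_vs /= x0 hx xi_le //.
Qed.

(** A vector in the left kernel is constant along the traces; extended by 0 to the
    long components it is constant on the whole surface, which is connected. *)
Lemma kernel_trivial (phi : nat * nat -> R) :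
  (forall e, e \in es -> \sum_(v <- vs) phi v * B v e = 0) ->
  forall v, v \in vs -> phi v = 0.
Proof.
move=> H [i c] hv; pose ph v := if v \in vs then phi v else 0.
have eqn j x : (j < N)%N -> (x < ncomp (M (xi j)))%N ->
    ph (xi j, x) = ph (yi j, pi j x).
  move=> hj hx; case: x hx => [|x] hx.
    by rewrite pi0 // /ph !mem_vs /= !andbF.
  have he : (j, x.+1) \in es by rewrite mem_es hj hx.
  have := H _ he; rewrite sum_B //= -/(ph (yi j, pi j x.+1)) => /subr0_eq <-.
  by rewrite /ph mem_vs xi_le //= hx.
have tr x y : trace N k M x y -> ph x = ph y.
  case: x y => [j a] [j' a'] [/= hj -> lk].
  have [valid lk'] := topo_linked (tM hj) lk.
  case ha: (a < ncomp (M j))%N; last first.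
    by rewrite /ph !mem_vs -valid ha !andbF.
  have := lk' ha; rewrite finerE coarserE -/(pi j) /=.
  have := @eqn j; move: valid; rewrite /pi /xi /yi ha.
  case: (b j) => valid Q E; first by rewrite E -Q.
  by rewrite E -Q.
have := hv; rewrite mem_vs => /and3P[hi _ hc].
have E : ph (0%N, 0%N) = ph (i, c).
  have := conM hi hc; elim=> [x y /tr //|//|x y _ -> //|x y z _ -> _ -> //].
by move: E; rewrite /ph mem_vs hv /= => <-.
Qed.

Variable t : nat -> edge -> R.
Hypothesis tcons : forall j, (j < N)%N ->
  conserved (M (xi j)) (M (yi j)) (rho j) (kept j) (t (xi j)) (t (yi j)).

(** Conservation, with both sides grouped by component. *)
Lemma holonomy_fibre j y : (j < N)%N -> (0 < y)%N ->
  holonomy (M (yi j)) (t (yi j)) y =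
  \sum_(x <- iota 1 (nl (xi j)) | pi j x == y) holonomy (M (xi j)) (t (xi j)) x.
Proof.
move=> hj y0; have gX := gM (xi_le hj); have gY := gM (yi_le hj).
have -> : \sum_(x <- iota 1 (nl (xi j)) | pi j x == y) holonomy (M (xi j)) (t (xi j)) x =
    \sum_(x <- iota 0 (ncomp (M (xi j))) | pi j x == y) holonomy (M (xi j)) (t (xi j)) x.
  by rewrite /ncomp /= big_cons pi0 //; case: y y0.
rewrite (conserved_holonomy (tcons hj)).
rewrite big_mkcond /= [RHS]big_mkcond /=.
under [RHS]eq_bigr => x _.
  rewrite /holonomy -[X in if _ then X else _]mul1r -[X in if _ then _ else X](mul0r
    (\sum_(e <- edges (M (xi j)) | cidx (M (xi j)) e.1 == x) t (xi j) e)).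
  rewrite -(fun_if (fun z => z * _)) big_mkcond /= big_distrr /=.
  over.
rewrite exchange_big /= big_seq [RHS]big_seq; apply: eq_bigr => e he.
have [h1 _] := edge_vertices gX he.
have lt : (cidx (M (xi j)) e.1 < ncomp (M (xi j)))%N by rewrite -cidx_lt.
have mi : cidx (M (xi j)) e.1 \in iota 0 (ncomp (M (xi j))) by rewrite mem_iota.
rewrite (bigD1_seq _ mi (iota_uniq _ _)) /=.
rewrite big1 ?addr0; last by move=> x /negbTE; rewrite eq_sym => ->; rewrite mulr0.
rewrite eqxx [pi j _](comp_mapE gX gY (carriesM hj) h1).
by case: ifP => _; rewrite ?mul1r ?mul0r.
Qed.

(** The holonomies, with a sign for the direction of each move, form a flow on the
    graph: at each node the sum over the incoming edges and the sum over the
    outgoing edges are both the holonomy of that node. The incidence matrix is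
    invertible, so the flow vanishes. *)
Lemma holonomy0 i c : (i <= N)%N -> (c < nl i)%N -> holonomy (M i) (t i) c.+1 = 0.
Proof.
have [flow _] := square_system size_vs uniq_vs uniq_es kernel_trivial.
(* The sign orients the edges of the graph along the movie. *)
pose s j : R := if b j then -1 else 1.
have hX j x : (j < N)%N -> (x < nl (xi j))%N -> holonomy (M (xi j)) (t (xi j)) x.+1 = 0.
  move=> hj hx; have := flow (fun e => s e.1 * holonomy (M (xi e.1)) (t (xi e.1)) e.2).
  move=> /(_ _ (j, x.+1)); rewrite mem_es hj /= /ncomp ltnS hx => /(_ _ isT)/= H.
  suff : s j * holonomy (M (xi j)) (t (xi j)) x.+1 = 0.
    by rewrite /s; case: (b j); rewrite ?mulN1r ?mul1r // => /eqP; rewrite oppr_eq0 => /eqP.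
  apply: H => -[i' c']; rewrite mem_vs => /and3P[hi' c0' hc'].
  rewrite big_allpairs_dep /= iota0.
  have inner j' : (j' < N)%N ->
     \sum_(x <- iota 1 (nl (xi j'))) B (i', c') (j', x) * (s j' * holonomy (M (xi j')) (t (xi j')) x)
     = ((i' == j')%:R - (i' == j'.+1)%:R) * holonomy (M i') (t i') c'.
    move=> hj'; under eq_bigr do rewrite mulrBl.
    rewrite sumrB.
    have -> : \sum_(x <- iota 1 (nl (xi j')))
        ((i', c') == (xi j', x))%:R * (s j' * holonomy (M (xi j')) (t (xi j')) x) =
        (i' == xi j')%:R * (s j' * holonomy (M i') (t i') c').
      case: (eqVneq i' (xi j')) => [Ei|ne]; last first.
        by rewrite mul0r big1 // => x' _; rewrite xpair_eqE (negbTE ne) mul0r.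
      rewrite mul1r (bigD1_seq c') ?iota_uniq //=; last first.
        by rewrite mem_iota c0' add1n -Ei.
      rewrite -Ei eqxx mul1r big1 ?addr0 // => x' ne.
      by rewrite xpair_eqE [c' == _]eq_sym (negbTE ne) andbF mul0r.
    have -> : \sum_(x <- iota 1 (nl (xi j')))
        ((i', c') == (yi j', pi j' x))%:R * (s j' * holonomy (M (xi j')) (t (xi j')) x) =
        (i' == yi j')%:R * (s j' * holonomy (M i') (t i') c').
      case: (eqVneq i' (yi j')) => [Ei|ne]; last first.
        by rewrite mul0r big1 // => x' _; rewrite xpair_eqE (negbTE ne) mul0r.
      rewrite mul1r Ei holonomy_fibre // big_distrr /= [RHS]big_mkcond /=.
      apply: eq_bigr => x' _; rewrite xpair_eqE eqxx /= eq_sym.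
      by case: ifP; rewrite ?mul1r ?mul0r.
    by rewrite /s /xi /yi; case: (b j'); ring.
  rewrite big_seq; under eq_bigr => j' do [rewrite mem_index_iota => /= hj'; rewrite inner //].
  rewrite -big_seq -big_distrl /=.
  suff -> : \sum_(0 <= j' < N) ((i' == j')%:R - (i' == j'.+1)%:R : R) = 0 by rewrite mul0r.
  have i0 : (0 < i')%N.
    rewrite lt0n; apply/eqP => Ei.
    by move: hc'; rewrite Ei /ncomp M0 /= ltnS leqNgt c0'.
  have iN : (i' < N)%N.
    rewrite ltn_neqAle hi' andbT; apply/eqP => Ei.
    by move: hc'; rewrite Ei /ncomp MN /= ltnS leqNgt c0'.
  (* At an inner time each node is met once as the end and once as the beginning of
     a move. *)
  have tel n : \sum_(0 <= j' < n) ((i' == j')%:R - (i' == j'.+1)%:R : R) = - (i' == n)%:R + (i' == 0%N)%:R.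
    elim: n => [|n IH]; first by rewrite big_nil; ring.
    by rewrite big_nat_recr //= IH; ring.
  by rewrite tel (gtn_eqF i0) (ltn_eqF iN) oppr0 addr0.
move=> hi hc.
have iN : (i < N)%N.
  by rewrite ltn_neqAle hi andbT; apply/eqP => Ei; move: hc; rewrite Ei /nl MN.
case Ex: (xi i == i).
  by move/eqP: Ex => Ex; have := hX i c iN; rewrite Ex; apply.
have Ey : yi i = i by move: Ex; rewrite /xi /yi; case: (b i) => //; rewrite eqxx.
have := holonomy_fibre iN (ltn0Sn c); rewrite Ey => ->.
rewrite big_seq_cond big1 // => x /andP[]; rewrite mem_iota add1n.
by case: x => // x /andP[_ hx] _; exact: hX.
Qed.

(** Potentials exist by [holonomy0]. Across each move they differ by constants, one
    for each circle of the finer side; removing them amounts to solving a system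
    whose matrix is the transposed incidence matrix. *)
Theorem movie_potentials : exists F : nat -> pt -> R,
  (forall i, (i <= N)%N -> pot (edges (M i)) (t i) (F i) /\ F i (ptL R) = 0) /\
  (forall j, (j < N)%N -> forall v, kept j v -> F (xi j) v = F (yi j) (rho j v)).
Proof.
have [_ solve] := square_system size_vs uniq_vs uniq_es kernel_trivial.
have /boolp.choice[F0 HF0] i : exists F : pt -> R, (i <= N)%N ->
    pot (edges (M i)) (t i) F /\ F (ptL R) = 0.
  case: (leqP i N) => hi; last by exists (fun=> 0).
  have [F HF] := pot_exists (gM hi) (fun c hc => holonomy0 hi hc).
  by exists F.
have /boolp.choice[cst Hcst] (jx : nat * nat) : exists d : R, (jx.1 < N)%N ->
    forall v, kept jx.1 v -> cidx (M (xi jx.1)) v = jx.2 ->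
    F0 (xi jx.1) v - F0 (yi jx.1) (rho jx.1 v) = d.
  case: jx => j x /=.
  have [[v [kv vx]]|none] := pselect (exists v, kept j v /\ cidx (M (xi j)) v = x).
    exists (F0 (xi j) v - F0 (yi j) (rho j v)) => hj w kw wx.
    have [pX _] := HF0 _ (xi_le hj); have [pY _] := HF0 _ (yi_le hj).
    by apply: (conserved_pot (tcons hj) pX pY) => //; rewrite wx vx.
  by exists 0 => hj v kv vx; case: none; exists v.
have [phi Hphi] := solve (fun e => - cst e).
(* The correction is 0 on the long components, where the value at the left end is
   already common. *)
pose ph v := if v \in vs then phi v else 0.
exists (fun i v => F0 i v + ph (i, cidx (M i) v)); split.
  move=> i hi; have [p0 pL] := HF0 i hi; split.
    by move=> e he; rewrite p0 // -(edge_cidx (gM hi) he); ring.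
  by rewrite pL cidxL ?add0r; [rewrite /ph mem_vs /= andbF | exact: gM].
move=> j hj v kv; have gX := gM (xi_le hj); have gY := gM (yi_le hj).
have hv : v \in vertices (M (xi j)).
  by have := topo_kept (tM hj) kv; rewrite finerE.
set x := cidx (M (xi j)) v.
have hx : (x < ncomp (M (xi j)))%N by rewrite -cidx_lt.
have Ecst := Hcst (j, x) hj v kv erefl.
rewrite -(comp_mapE gX gY (carriesM hj) hv) -/(pi j) -/x.
suff : ph (xi j, x) - ph (yi j, pi j x) = - cst (j, x).
  by rewrite -Ecst /=; set u := ph _; set w := ph _ => H; lra.
case: (posnP x) => x0.
  rewrite x0 pi0 // /ph !mem_vs /= !andbF subr0.
  have kL := topo_keptL (tM hj).
  have := Hcst (j, 0%N) hj (ptL R) kL (cidxL gX) => /= <-.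
  rewrite (carriesL (carriesM hj)).
  have [_ ->] := HF0 _ (xi_le hj); have [_ ->] := HF0 _ (yi_le hj).
  by rewrite subr0 oppr0.
have he : (j, x) \in es by rewrite mem_es hj x0 hx.
rewrite -(Hphi _ he) sum_B //= /ph; congr (_ - _).
by rewrite mem_vs xi_le //= x0 hx.
Qed.

End Movie.

(** * Replacing one strand *)

Section Strands.
Variable R : realType.
Notation pt := (R * R)%type.
Notation edge := (pt * pt)%type.
Notation diagram := (diagram R).

Definition strand (a : pt) (u : seq pt) (b : pt) : seq edge := path_edges (a :: rcons u b).

Lemma strand1 a u b : unzip1 (strand a u b) = a :: u.
Proof. by rewrite unzip1_path belast_rcons. Qed.
Lemma strand2 a u b : unzip2 (strand a u b) = rcons u b.
Proof. by rewrite unzip2_path. Qed.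

Lemma strand_mem1 a u b e : e \in strand a u b -> e.1 \in a :: u.
Proof. by move=> he; rewrite -(strand1 a u b); exact: map_f. Qed.
Lemma strand_mem2 a u b e : e \in strand a u b -> e.2 \in rcons u b.
Proof. by move=> he; rewrite -(strand2 a u b); exact: map_f. Qed.

Lemma pot_path (x : pt) l t F : pot (path_edges (x :: l)) t F ->
  F (last x l) = F x + \sum_(e <- path_edges (x :: l)) t e.
Proof.
elim: l x => [|y l IH] x H; first by rewrite /path_edges /= big_nil addr0.
rewrite path_edges_cons big_cons /= IH; last first.
  by move=> e he; apply: H; rewrite path_edges_cons inE he orbT.
by rewrite (H (x, y)) ?path_edges_cons ?inE ?eqxx //= addrA.
Qed.

Lemma pot_strand a u b t F : pot (strand a u b) t F ->
  F b = F a + \sum_(e <- strand a u b) t e.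
Proof. by move/pot_path; rewrite last_rcons. Qed.

Lemma pot_sub E E' t (F : pt -> R) : {subset E <= E'} -> pot E' t F -> pot E t F.
Proof. by move=> s H e /s; exact: H. Qed.

Lemma conn_strand a u b v : v \in a :: rcons u b -> conn (strand a u b) a v.
Proof. exact: conn_path. Qed.

(** A sum over the edges of one strand: they all lie on one component. *)
Lemma big_const_cond (s : seq edge) (q : pred edge) (c : bool) (f : edge -> R) :
  (forall e, e \in s -> q e = c) ->
  \sum_(e <- s | q e) f e = if c then \sum_(e <- s) f e else 0.
Proof.
move=> H; case: c H => H; last by rewrite big1_seq // => e /andP[qe /H]; rewrite qe.
by rewrite big_seq_cond [RHS]big_seq; apply: eq_bigl => e; case he: (e \in s); rewrite //= H.
Qed.

Section OneStrand.
Variables (D : diagram) (a b : pt) (u : seq pt) (E : seq edge).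
Hypothesis G : gen D.
Hypothesis P : perm_eq (edges D) (strand a u b ++ E).

Lemma strand_sub : {subset strand a u b <= edges D}.
Proof. by move=> e he; rewrite (perm_mem P) mem_cat he. Qed.
Lemma rest_sub : {subset E <= edges D}.
Proof. by move=> e he; rewrite (perm_mem P) mem_cat he orbT. Qed.

Lemma strand_starts : uniq ((a :: u) ++ unzip1 E).
Proof.
have := uniq_starts G; rewrite (perm_uniq (perm_map _ P)) map_cat.
by rewrite -/(unzip1 _) strand1.
Qed.
Lemma strand_ends : uniq (rcons u b ++ unzip2 E).
Proof.
have := uniq_ends G; rewrite (perm_uniq (perm_map _ P)) map_cat.
by rewrite -/(unzip2 _) strand2.
Qed.

Lemma start_notin : a \notin u.
Proof. by have := strand_starts; rewrite /= mem_cat negb_or => /andP[/andP[]]. Qed.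
Lemma end_notin : b \notin u.
Proof. by have := strand_ends; rewrite cat_uniq rcons_uniq => /andP[/andP[]]. Qed.
Lemma rest_start e : e \in E -> e.1 \notin a :: u.
Proof.
have := strand_starts; rewrite cat_uniq => /and3P[_ /hasPn H _] he.
apply: H. exact: (map_f fst he).
Qed.
Lemma rest_end e : e \in E -> e.2 \notin rcons u b.
Proof.
have := strand_ends; rewrite cat_uniq => /and3P[_ /hasPn H _] he.
apply: H. exact: (map_f snd he).
Qed.
Lemma rest_start_in e : e \in E -> e.1 \notin u.
Proof. by move/rest_start; rewrite inE negb_or => /andP[]. Qed.
Lemma rest_end_in e : e \in E -> e.2 \notin u.
Proof. by move/rest_end; rewrite mem_rcons inE negb_or => /andP[]. Qed.
Lemma ends_strand v : v \in rcons u b -> v \in unzip2 (edges D).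
Proof.
by move=> h; rewrite (perm_mem (perm_map _ P)) map_cat -/(unzip2 _) strand2 mem_cat h.
Qed.
Lemma strand_neqL v : v \in rcons u b -> v != ptL R.
Proof. by move/ends_strand/mapP => [e he ->]; exact: (end_neqL G he). Qed.
Lemma strand_vertex v : v \in a :: rcons u b -> v \in vertices D.
Proof.
rewrite inE => /orP[/eqP->|/ends_strand/mapP[e he ->]]; last by case: (edge_vertices G he).
have : a \in unzip1 (edges D).
  by rewrite (perm_mem (perm_map _ P)) map_cat -/(unzip1 _) strand1 inE eqxx.
by case/mapP => e he ->; case: (edge_vertices G he).
Qed.
Lemma ptL_notin : ptL R \notin u.
Proof.
apply/negP => h; have := @strand_neqL (ptL R); rewrite mem_rcons inE h orbT eqxx.
by move/(_ isT).
Qed.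
Lemma vertex_cases v : v \in vertices D ->
  [\/ v = ptL R, v \in rcons u b | exists2 e, e \in E & v = e.2].
Proof.
rewrite -(perm_mem (perm_ends G)) inE => /orP[/eqP->|]; first by constructor 1.
rewrite (perm_mem (perm_map _ P)) map_cat -/(unzip2 _) strand2 mem_cat.
by move=> /orP[h|/mapP[e he ->]]; [constructor 2 | constructor 3; exists e].
Qed.
Lemma strand_cidx v : v \in a :: rcons u b -> cidx D a = cidx D v.
Proof. by move=> h; exact: (conn_cidx G (conn_sub strand_sub (conn_strand h))). Qed.
End OneStrand.

Lemma leq_ncomp (X Y : diagram) (f g : nat -> nat) :
  (forall c, (c < ncomp X)%N -> (f c < ncomp Y)%N /\ g (f c) = c) ->
  (ncomp X <= ncomp Y)%N.
Proof.
move=> H; rewrite -(size_iota 0 (ncomp X)) -(size_map f) -(size_iota 0 (ncomp Y)).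
apply: uniq_leq_size.
  rewrite map_inj_in_uniq ?iota_uniq // => x y.
  rewrite !mem_iota !add0n => hx hy E.
  by have [_ <-] := H _ hx; have [_ <-] := H _ hy; rewrite E.
by move=> _ /mapP[x hx ->]; move: hx; rewrite !mem_iota !add0n => /H[].
Qed.

Definition collapse (a : pt) (u : seq pt) (v : pt) : pt := if v \in u then a else v.

Section Restrand.
Variables (D D' : diagram) (E : seq edge) (a b : pt) (u u' : seq pt).
Hypothesis G : gen D.
Hypothesis G' : gen D'.
Hypothesis P : perm_eq (edges D) (strand a u b ++ E).
Hypothesis P' : perm_eq (edges D') (strand a u' b ++ E).

Lemma restrand_common v : v \in vertices D -> v \notin u -> v \in vertices D'.
Proof.
move=> /(vertex_cases G P)[->|h|[e he ->]] nu; first exact: ptL_vertex.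
  move: h nu; rewrite mem_rcons inE => /orP[/eqP-> _|->//].
  by apply: (strand_vertex G' P'); rewrite inE mem_rcons inE eqxx orbT.
by case: (edge_vertices G' (rest_sub P' he)).
Qed.

(** The other edges keep their end points, and the two strands connect the same
    pair of points. *)
Lemma restrand_carries : carries D D' (collapse a u).
Proof.
split.
- move=> v hv; rewrite /collapse; case: ifP => h; last exact: restrand_common (negbT h).
  by apply: (strand_vertex G' P'); rewrite inE eqxx.
- move=> e; rewrite (perm_mem P) mem_cat => /orP[he|he]; last first.
    rewrite /collapse (negbTE (rest_start_in G P he)) (negbTE (rest_end_in G P he)).
    exact/conn_step/(rest_sub P').
  have -> : collapse a u e.1 = a.
    rewrite /collapse; case: ifP => // h.
    by have := strand_mem1 he; rewrite inE h orbF => /eqP.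
  rewrite /collapse; case: ifP => h; first exact: rst_refl.
  have := strand_mem2 he; rewrite mem_rcons inE h orbF => /eqP->.
  apply: (conn_sub (strand_sub P')); apply: conn_strand.
  by rewrite inE mem_rcons inE eqxx orbT.
- by rewrite /collapse (negbTE (ptL_notin G P)).
Qed.

Definition unmoved (D : diagram) (u : seq pt) (v : pt) : Prop :=
  v \in vertices D /\ v \notin u.
End Restrand.

(** Going back and forth returns to the same component, so that neither diagram has
    more components than the other. *)
Lemma restrand_ncomp D D' E a b u u' : gen D -> gen D' ->
  perm_eq (edges D) (strand a u b ++ E) -> perm_eq (edges D') (strand a u' b ++ E) ->
  (ncomp D <= ncomp D')%N.
Proof.
move=> G G' P P'.
have C := restrand_carries G G' P P'; have C' := restrand_carries G' G P' P.
apply: (@leq_ncomp D D' (comp_map D D' (collapse a u)) (comp_map D' D (collapse a u'))).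
move=> c hc; split; first exact: (comp_map_lt G G' C).
have [hv <-] := chead_cidx G hc; move: (chead D c) hv => v hv.
rewrite (comp_mapE G G' C hv) (comp_mapE G' G C') ?(carries_vertex C) //.
rewrite /collapse; case: (boolP (v \in u)) => h.
  rewrite (negbTE (start_notin G' P')); apply: (strand_cidx G P).
  by rewrite inE mem_rcons inE h !orbT.
case: ifP => // h'; have [vL|vr|[e he ve]] := vertex_cases G P hv.
- by move: (ptL_notin G' P'); rewrite -vL h'.
- move: vr; rewrite mem_rcons inE (negbTE h) orbF => /eqP vb.
  by move: (end_notin G' P'); rewrite -vb h'.
- by move: (rest_end_in G' P' he); rewrite -ve h'.
Qed.

Lemma restrand_topo D D' E a b u u' : gen D -> gen D' ->
  perm_eq (edges D) (strand a u b ++ E) -> perm_eq (edges D') (strand a u' b ++ E) ->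
  topo Rewriting D D' false (collapse a u) (unmoved D u).
Proof.
move=> G G' P P'; have C := restrand_carries G G' P P'; split=> //=.
- by split; [exact: ptL_vertex | exact: ptL_notin P].
- by move=> v [].
- move=> c c' [v /(mem_comp G)[hv <-] /(mem_comp G')[hv' <-]].
  split; first by rewrite -!cidx_lt // hv hv'.
  move=> _; rewrite (comp_mapE G G' C hv) /collapse; case: ifP => // h.
  apply/esym/(strand_cidx G' P').
  have [vL|vr|[e he ve]] := vertex_cases G' P' hv'.
  + by move: (ptL_notin G P); rewrite -vL h.
  + by rewrite inE vr orbT.
  + by move: (rest_end_in G P he); rewrite -ve h.
- have := restrand_ncomp G G' P P'; have := restrand_ncomp G' G P' P.
  rewrite /ncomp -addnn; lia.
Qed.

(** Equal totals along the two strands make up for the different inner vertices. *)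
Lemma restrand_conserved D D' E a b u u' (t t' : edge -> R) : gen D -> gen D' ->
  perm_eq (edges D) (strand a u b ++ E) -> perm_eq (edges D') (strand a u' b ++ E) ->
  (forall e, e \in E -> t e = t' e) ->
  \sum_(e <- strand a u b) t e = \sum_(e <- strand a u' b) t' e ->
  conserved D D' (collapse a u) (unmoved D u) t t'.
Proof.
move=> G G' P P' tE tP; split.
  move=> y; rewrite /holonomy (perm_big _ P') [RHS](perm_big _ P) !big_cat /=.
  congr (_ + _); last first.
    rewrite big_seq_cond [RHS]big_seq_cond; apply: eq_big => e; last by move=> /andP[/tE].
    case he: (e \in E) => //=; rewrite /collapse.
    by rewrite (negbTE (rest_start_in G P he)).
  rewrite (@big_const_cond _ _ (cidx D' a == y)); last first.
    move=> e /strand_mem1 he; rewrite -(strand_cidx G' P') //.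
    by move: he; rewrite !inE mem_rcons inE => /orP[->|->]; rewrite ?orbT.
  rewrite [RHS](@big_const_cond _ _ (cidx D' a == y)) ?tP // => e /strand_mem1.
  by rewrite inE /collapse; case: ifP => [//|_]; rewrite orbF => /eqP->.
move=> F F' pF pF'.
have tr e : e \in edges D ->
    F (collapse a u e.1) - F' (collapse a u e.1) =
    F (collapse a u e.2) - F' (collapse a u e.2).
  rewrite (perm_mem P) mem_cat => /orP[he|he]; last first.
    rewrite /collapse (negbTE (rest_start_in G P he)) (negbTE (rest_end_in G P he)).
    by rewrite (pF _ (rest_sub P he)) (pF' _ (rest_sub P' he)) tE //; ring.
  have -> : collapse a u e.1 = a.
    rewrite /collapse; case: ifP => // h.
    by have := strand_mem1 he; rewrite inE h orbF => /eqP.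
  rewrite /collapse; case: ifP => [//|h].
  have := strand_mem2 he; rewrite mem_rcons inE h orbF => /eqP->.
  rewrite (pot_strand (pot_sub (strand_sub P) pF)) (pot_strand (pot_sub (strand_sub P') pF')).
  by rewrite tP; ring.
move=> v w [hv nv] [hw nw] E0; have := conn_fun (f := fun x => F (collapse a u x) - F' (collapse a u x)) tr (cidx_conn G hv hw E0).
by rewrite /collapse (negbTE nv) (negbTE nw).
Qed.

End Strands.

(** * Two strands *)

Section TwoStrands.
Variable R : realType.
Notation pt := (R * R)%type.
Notation edge := (pt * pt)%type.
Notation diagram := (diagram R).

Section Bifurcation.
Variables (Z : diagram) (a1 b1 a2 b2 : pt) (x1 x2 : seq pt) (E : seq edge).
Hypothesis G : gen Z.
Hypothesis P : perm_eq (edges Z) (strand a1 x1 b1 ++ (strand a2 x2 b2 ++ E)).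

Lemma two_swap : perm_eq (edges Z) (strand a2 x2 b2 ++ (strand a1 x1 b1 ++ E)).
Proof. by apply: perm_trans P _; rewrite perm_catCA. Qed.
Let P2 := two_swap.

Definition collapse2 (v : pt) : pt := collapse a1 x1 (collapse a2 x2 v).

Lemma two_E e : e \in E -> e \in edges Z.
Proof. by move=> he; rewrite (perm_mem P) !mem_cat he !orbT. Qed.

Lemma mem_strand_start a x b : exists2 e, e \in strand a x b & e.1 = a :> pt.
Proof.
rewrite /strand; case E1: (rcons x b) => [|n s]; first by case: x E1.
by exists (a, n); rewrite // path_edges_cons inE eqxx.
Qed.
Lemma mem_strand_end a x b : exists2 e, e \in strand a x b & e.2 = b :> pt.
Proof.
have : b \in unzip2 (strand a x b) by rewrite strand2 mem_rcons inE eqxx.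
by move=> /mapP[e he Eb]; exists e.
Qed.

Lemma starts_neq : a1 != a2.
Proof.
have [e he <-] := mem_strand_start a2 x2 b2.
have := @rest_start _ _ _ _ _ _ G P e; rewrite mem_cat he => /(_ isT).
by rewrite inE negb_or eq_sym => /andP[].
Qed.
Lemma start2_notin1 : a2 \notin x1.
Proof.
have [e he <-] := mem_strand_start a2 x2 b2.
by apply: (rest_start_in G P); rewrite mem_cat he.
Qed.
Lemma end2_notin1 : b2 \notin x1.
Proof.
have [e he <-] := mem_strand_end a2 x2 b2.
by apply: (rest_end_in G P); rewrite mem_cat he.
Qed.
Lemma start1_notin2 : a1 \notin x2.
Proof.
have [e he <-] := mem_strand_start a1 x1 b1.
by apply: (rest_start_in G P2); rewrite mem_cat he.
Qed.
Lemma end1_notin2 : b1 \notin x2.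
Proof.
have [e he <-] := mem_strand_end a1 x1 b1.
by apply: (rest_end_in G P2); rewrite mem_cat he.
Qed.

Lemma in1_notin2 v : v \in x1 -> v \notin x2.
Proof.
move=> h; have : v \in unzip1 (strand a1 x1 b1) by rewrite strand1 inE h orbT.
by move=> /mapP[e he ->]; apply: (rest_start_in G P2); rewrite mem_cat he.
Qed.

Lemma col_fix v : v \notin x1 -> v \notin x2 -> collapse2 v = v.
Proof. by move=> h1 h2; rewrite /collapse2 /collapse (negbTE h2) (negbTE h1). Qed.

Lemma col_in1 v : v \in x1 -> collapse2 v = a1.
Proof. by move=> h; rewrite /collapse2 /collapse (negbTE (in1_notin2 h)) h. Qed.
Lemma col_in2 v : v \in x2 -> collapse2 v = a2.
Proof. by move=> h; rewrite /collapse2 /collapse h (negbTE start2_notin1). Qed.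

Lemma col_E e : e \in E -> collapse2 e.1 = e.1 /\ collapse2 e.2 = e.2.
Proof.
move=> he; have he1 : e \in strand a2 x2 b2 ++ E by rewrite mem_cat he orbT.
have he2 : e \in strand a1 x1 b1 ++ E by rewrite mem_cat he orbT.
split; apply: col_fix.
- exact: rest_start_in G P _ he1.
- exact: rest_start_in G P2 _ he2.
- exact: rest_end_in G P _ he1.
- exact: rest_end_in G P2 _ he2.
Qed.
Lemma col_a1 : collapse2 a1 = a1.
Proof. by apply: col_fix; [exact: start_notin G P | exact: start1_notin2]. Qed.
Lemma col_b1 : collapse2 b1 = b1.
Proof. by apply: col_fix; [exact: end_notin G P | exact: end1_notin2]. Qed.
Lemma col_a2 : collapse2 a2 = a2.
Proof. by apply: col_fix; [exact: start2_notin1 | exact: start_notin G P2]. Qed.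
Lemma col_b2 : collapse2 b2 = b2.
Proof. by apply: col_fix; [exact: end2_notin1 | exact: end_notin G P2]. Qed.
Lemma colL : collapse2 (ptL R) = ptL R.
Proof. by apply: col_fix; [exact: ptL_notin G P | exact: ptL_notin G P2]. Qed.

Lemma col_strand1 v : v \in a1 :: rcons x1 b1 -> collapse2 v = a1 \/ collapse2 v = b1.
Proof.
rewrite inE mem_rcons inE => /or3P[/eqP->|/eqP->|/col_in1]; last by left.
  by left; exact: col_a1.
by right; exact: col_b1.
Qed.
Lemma col_strand2 v : v \in a2 :: rcons x2 b2 -> collapse2 v = a2 \/ collapse2 v = b2.
Proof.
rewrite inE mem_rcons inE => /or3P[/eqP->|/eqP->|/col_in2]; last by left.
  by left; exact: col_a2.
by right; exact: col_b2.
Qed.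
Lemma strand_endpoints (a : pt) x b e : e \in strand a x b ->
  e.1 \in a :: rcons x b /\ e.2 \in a :: rcons x b.
Proof.
move=> he; have := strand_mem1 he; have := strand_mem2 he => h2 h1; split.
  by move: h1; rewrite !inE mem_rcons inE => /orP[->|->]; rewrite ?orbT.
by rewrite inE h2 orbT.
Qed.

Lemma col_cidx v : v \in vertices Z -> cidx Z (collapse2 v) = cidx Z v.
Proof.
move=> hv; case: (boolP (v \in x1)) => h1.
  by rewrite col_in1 //; apply: (strand_cidx G P); rewrite inE mem_rcons inE h1 !orbT.
case: (boolP (v \in x2)) => h2.
  by rewrite col_in2 //; apply: (strand_cidx G P2); rewrite inE mem_rcons inE h2 !orbT.
by rewrite col_fix.
Qed.

Lemma two_a1 : a1 \in vertices Z. Proof. by apply: (strand_vertex G P); rewrite inE eqxx. Qed.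
Lemma two_a2 : a2 \in vertices Z. Proof. by apply: (strand_vertex G P2); rewrite inE eqxx. Qed.
Lemma two_b1 : b1 \in vertices Z.
Proof. by apply: (strand_vertex G P); rewrite inE mem_rcons inE eqxx orbT. Qed.
Lemma two_b2 : b2 \in vertices Z.
Proof. by apply: (strand_vertex G P2); rewrite inE mem_rcons inE eqxx orbT. Qed.
Lemma cidx_b1 : cidx Z b1 = cidx Z a1.
Proof. by symmetry; apply: (strand_cidx G P); rewrite inE mem_rcons inE eqxx orbT. Qed.
Lemma cidx_b2 : cidx Z b2 = cidx Z a2.
Proof. by symmetry; apply: (strand_cidx G P2); rewrite inE mem_rcons inE eqxx orbT. Qed.

Lemma col_vertex v : v \in vertices Z -> collapse2 v \in vertices Z.
Proof. by move=> hv; rewrite (cidx_vertices (col_cidx hv)). Qed.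

Lemma col_notin v : collapse2 v \notin x1 /\ collapse2 v \notin x2.
Proof.
case: (boolP (v \in x1)) => h1.
  by rewrite col_in1 //; split; [exact: start_notin G P | exact: start1_notin2].
case: (boolP (v \in x2)) => h2; last by rewrite col_fix.
by rewrite col_in2 //; split; [exact: start2_notin1 | exact: start_notin G P2].
Qed.

Lemma two_cases v : v \in vertices Z -> v \notin x1 -> v \notin x2 ->
  [\/ v = ptL R, v = b1, v = b2 | exists2 e, e \in E & v = e.2].
Proof.
move=> hv n1 n2; move: hv; rewrite -(perm_mem (perm_ends G)) inE.
move=> /orP[/eqP->|]; first by constructor 1.
rewrite (perm_mem (perm_map _ P)) !map_cat -!/(unzip2 _) !strand2 !mem_cat !mem_rcons !inE.
rewrite (negbTE n1) (negbTE n2) !orbF => /or3P[/eqP->|/eqP->|/mapP[e he ->]].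
- by constructor 2.
- by constructor 3.
- by constructor 4; exists e.
Qed.

(** After its first edge, a strand reaches its end without passing through its
    start again. *)
Lemma strand_tail : exists n, [/\ (a1, n) \in strand a1 x1 b1, n \in rcons x1 b1 &
  conn [seq e <- strand a1 x1 b1 | e.1 \in x1] n b1].
Proof.
rewrite /strand; case E1: (rcons x1 b1) => [|n s]; first by case: x1 E1.
exists n; rewrite path_edges_cons !inE !eqxx; split=> //.
have -> : b1 = last n s by rewrite -[last n s]/(last a1 (n :: s)) -E1 last_rcons.
apply: conn_sub (conn_path (mem_last n s)) => e he.
rewrite mem_filter inE he orbT andbT.
have : e.1 \in unzip1 (path_edges (n :: s)) by exact: map_f.
rewrite unzip1_path; have -> // : belast n s = x1.
by have := belast_rcons n x1 b1; have := lastI n s; rewrite -E1 => /rcons_inj[<-].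
Qed.

End Bifurcation.
End TwoStrands.

(** * Reconnecting two strands *)

Section Reconnection.
Variable R : realType.
Notation pt := (R * R)%type.
Notation edge := (pt * pt)%type.
Notation diagram := (diagram R).

Lemma mem_loop_rot i (l : seq pt) e : e \in loop_edges (rot i l) -> e \in loop_edges l.
Proof.
case: l => [|x0 l0] //; set l := x0 :: l0.
have sz (s : seq pt) : size (rot 1 s) = size s by rewrite size_rot.
have nthr (s : seq pt) k : (k < size s)%N -> nth x0 (rot 1 s) k = nth x0 s (k.+1 %% size s).
  case: s => [|x s] // hk; rewrite rot1_cons nth_rcons.
  move: hk; rewrite ltnS leq_eqVlt => /orP[/eqP->|hk].
    by rewrite ltnn eqxx modnn.
  by rewrite hk modn_small.
have memE (s : seq pt) : e \in loop_edges s ->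
    exists2 k, (k < size s)%N & e = (nth x0 s k, nth x0 s (k.+1 %% size s)).
  move=> he; have hk : (index e (loop_edges s) < size s)%N.
    by have := he; rewrite -index_mem {2}/loop_edges size_zip sz minnn.
  exists (index e (loop_edges s)) => //.
  by rewrite -[LHS](nth_index (x0, x0) he) {1}/loop_edges nth_zip // nthr.
move=> /memE[k]; rewrite size_rot => hk ->.
have nrot j : (j < size l)%N -> nth x0 (rot i l) j = nth x0 l ((i + j) %% size l) \/ (size l <= i)%N.
  move=> hj; case: (leqP (size l) i) => hi; [by right | left].
  rewrite /rot nth_cat size_drop; case: ltnP => h.
    by rewrite nth_drop modn_small //; lia.
  rewrite nth_take; last by lia.
  have -> : (i + j = (j - (size l - i)) + size l)%N by lia.
  by rewrite modnDr modn_small //; lia.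
have s0 : (0 < size l)%N by [].
have inE' j : (j < size l)%N -> (nth x0 l j, nth x0 l (j.+1 %% size l)) \in loop_edges l.
  move=> hj; rewrite -nthr //.
  have -> : (nth x0 l j, nth x0 (rot 1 l) j) = nth (x0, x0) (loop_edges l) j.
    by rewrite /loop_edges nth_zip.
  by apply: mem_nth; rewrite size_zip sz minnn.
have [E1|h] := nrot k hk; last by rewrite rot_oversize //; exact: inE'.
have hk1 : (k.+1 %% size l < size l)%N by rewrite ltn_mod.
have [E2|h] := nrot _ hk1; last by rewrite rot_oversize //; exact: inE'.
rewrite E1 E2.
have -> : ((i + k.+1 %% size l) %% size l = ((i + k) %% size l).+1 %% size l)%N.
  by rewrite modnDmr addnS -addn1 -[in RHS]addn1 modnDml.
by apply: inE'; rewrite ltn_mod.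
Qed.

(** A circle stays connected when one arc is taken out of it: turning once around
    the circle from [p], one meets the arc first and comes back to [p] by the
    remaining edges. *)
Lemma loop_rest (X : diagram) p q r s u1 u2 E c : gen X ->
  perm_eq (edges X) (strand p u1 q ++ (strand r u2 s ++ E)) ->
  cidx X p = c.+1 -> cidx X p <> cidx X r -> conn E q p.
Proof.
move=> G P Ec ne.
have hp := two_a1 G P.
have := cidx_mem hp; rewrite Ec => hpl.
have hc : (c < size (loops X))%N by move: hp; rewrite cidx_lt Ec.
set l := component X c.+1 in hpl.
have hl : l \in loops X by exact: mem_nth.
have ul : uniq l.
  have [_ [U _] _ _ _] := G; move: U; rewrite cat_uniq => /and3P[_ _].
  elim: (loops X) l hl {hpl} => //= l' ls IH l; rewrite inE cat_uniq.
  by move=> /orP[/eqP->|/IH h] /and3P[// _ _]; exact: h.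
have [i s' Er] := rot_to hpl.
have sub e : e \in loop_edges (p :: s') -> e \in loop_edges l.
  by rewrite -Er; exact: mem_loop_rot.
have us : uniq (p :: s') by rewrite -Er rot_uniq.
move: sub; rewrite loop_edgesE.
case E1: (rcons s' p) => [|n s'']; first by case: s' E1 {Er us}.
have lastp : last n s'' = p by rewrite -[last n s'']/(last n (n :: s'')) -E1 last_rcons.
have starts : belast n s'' = s'.
  by have := lastI n s''; rewrite -E1 => /rcons_inj[<-].
rewrite path_edges_cons => sub.
have hpn : (p, n) \in edges X by apply: (loop_sub hl); apply: sub; rewrite inE eqxx.
have hn : collapse q u1 n = q.
  rewrite /collapse; case: ifP => // hn.
  move: hpn; rewrite (perm_mem P) mem_cat => /orP[/strand_mem2|/(rest_start G P)].
    by rewrite mem_rcons inE hn orbF => /eqP.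
  by rewrite inE eqxx.
have hpp : collapse q u1 p = p by rewrite /collapse (negbTE (start_notin G P)).
rewrite -{1}hn -{1}hpp -lastp; apply: (conn_map _ (conn_path (mem_last n s''))).
move=> e he.
have hee : e \in loop_edges l by apply: sub; rewrite inE he orbT.
have heX := loop_sub hl hee.
have e1p : e.1 != p.
  apply: contraTneq us => <- /=; rewrite -starts -unzip1_path.
  by rewrite (map_f fst he).
have [/(mem_comp G)[_ ec] _] := @comp_edges_mem _ X c.+1 e hee.
move: heX; rewrite (perm_mem P) !mem_cat => /or3P[h|h|h].
- have -> : collapse q u1 e.1 = q.
    by have := strand_mem1 h; rewrite inE (negbTE e1p) /= /collapse => ->.
  have -> : collapse q u1 e.2 = q; last exact: rst_refl.
    have := strand_mem2 h; rewrite mem_rcons inE /collapse => /orP[/eqP->|->//].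
    by rewrite (negbTE (end_notin G P)).
- exfalso; apply: ne; rewrite Ec -ec; symmetry.
  by apply: (strand_cidx G (two_swap P)); have [] := strand_endpoints h.
- have h' : e \in strand r u2 s ++ E by rewrite mem_cat h orbT.
  rewrite /collapse (negbTE (rest_start_in G P h')) (negbTE (rest_end_in G P h')).
  exact: conn_step.
Qed.

(** The successor of the last vertex of a circle is the first one; the positions
    thus run cyclically. *)
Lemma next_index (X : diagram) e : gen X -> e \in edges X ->
  let l := component X (cidx X e.1) in
  index e.2 l = (index e.1 l).+1 \/ (index e.2 l = 0%N /\ (index e.1 l).+1 = size l).
Proof.
move=> G he; have [c hc hec] := edges_comp he.
have [/(mem_comp G)[_ E1] _] := comp_edges_mem hec; rewrite E1 /=.
have uc := uniq_comp G hc.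
have [x0 [l El]] := comp_nonempty G hc.
case: c {E1} hc hec uc El => [|c] hc hec uc El.
  move: hec uc El; rewrite /Defs.comp /= => hec uc El; rewrite El in hec uc *; left.
  have ltk : (index e (path_edges (x0 :: l)) < size l)%N.
    by have := hec; rewrite -index_mem {2}/path_edges size_zip /=; lia.
  have [k hk [-> ->]] : exists2 k, (k < size l)%N & e.1 = nth x0 (x0 :: l) k /\
      e.2 = nth x0 (x0 :: l) k.+1.
    exists (index e (path_edges (x0 :: l))) => //.
    rewrite -{1 3}(nth_index (x0, x0) hec); move: (index e _) ltk => k hk.
    by rewrite {1 2}/path_edges nth_zip_cond ifT // size_zip /=; lia.
  by rewrite !index_uniq //= ltnS // ltnW.
have hec' : e \in loop_edges (x0 :: l) by move: hec; rewrite /= El.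
rewrite El in uc *.
have sz : size (loop_edges (x0 :: l)) = (size l).+1.
  by rewrite /loop_edges size_zip size_rot minnn.
have ltk : (index e (loop_edges (x0 :: l)) < (size l).+1)%N by rewrite -sz index_mem.
have [k hk [-> ->]] : exists2 k, (k < (size l).+1)%N & e.1 = nth x0 (x0 :: l) k /\
    e.2 = nth x0 (rcons l x0) k.
  exists (index e (loop_edges (x0 :: l))) => //.
  rewrite -{1 3}(nth_index (x0, x0) hec'); move: (index e _) ltk => k hk.
  by rewrite {1 2}/loop_edges nth_zip ?size_rot // rot1_cons.
rewrite nth_rcons index_uniq //; move: hk; rewrite ltnS leq_eqVlt => /orP[/eqP->|hk].
  by right; rewrite ltnn eqxx /= eqxx.
left; rewrite hk; have -> : nth x0 l k = nth x0 (x0 :: l) k.+1 by [].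
by rewrite index_uniq //= ltnS.
Qed.

Lemma arc_step i i' a b n : (a < b < n)%N -> i <> a -> i <> b ->
  i' = i.+1 \/ (i' = 0 /\ i.+1 = n)%N -> (a < i <= b)%N = (a < i' <= b)%N.
Proof.
move=> /andP[ab bn] ia ib [->|[-> e4]]; first by apply/idP/idP => /andP[]; lia.
by rewrite ltn0 /=; apply/negP => /andP[]; lia.
Qed.
Lemma arc_in i a b n : (a < b < n)%N ->
  i = a.+1 \/ (i = 0 /\ a.+1 = n)%N -> (a < i <= b)%N.
Proof. by move=> /andP[ab bn] [->|[-> e]]; [rewrite leqnn | lia]. Qed.
Lemma arc_out i a b n : i = b.+1 \/ (i = 0 /\ b.+1 = n)%N -> (a < i <= b)%N = false.
Proof. by move=> [->|[-> _]]; rewrite ?ltnn ?andbF. Qed.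

(** If both strands lie on one component, oriented reconnection cuts it in two. The
    vertices met after [p] up to [r] form an arc [S]; the edges of [Y] never lead
    from [S] to its complement, because the only edges of [X] that do so leave from
    [p] and from [r]. *)
Lemma merged_splits (X Y : diagram) p q r s u1 u2 w1 w2 E : gen X -> gen Y ->
  perm_eq (edges X) (strand p u1 q ++ (strand r u2 s ++ E)) ->
  perm_eq (edges Y) (strand p w1 s ++ (strand r w2 q ++ E)) ->
  cidx X p = cidx X r -> cidx Y p <> cidx Y r.
Proof.
move=> GX GY PX PY Epr.
(* The picture is symmetric under exchange of the two strands, so that [p] may be
   taken to come first. *)
wlog lt : p q r s u1 u2 w1 w2 PX PY Epr / (index p (component X (cidx X p))
    < index r (component X (cidx X p)))%N.
  move=> H; have hp := cidx_mem (two_a1 GX PX).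
  have hr := cidx_mem (two_a2 GX PX).
  case: (ltngtP (index p (component X (cidx X p))) (index r (component X (cidx X p)))) => lt.
  - exact: H PX PY Epr lt.
  - move=> E'; apply: (H r s p q u2 u1 w2 w1) => //.
    + exact: two_swap PX.
    + exact: two_swap PY.
    + by rewrite -Epr.
  - have := starts_neq GX PX; have -> : p = r; last by rewrite eqxx.
    rewrite -Epr in hr.
    by rewrite -(nth_index (ptL R) hp) lt nth_index.
set c := cidx X p in Epr lt; set l := component X c in lt.
have hp : p \in l by exact: cidx_mem (two_a1 GX PX).
have hr : r \in l by rewrite /l Epr; exact: cidx_mem (two_a2 GX PX).
pose S v := (cidx X v == c) && (index p l < index v l <= index r l)%N.
have idx_neq v w : v \in l -> w \in l -> v != w -> index v l <> index w l.
  by move=> hv hw /eqP ne E'; apply: ne; rewrite -(nth_index (ptL R) hv) E' nth_index.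
have Sp : S p = false by rewrite /S ltnn andbF.
have Sr : S r by rewrite /S -Epr eqxx lt leqnn.
have step e : e \in edges X -> e.1 != p -> e.1 != r -> S e.1 = S e.2.
  move=> he np nr; rewrite /S -(edge_cidx GX he); case: eqP => //= ec.
  have hv : e.1 \in l by rewrite /l -ec; apply: cidx_mem; case: (edge_vertices GX he).
  have ip := idx_neq _ _ hv hp np; have ir := idx_neq _ _ hv hr nr.
  have := next_index GX he; rewrite ec -/l /=.
  by apply: arc_step => //; rewrite lt index_mem.
have tail a x b a' x' b' : perm_eq (edges X) (strand a x b ++ (strand a' x' b' ++ E)) ->
    (forall v, v != a -> v != a' -> v != p /\ v != r) ->
    exists2 n, (a, n) \in edges X & S n = S b.
  move=> PP pr; have [n [h1 h2 h3]] := strand_tail a b x.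
  exists n; first exact: strand_sub PP _ h1.
  apply: (conn_fun _ h3) => e; rewrite mem_filter => /andP[ex he].
  have na : e.1 != a.
    by apply: contraTneq ex => ->; exact: start_notin GX PP.
  have na' : e.1 != a'.
    by apply: contraTneq ex => ->; exact: start2_notin1 GX PP.
  have [np nr] := pr _ na na'.
  by apply: step => //; exact: strand_sub PP _ he.
have [n hn Sq] := tail _ _ _ _ _ _ PX (fun v hp hr => conj hp hr).
have [n' hn' Ss] := tail _ _ _ _ _ _ (two_swap PX) (fun v hr hp => conj hp hr).
have {}Sq : S q.
  rewrite -Sq /S -(edge_cidx GX hn) /= -/c eqxx /=.
  by have := next_index GX hn; rewrite /= -/c -/l; apply: arc_in; rewrite lt index_mem.
have {}Ss : S s = false.
  rewrite -Ss /S -(edge_cidx GX hn') /= -Epr eqxx /=.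
  by have := next_index GX hn'; rewrite /= -Epr -/l; exact: arc_out.
move=> EY.
have cpr := cidx_conn GY (two_a1 GY PY) (two_a2 GY PY) EY.
suff H e : e \in edges Y -> S (collapse2 p r w1 w2 e.1) = S (collapse2 p r w1 w2 e.2).
  have := @conn_fun _ _ _ (fun v => S (collapse2 p r w1 w2 v)) _ _ H cpr.
  by rewrite /= (col_a1 GY PY) (col_a2 GY PY) Sp Sr.
rewrite (perm_mem PY) !mem_cat => /or3P[/strand_endpoints[h1 h2]|/strand_endpoints[h1 h2]|he].
- by have [->|->] := col_strand1 GY PY h1; have [->|->] := col_strand1 GY PY h2; rewrite ?Sp ?Ss.
- by have [->|->] := col_strand2 GY PY h1; have [->|->] := col_strand2 GY PY h2; rewrite ?Sr ?Sq.
- have [-> ->] := col_E GY PY he.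
  have h1 : e \in strand r u2 s ++ E by rewrite mem_cat he orbT.
  have h2 : e \in strand p u1 q ++ E by rewrite mem_cat he orbT.
  apply: step; first exact: two_E PX _ he.
    by have := rest_start GX PX h1; rewrite inE negb_or => /andP[].
  by have := rest_start GX (two_swap PX) h2; rewrite inE negb_or => /andP[].
Qed.
End Reconnection.

(** * Saddles, births and isotopies *)

(** The finer side [X] of a saddle: there the two strands lie on distinct
    components, which are joined in [Y]. *)
Section Saddle.
Variable R : realType.
Notation pt := (R * R)%type.
Notation edge := (pt * pt)%type.
Notation diagram := (diagram R).

Variables (X Y : diagram) (p q r s : pt) (u1 u2 w1 w2 : seq pt) (E : seq edge).
Hypothesis GX : gen X.
Hypothesis GY : gen Y.
Hypothesis PX : perm_eq (edges X) (strand p u1 q ++ (strand r u2 s ++ E)).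
Hypothesis PY : perm_eq (edges Y) (strand p w1 s ++ (strand r w2 q ++ E)).
Hypothesis sep : cidx X p <> cidx X r.
Hypothesis disj : forall v, v \in u1 ++ u2 -> v \notin w1 ++ w2.

(** One of the two components is a circle. *)
Lemma rest_conn : conn E q p \/ conn E s r.
Proof.
case Ep: (cidx X p) => [|c]; last by left; exact: loop_rest GX PX Ep sep.
case Er: (cidx X r) => [|c]; first by case: sep; rewrite Ep Er.
right; apply: loop_rest GX (two_swap PX) Er _ => E1; exact: sep.
Qed.

Lemma conn_rest v w : conn E v w -> conn (edges Y) v w.
Proof. by apply: conn_sub => e he; exact: two_E PY _ he. Qed.

(** What is left of the circle connects the two strands of [Y]. *)
Lemma split_merges : conn (edges Y) p r.
Proof.
have ps : conn (edges Y) p s.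
  apply: (conn_sub (strand_sub PY)); apply: conn_strand.
  by rewrite inE mem_rcons inE eqxx orbT.
have rq : conn (edges Y) r q.
  apply: (conn_sub (strand_sub (two_swap PY))); apply: conn_strand.
  by rewrite inE mem_rcons inE eqxx orbT.
have [/conn_rest h|/conn_rest h] := rest_conn.
  by apply: rst_sym; exact: rst_trans rq h.
exact: rst_trans ps h.
Qed.

Notation rhoX := (collapse2 p r u1 u2).
Notation rhoY := (collapse2 p r w1 w2).

Lemma commonX v : v \in vertices X -> v \notin u1 -> v \notin u2 ->
  [/\ v \in vertices Y, v \notin w1 & v \notin w2].
Proof.
move=> hv n1 n2; have [->|->|->|[e he ->]] := two_cases GX PX hv n1 n2.
- by split; [exact: ptL_vertex | exact: ptL_notin GY PY | exact: ptL_notin GY (two_swap PY)].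
- by split; [exact: two_b2 GY PY | exact: end2_notin1 GY PY | exact: end_notin GY (two_swap PY)].
- by split; [exact: two_b1 GY PY | exact: end_notin GY PY | exact: end1_notin2 GY PY].
- split; first by case: (edge_vertices GY (two_E PY he)).
    by apply: (rest_end_in GY PY); rewrite mem_cat he orbT.
  by apply: (rest_end_in GY (two_swap PY)); rewrite mem_cat he orbT.
Qed.

Lemma commonY v : v \in vertices Y -> v \notin w1 -> v \notin w2 ->
  [/\ v \in vertices X, v \notin u1 & v \notin u2].
Proof.
move=> hv n1 n2; have [->|->|->|[e he ->]] := two_cases GY PY hv n1 n2.
- by split; [exact: ptL_vertex | exact: ptL_notin GX PX | exact: ptL_notin GX (two_swap PX)].
- by split; [exact: two_b2 GX PX | exact: end2_notin1 GX PX | exact: end_notin GX (two_swap PX)].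
- by split; [exact: two_b1 GX PX | exact: end_notin GX PX | exact: end1_notin2 GX PX].
- split; first by case: (edge_vertices GX (two_E PX he)).
    by apply: (rest_end_in GX PX); rewrite mem_cat he orbT.
  by apply: (rest_end_in GX (two_swap PX)); rewrite mem_cat he orbT.
Qed.

Lemma saddle_carries : carries X Y rhoX.
Proof.
have Ypr := split_merges.
have connYs : conn (edges Y) p s.
  apply: (conn_sub (strand_sub PY)); apply: conn_strand.
  by rewrite inE mem_rcons inE eqxx orbT.
have connYq : conn (edges Y) r q.
  apply: (conn_sub (strand_sub (two_swap PY))); apply: conn_strand.
  by rewrite inE mem_rcons inE eqxx orbT.
split.
- move=> v /(col_vertex GX PX) hv; have [n1 n2] := col_notin GX PX v.
  by case: (commonX hv n1 n2).
- move=> e; rewrite (perm_mem PX) !mem_cat.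
  case/or3P => [/strand_endpoints[h1 h2]|/strand_endpoints[h1 h2]|he].
  + have [->|->] := col_strand1 GX PX h1; have [->|->] := col_strand1 GX PX h2;
      try exact: rst_refl.
      exact: rst_trans Ypr connYq.
    by apply: rst_sym; exact: rst_trans Ypr connYq.
  + have [->|->] := col_strand2 GX PX h1; have [->|->] := col_strand2 GX PX h2;
      try exact: rst_refl.
      by apply: rst_trans connYs; exact: rst_sym.
    by apply: rst_sym; apply: rst_trans connYs; exact: rst_sym.
  + by have [-> ->] := col_E GX PX he; exact: conn_step (two_E PY he).
- exact: colL GX PX.
Qed.

(** The components of [X] as seen from [Y], where the two components at the saddle
    have become one. *)
Definition fuse (c : nat) : nat := if c == cidx X r then cidx X p else c.

Lemma fuse_Y v w : cidx Y v = cidx Y w -> v \in vertices Y -> w \in vertices Y ->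
  fuse (cidx X (rhoY v)) = fuse (cidx X (rhoY w)).
Proof.
move=> Evw hv hw; have := cidx_conn GY hv hw Evw.
apply: (@conn_fun _ _ _ (fun v => fuse (cidx X (rhoY v)))) => e.
have fp : fuse (cidx X p) = cidx X p by rewrite /fuse; case: eqP => // /sep.
have fr : fuse (cidx X r) = cidx X p by rewrite /fuse eqxx.
have qp := cidx_b1 GX PX; have sr := cidx_b2 GX PX.
rewrite (perm_mem PY) !mem_cat.
case/or3P => [/strand_endpoints[h1 h2]|/strand_endpoints[h1 h2]|he].
- by have [->|->] := col_strand1 GY PY h1; have [->|->] := col_strand1 GY PY h2;
     rewrite ?sr ?fp ?fr.
- by have [->|->] := col_strand2 GY PY h1; have [->|->] := col_strand2 GY PY h2;
     rewrite ?qp ?fp ?fr.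
- by have [-> ->] := col_E GY PY he; rewrite (edge_cidx GX (two_E PX he)).
Qed.

(** The map induced from [X] to [Y] becomes a bijection once one of the two
    components at the saddle is left out. *)
Lemma saddle_ncomp : ncomp X = (ncomp Y).+1.
Proof.
have C := saddle_carries.
have Ypr : cidx Y p = cidx Y r := conn_cidx GY split_merges.
have hp := two_a1 GX PX; have hr := two_a2 GX PX.
pose pi := comp_map X Y rhoX.
have piE v : v \in vertices X -> pi (cidx X v) = cidx Y (rhoX v) := comp_mapE GX GY C.
pose g y := fuse (cidx X (rhoY (chead Y y))).
have gE v : v \in vertices Y -> g (cidx Y v) = fuse (cidx X (rhoY v)).
  move=> hv; have hc := hv; rewrite cidx_lt in hc.
  have [hh Eh] := chead_cidx GY hc.
  exact: fuse_Y.
have pi_fuse c : pi (fuse c) = pi c.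
  rewrite /fuse; case: eqP => // ->.
  by rewrite !piE // (col_a1 GX PX) (col_a2 GX PX).
have fuse_lt c : (c < ncomp X)%N -> (fuse c < ncomp X)%N.
  by rewrite /fuse; case: ifP => // _ _; rewrite -cidx_lt.
have fuse_neq c : fuse c != cidx X r.
  by rewrite /fuse; case: (eqVneq c (cidx X r)) => // _; apply/eqP.
pose sX := [seq c <- iota 0 (ncomp X) | c != cidx X r].
have szX : ncomp X = (size sX).+1.
  have := count_predC (pred1 (cidx X r)) (iota 0 (ncomp X)).
  rewrite size_iota (count_uniq_mem _ (iota_uniq _ _)) mem_iota add0n -cidx_lt hr /=.
  by rewrite add1n => E1; rewrite -[LHS]E1 size_filter.
have memX c : (c \in sX) = (c != cidx X r) && (c < ncomp X)%N.
  by rewrite mem_filter mem_iota.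
rewrite szX; congr _.+1; rewrite -(size_iota 0 (ncomp Y)).
have gpi c : c \in sX -> g (pi c) = c.
  rewrite memX => /andP[nr hc]; have [hv Ec] := chead_cidx GX hc.
  rewrite -{1}Ec piE // gE; last exact: (carries_vertex C).
  have [n1 n2] := col_notin GX PX (chead X c).
  have [_ m1 m2] := commonX (col_vertex GX PX hv) n1 n2.
  by rewrite (col_fix _ _ m1 m2) (col_cidx GX PX hv) Ec /fuse (negbTE nr).
have pig y : (y < ncomp Y)%N -> pi (g y) = y.
  move=> hy; have [hv Ey] := chead_cidx GY hy.
  have [n1 n2] := col_notin GY PY (chead Y y).
  have [hv' m1 m2] := commonY (col_vertex GY PY hv) n1 n2.
  by rewrite /g pi_fuse piE // (col_fix _ _ m1 m2) (col_cidx GY PY hv).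
apply/eqP; rewrite eqn_leq; apply/andP; split.
  rewrite -(size_map pi sX); apply: uniq_leq_size.
    rewrite map_inj_in_uniq ?filter_uniq ?iota_uniq // => x y hx hy E1.
    by rewrite -(gpi x hx) -(gpi y hy) E1.
  move=> _ /mapP[c hc ->]; rewrite mem_iota add0n.
  by move: hc; rewrite memX => /andP[_ hc]; exact: (comp_map_lt GX GY C hc).
rewrite -(size_map g (iota 0 (ncomp Y))); apply: uniq_leq_size.
  rewrite map_inj_in_uniq ?iota_uniq // => x y; rewrite !mem_iota !add0n => hx hy E1.
  by rewrite -(pig x hx) -(pig y hy) E1.
move=> _ /mapP[y hy ->]; move: hy; rewrite mem_iota add0n memX fuse_neq => hy /=.
have [hv Ey] := chead_cidx GY hy.
have [n1 n2] := col_notin GY PY (chead Y y).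
have [hv' _ _] := commonY (col_vertex GY PY hv) n1 n2.
by apply: fuse_lt; rewrite -cidx_lt.
Qed.

Definition saddle_kept (v : pt) : Prop := v \in vertices X /\ v \notin u1 ++ u2.

Lemma saddle_common_cidx v : v \in vertices X -> v \in vertices Y ->
  comp_map X Y rhoX (cidx X v) = cidx Y v.
Proof.
move=> hv hw; rewrite (comp_mapE GX GY saddle_carries hv).
case: (boolP (v \in u1 ++ u2)) => h; last first.
  by move: h; rewrite mem_cat negb_or => /andP[h1 h2]; rewrite (col_fix _ _ h1 h2).
have := disj h; rewrite mem_cat negb_or => /andP[h1 h2].
have [_ m1 m2] := commonY hw h1 h2.
by rewrite (col_fix _ _ m1 m2).
Qed.

(** The strands of the local picture meet no other edge, so that increments vanish
    there. Since a potential of [X] returns to its value around the circle that the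
    band opens, a potential of [Y] has equal values at [p] and [r]. *)
Lemma saddle_conserved (t t' : edge -> R) : (forall e, e \in E -> t e = t' e) ->
  (forall e, e \in strand p u1 q ++ strand r u2 s -> t e = 0) ->
  (forall e, e \in strand p w1 s ++ strand r w2 q -> t' e = 0) ->
  conserved X Y rhoX saddle_kept t t'.
Proof.
move=> tE t0 t0'.
have z (A : seq edge) (P : pred edge) (f : edge -> R) : (forall e, e \in A -> f e = 0) ->
    \sum_(e <- A | P e) f e = 0.
  by move=> H; rewrite big1_seq // => e /andP[_ /H].
split.
  move=> y; rewrite /holonomy (perm_big _ PY) [RHS](perm_big _ PX) !big_cat /=.
  rewrite !(z (strand _ _ _)); try by
    move=> e he; (apply: t0 || apply: t0'); rewrite mem_cat he ?orbT.
  rewrite !add0r big_seq_cond [RHS]big_seq_cond; apply: eq_big => e; last by move=> /andP[/tE].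
  by case he: (e \in E) => //=; have [-> _] := col_E GX PX he.
move=> F F' pF pF'.
have Fpq : F q = F p.
  by rewrite (pot_strand (pot_sub (strand_sub PX) pF)) big1_seq ?addr0 // => e /andP[_ he]; apply: t0; rewrite mem_cat he.
have Frs : F s = F r.
  by rewrite (pot_strand (pot_sub (strand_sub (two_swap PX)) pF)) big1_seq ?addr0 // => e /andP[_ he]; apply: t0; rewrite mem_cat he orbT.
have F'ps : F' s = F' p.
  by rewrite (pot_strand (pot_sub (strand_sub PY) pF')) big1_seq ?addr0 // => e /andP[_ he]; apply: t0'; rewrite mem_cat he.
have F'rq : F' q = F' r.
  by rewrite (pot_strand (pot_sub (strand_sub (two_swap PY)) pF')) big1_seq ?addr0 // => e /andP[_ he]; apply: t0'; rewrite mem_cat he orbT.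
have dE e : e \in E -> F e.1 - F' e.1 = F e.2 - F' e.2.
  by move=> he; rewrite (pF _ (two_E PX he)) (pF' _ (two_E PY he)) tE //; ring.
(* Around the circle the increments of [X] sum to 0, since [F] exists. *)
have F'pr : F' p = F' r.
  have [c|c] := rest_conn.
    have := @conn_fun _ _ _ (fun v => F v - F' v) _ _ dE c.
    by rewrite /= Fpq F'rq => H; lra.
  have := @conn_fun _ _ _ (fun v => F v - F' v) _ _ dE c.
  by rewrite /= Frs F'ps => H; lra.
have tr e : e \in edges X ->
    F (rhoX e.1) - F' (rhoX e.1) = F (rhoX e.2) - F' (rhoX e.2).
  rewrite (perm_mem PX) !mem_cat.
  case/or3P => [/strand_endpoints[h1 h2]|/strand_endpoints[h1 h2]|he].
  - by have [->|->] := col_strand1 GX PX h1; have [->|->] := col_strand1 GX PX h2;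
      rewrite ?Fpq ?F'rq ?F'pr.
  - by have [->|->] := col_strand2 GX PX h1; have [->|->] := col_strand2 GX PX h2;
      rewrite ?Frs ?F'ps ?F'pr.
  - by have [-> ->] := col_E GX PX he; exact: dE.
move=> v w [hv nv] [hw nw] E0.
have := @conn_fun _ _ _ (fun v => F (rhoX v) - F' (rhoX v)) _ _ tr (cidx_conn GX hv hw E0).
by move: nv nw; rewrite !mem_cat !negb_or => /andP[a1 a2] /andP[b1 b2];
   rewrite /= !col_fix.
Qed.

End Saddle.

Section OtherMoves.
Variable R : realType.
Notation pt := (R * R)%type.
Notation edge := (pt * pt)%type.
Notation diagram := (diagram R).

Lemma saddle_topo (X Y : diagram) p q r s u1 u2 w1 w2 E (b : bool) : gen X -> gen Y ->
  perm_eq (edges X) (strand p u1 q ++ (strand r u2 s ++ E)) ->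
  perm_eq (edges Y) (strand p w1 s ++ (strand r w2 q ++ E)) ->
  cidx X p <> cidx X r -> (forall v, v \in u1 ++ u2 -> v \notin w1 ++ w2) ->
  topo Saddle (if b then Y else X) (if b then X else Y) b (collapse2 p r u1 u2)
    (saddle_kept X u1 u2).
Proof.
move=> GX GY PX PY sep disj.
have := saddle_carries GX GY PX PY sep => C.
have := saddle_ncomp GX GY PX PY sep; rewrite /ncomp => -[sz].
have EX : finer b (if b then Y else X) (if b then X else Y) = X by case: b.
have EY : coarser b (if b then Y else X) (if b then X else Y) = Y by case: (b).
split; rewrite ?EX ?EY //.
- by split; [exact: ptL_vertex | rewrite mem_cat negb_or (ptL_notin GX PX) (ptL_notin GX (two_swap PX))].
- by move=> v [].
- move=> c c'; rewrite /= => -[v hv hv'].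
  have cm := saddle_common_cidx GX GY PX PY sep disj.
  clear EX EY; case: b hv hv' => /(mem_comp _)h1 /(mem_comp _)h2.
    have [hv <-] := h1 GY; have [hv' <-] := h2 GX.
    by rewrite -!cidx_lt hv hv' cm.
  have [hv <-] := h1 GX; have [hv' <-] := h2 GY.
  by rewrite -!cidx_lt hv hv' cm.
- by rewrite /= -addnn; clear EX EY; case: b; rewrite sz; lia.
Qed.

Lemma topo_sym k (D D' : diagram) b rho kept : topo k D D' b rho kept ->
  topo (rev_kind k) D' D (~~ b) rho kept.
Proof.
have E1 : finer (~~ b) D' D = finer b D D' by case: b.
have E2 : coarser (~~ b) D' D = coarser b D D' by case: (b).
case=> C L K lk cn; split; rewrite ?E1 ?E2 //.
- move=> c c' /linked_sym.
  have -> : rev_kind (rev_kind k) = k by case: k {lk cn}.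
  move=> /lk[lt H]; split=> // hc.
  by have := H _; rewrite lt hc => /(_ isT); case: b {C K lk cn E1 E2 H}.
- by move: cn; case: k {lk} => /=; lia.
Qed.

Lemma birth_topo (D D' : diagram) l : gen D -> gen D' ->
  long D' = long D -> loops D' = l :: loops D ->
  topo Birth D D' false id (fun v => v \in vertices D).
Proof.
move=> G G' El Els.
have sub v : v \in vertices D -> v \in vertices D'.
  by rewrite /vertices El Els /= !mem_cat => /orP[->//|->]; rewrite !orbT.
have C : carries D D' id.
  split=> // e he; apply: conn_step; move: he.
  by rewrite /edges /edges_of El Els /= !mem_cat => /orP[->//|->]; rewrite !orbT.
split=> //=.
- exact: ptL_vertex.
- move=> c c' [v /(mem_comp G)[hv <-] /(mem_comp G')[hv' <-]].
  by rewrite -!cidx_lt hv hv' (comp_mapE G G' C hv).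
- by rewrite Els /= -addnn; lia.
Qed.

Lemma birth_conserved (D D' : diagram) l (t t' : edge -> R) : gen D -> gen D' ->
  long D' = long D -> loops D' = l :: loops D ->
  (forall e, e \in edges D -> t e = t' e) ->
  (forall e, e \in loop_edges l -> t' e = 0) ->
  conserved D D' id (fun v => v \in vertices D) t t'.
Proof.
move=> G G' El Els tE t0.
have P : perm_eq (edges D') (loop_edges l ++ edges D).
  by rewrite /edges /edges_of El Els /= perm_catCA.
have sub e : e \in edges D -> e \in edges D'.
  by move=> he; rewrite (perm_mem P) mem_cat he orbT.
split.
  move=> y; rewrite /holonomy (perm_big _ P) big_cat /= big1_seq ?add0r; last first.
    by move=> e /andP[_ /t0].
  by rewrite big_seq_cond [RHS]big_seq_cond; apply: eq_bigr => e /andP[/tE].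
move=> F F' pF pF' v w hv hw Evw.
apply: (@conn_fun _ _ _ (fun v => F v - F' v) _ _ _ (cidx_conn G hv hw Evw)) => e he.
by rewrite (pF _ he) (pF' _ (sub _ he)) tE //; ring.
Qed.

Lemma isotopy_cidx (D D' : diagram) g v : gen D -> gen D' ->
  long D' = map g (long D) -> loops D' = map (map g) (loops D) ->
  v \in vertices D -> g v \in vertices D' /\ cidx D' (g v) = cidx D v.
Proof.
move=> G G' El Els hv; apply: (mem_comp G').
have := cidx_mem hv; move: (hv); rewrite cidx_lt; case: (cidx D v) => [_|c].
  by rewrite /Defs.comp /= El => h; exact: map_f.
by rewrite /Defs.comp /ncomp /= ltnS Els => hc h; rewrite (nth_map [::]) // map_f.
Qed.

Lemma isotopy_edges (D D' : diagram) g :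
  long D' = map g (long D) -> loops D' = map (map g) (loops D) ->
  edges D' = map (mapE g) (edges D).
Proof. by move=> El Els; rewrite /edges El Els edges_of_map. Qed.

Lemma isotopy_carries (D D' : diagram) g : gen D -> gen D' ->
  long D' = map g (long D) -> loops D' = map (map g) (loops D) -> carries D D' g.
Proof.
move=> G G' El Els; split.
- by move=> v hv; case: (isotopy_cidx G G' El Els hv).
- move=> e he; apply: (@conn_step _ _ (mapE g e)).
  by rewrite (isotopy_edges El Els) map_f.
- have [m Em] := long_shape G; have [m' Em'] := long_shape G'.
  by move: Em'; rewrite El Em => -[].
Qed.

Lemma isotopy_topo (D D' : diagram) g : gen D -> gen D' ->
  long D' = map g (long D) -> loops D' = map (map g) (loops D) ->
  topo Isotopy D D' false g (fun v => v \in vertices D).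
Proof.
move=> G G' El Els; have C := isotopy_carries G G' El Els; split=> //=.
- exact: ptL_vertex.
- move=> c _ <-; split; first by rewrite /ncomp Els size_map.
  move=> hc; have [hv Ec] := chead_cidx G hc.
  by rewrite -{2}Ec (comp_mapE G G' C hv); have [_ ->] := isotopy_cidx G G' El Els hv.
- by rewrite Els size_map -addnn; lia.
Qed.

Lemma isotopy_conserved (D D' : diagram) g t t' : gen D -> gen D' ->
  long D' = map g (long D) -> loops D' = map (map g) (loops D) ->
  (forall e, e \in edges D -> t e = t' (mapE g e)) ->
  conserved D D' g (fun v => v \in vertices D) t t'.
Proof.
move=> G G' El Els tE; have EE := isotopy_edges El Els; split.
  move=> y; rewrite /holonomy EE big_map big_seq_cond [RHS]big_seq_cond.
  by apply: eq_bigr => e /andP[/tE].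
move=> F F' pF pF' v w hv hw Evw.
apply: (@conn_fun _ _ _ (fun v => F v - F' (g v)) _ _ _ (cidx_conn G hv hw Evw)) => e he.
have := pF' (mapE g e); rewrite EE map_f // => /(_ isT) /= ->.
by rewrite (pF _ he) tE //; ring.
Qed.

End OtherMoves.

(** * Crossings over the reals, local pictures *)

Section Geometry.
Variable R : realType.
Notation pt := (R * R)%type.
Notation edge := (pt * pt)%type.
Notation diagram := (diagram R).
Notation ipt := (int * int)%type.
Notation iedge := (ipt * ipt)%type.

(** The parameter along [e] of its intersection with the line of [g]. *)
Definition par (e g : edge) : R := lead e g / turn e g.

Lemma par_meet e g : turn e g != 0 -> on_edge e (par e g) = on_edge g (par g e).
Proof.
move=> n; have n' : turn g e != 0 by rewrite turn_swap oppr_eq0.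
move: n n'; rewrite /on_edge /par; case: e g => [[a b] [c d]] [[a' b'] [c' d']].
rewrite /turn /lead /det /vec /= => n n'; congr pair; field; by rewrite n n'.
Qed.

Lemma par_unique1 e g s t : turn e g != 0 -> on_edge e s = on_edge g t -> s = par e g.
Proof.
move=> n; case: e g n => [[a b] [c d]] [[a' b'] [c' d']] n [h1 h2].
apply/(mulIf n); rewrite /par divfK //; rewrite /= in h1 h2.
rewrite /turn /lead /det /vec /=.
have : ((1 - s) * a + s * c - ((1 - t) * a' + t * c')) * (d' - b')
   - ((1 - s) * b + s * d - ((1 - t) * b' + t * d')) * (c' - a') = 0.
  by rewrite h1 h2; ring.
by move=> H; apply/eqP; rewrite -subr_eq0 -[X in _ == X]H; apply/eqP; ring.
Qed.

Lemma par_unique e g s t : turn e g != 0 -> on_edge e s = on_edge g t ->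
  s = par e g /\ t = par g e.
Proof.
move=> n H; split; first exact: par_unique1 n H.
by apply: (par_unique1 _ (esym H)); rewrite turn_swap oppr_eq0.
Qed.

Lemma xingE e g : xing e g = [&& turn e g != 0, 0 < par e g < 1 & 0 < par g e < 1].
Proof.
have aux e' g' : turn e' g' != 0 ->
    (0 < lead e' g' * turn e' g' < turn e' g' ^+ 2) = (0 < par e' g' < 1).
  move=> n; have n2 : 0 < turn e' g' ^+ 2 by rewrite lt_def sqr_ge0 sqrf_eq0 n.
  have -> : lead e' g' * turn e' g' = par e' g' * turn e' g' ^+ 2.
    by rewrite /par; field.
  by rewrite pmulr_lgt0 // -{2}[turn e' g' ^+ 2]mul1r ltr_pM2r.
case: (eqVneq (turn e g) 0) => n /=.
  by apply/negP => /xing_turn; rewrite n eqxx.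
by rewrite /xing !aux // turn_swap oppr_eq0.
Qed.

Lemma beforeE e g h : turn e g != 0 -> turn e h != 0 ->
  before e g h = (par e g < par e h).
Proof.
move=> n n'; rewrite /before -[RHS]subr_gt0.
have n2 : turn e g * turn e h != 0 by rewrite mulf_neq0.
have : lead e h * turn e g - lead e g * turn e h =
    (par e h - par e g) * (turn e g * turn e h).
  by rewrite /par; field; rewrite n n'.
move: (turn e g * turn e h) n2 (lead e h * _) (lead e g * _) (par e h - par e g) => w n2 x y d H.
have [lt|le] := ltrP 0 w; first by rewrite -subr_gt0 H pmulr_lgt0.
have lt : w < 0 by rewrite lt_neqAle n2.
by rewrite -subr_lt0 H nmulr_llt0.
Qed.

Lemma xing_meet e g : xing e g ->
  [/\ 0 < par e g < 1, 0 < par g e < 1 & on_edge e (par e g) = on_edge g (par g e)].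
Proof. by rewrite xingE => /and3P[n h1 h2]; split=> //; exact: par_meet. Qed.

Lemma xing_cross (e g : edge) : xing e g -> cross e g.
Proof.
move=> x; split; first exact: xing_neq.
by have [h1 h2 h3] := xing_meet x; exists (par e g), (par g e).
Qed.

Lemma turn_wedge (e g : edge) : wedge (dir e) (dir g) = turn e g. Proof. by []. Qed.

Lemma cross_xing (D : diagram) e g : gen D -> e \in edges D -> g \in edges D -> cross e g -> xing e g.
Proof.
move=> [_ _ _ H _] he hg [ne [s [t [hs ht H']]]].
have [s0 s1] := andP hs; have [t0 t1] := andP ht.
have [||[_ _ n]|[s1' _]|[s0' _]] := H e g s t he hg ne _ _ H'; rewrite ?ltW //.
- rewrite turn_wedge in n; have [E1 E2] := par_unique n H'.
  by rewrite xingE n -E1 -E2 hs ht.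
- by rewrite s1' ltxx in s1.
- by rewrite s0' ltxx in s0.
Qed.

Lemma wf_flip (D : diagram) (e g : edge) : wf D -> e \in edges D -> g \in edges D -> xing e g ->
  mark D g e = flip (mark D e g).
Proof. by move=> [_ m] he hg /xing_cross; exact: m. Qed.

Lemma wf_gen (D : diagram) : wf D -> gen D.
Proof. by case. Qed.

(** The corners of all local pictures have coordinates in quarters. *)
Definition quarter (q : ipt) : pt := (q.1%:~R / 4%:R, q.2%:~R / 4%:R).
Definition ipath (l : seq ipt) : seq iedge := zip l (behead l).
Definition iedges (S : seq (seq ipt)) : seq iedge := flatten (map ipath S).

(** The edge lies in the closed square and its midpoint in the open one; hence all
    its inner points are in the open square. *)
Definition in_box (e : iedge) : bool :=
  [&& `|e.1.1| <= 4, `|e.1.2| <= 4, `|e.2.1| <= 4, `|e.2.2| <= 4,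
      `|e.1.1 + e.2.1| < 8 & `|e.1.2 + e.2.2| < 8].

Lemma path_edges_aff p u v (l : seq ipt) :
  path_edges (map (aff p u v) l) = map (affE p u v) (ipath l) :> seq edge.
Proof.
rewrite /path_edges /ipath behead_map; elim: l (behead l) => [|x l IH] [|y m] //=.
by rewrite IH.
Qed.

Section Chart.
Variables (f : pt -> pt) (p u v : pt).
Hypothesis Ef : forall q, f q = (p.1 + q.1 * u.1 + q.2 * v.1, p.2 + q.1 * u.2 + q.2 * v.2).
Hypothesis uv : wedge u v != 0.

Definition u4 : pt := (u.1 / 4%:R, u.2 / 4%:R).
Definition v4 : pt := (v.1 / 4%:R, v.2 / 4%:R).

Lemma det4 : det u4 v4 != 0.
Proof.
have -> : det u4 v4 = wedge u v / 16%:R by rewrite /det /wedge /u4 /v4 /=; field.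
by rewrite mulf_neq0 // invr_neq0 // pnatr_eq0.
Qed.

Lemma chart_quarter q : f (quarter q) = aff p u4 v4 q.
Proof. by rewrite Ef /aff /quarter /u4 /v4 /=; congr pair; ring. Qed.

Lemma strand_edges_aff (iA : seq (seq ipt)) :
  map (mapE f) (strand_edges (map (map quarter) iA)) = map (affE p u4 v4) (iedges iA).
Proof.
rewrite /strand_edges /iedges !map_flatten -!map_comp; congr flatten.
apply: eq_map => l /=; rewrite -path_edges_map -path_edges_aff -map_comp.
by congr path_edges; apply: eq_map => q /=; exact: chart_quarter.
Qed.

(** A crossing is an inner point of both edges, and inner points of an edge of the
    picture are in the open square, from which the outer edges are excluded. *)
Lemma outside_nox E0 e g : outside f E0 -> in_box e -> g \in E0 ->
  ~~ xing (affE p u4 v4 e) g.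
Proof.
move=> out box hg; apply/negP => /xing_meet[h1 /andP[h2 h2'] h3].
set s := par _ g in h1 h3; set t := par g _ in h2 h2' h3.
apply: (out g t (on_edge (quarter e.1, quarter e.2) s) hg).
- by rewrite !ltW.
- rewrite -h3 Ef /on_edge /affE /aff /quarter /u4 /v4 /=; congr pair; ring.
have [s0 s1] := andP h1.
have tor (x : int) : `|x| <= 4 -> -4%:R <= (x%:~R : R) <= 4%:R.
  rewrite ler_norml => /andP[a b]; apply/andP; split.
    by rewrite -[- _]/((-4)%:~R) ler_int.
  by rewrite -[4%:R]/(4%:~R) ler_int.
have tos (x y : int) : `|x + y| < 8 -> -8%:R < (x%:~R + y%:~R : R) < 8%:R.
  rewrite ltr_norml -intrD => /andP[a b]; apply/andP; split.
    by rewrite -[- _]/((-8)%:~R) ltr_int.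
  by rewrite -[8%:R]/(8%:~R) ltr_int.
have aux (x y : R) : -4%:R <= x <= 4%:R -> -4%:R <= y <= 4%:R -> - 8%:R < x + y < 8%:R ->
    -1 < (1 - s) * (x / 4%:R) + s * (y / 4%:R) < 1.
  have pos (a b : R) : 0 <= a -> 0 <= b -> 0 < a + b -> 0 < (1 - s) * a + s * b.
    move=> a0 b0 ab; case: (ltrP 0 a) => [a1|a1].
      by apply: ltr_pwDl; [apply: mulr_gt0; lra | apply: mulr_ge0; lra].
    by apply: ltr_wpDl; [apply: mulr_ge0; lra | apply: mulr_gt0; lra].
  move=> /andP[x0 x1] /andP[y0 y1] /andP[z0 z1]; apply/andP; split.
    by have := pos (4%:R + x) (4%:R + y); lra.
  by have := pos (4%:R - x) (4%:R - y); lra.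
case/and5P: box => b1 b2 b3 b4 /andP[b5 b6].
by rewrite /on_edge /quarter /=; split; apply: aux; auto.
Qed.

End Chart.
End Geometry.

(** * Moves that keep the levels *)

Section Invariance.
Variable R : realType.
Notation pt := (R * R)%type.
Notation edge := (pt * pt)%type.
Notation diagram := (diagram R).

Definition tK (D : diagram) := riseK (edges D) (mark D).
Definition tA (D : diagram) := riseA (edges D) (mark D).
Definition tC (D : diagram) := riseC (edges D) (mark D).
Definition sC (D : diagram) := sumC (edges D) (mark D).
Definition potK (D : diagram) K := pot (edges D) (tK D) K.
Definition potA (D : diagram) j K A := pot (edges D) (tA D j K) A.

Definition agree (rho : pt -> pt) (kept : pt -> Prop) (F F' : pt -> R) : Prop :=
  forall v, kept v -> F v = F' (rho v).

(** What has to be known of a move for the invariant to pass through it. The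
    increments of [A] and [B] depend on [K], and those of [C] on all three, whence
    the nested quantification over potentials that agree across the move. The index
    [j] is assumed nonzero because crossings of index 0 are created by kinks. *)
Record invariant_step (X Y : diagram) (rho : pt -> pt) (kept : pt -> Prop) : Prop :=
  InvariantStep {
  inv_K : conserved X Y rho kept (tK X) (tK Y);
  inv_A : forall K K', potK X K -> potK Y K' -> agree rho kept K K' ->
    forall j, j != 0 -> conserved X Y rho kept (tA X j K) (tA Y j K');
  inv_C : forall K K' A A' B B', potK X K -> potK Y K' -> agree rho kept K K' ->
    potA X 1 K A -> potA Y 1 K' A' -> agree rho kept A A' ->
    potA X (-1) K B -> potA Y (-1) K' B' -> agree rho kept B B' ->
    sC X K A B = sC Y K' A' B' }.

Definition balanced (E S S' : seq edge) (t t' : edge -> R) : Prop :=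
  (forall e, e \in E -> t e = t' e) /\ \sum_(e <- S) t e = \sum_(e <- S') t' e.

Definition agree_at (E : seq edge) (a : pt) (F F' : pt -> R) : Prop :=
  (forall e, e \in E -> F e.1 = F' e.1) /\ F a = F' a.

(** The same for the replacement of a strand: it is enough to compare the edges
    outside and the totals along the two strands. *)
Record balanced_step (X Y : diagram) (E S S' : seq edge) (a : pt) : Prop :=
  BalancedStep {
  bal_K : balanced E S S' (tK X) (tK Y);
  bal_A : forall K K', potK X K -> potK Y K' -> agree_at E a K K' ->
    forall j, j != 0 -> balanced E S S' (tA X j K) (tA Y j K');
  bal_C : forall K K' A A' B B', potK X K -> potK Y K' -> agree_at E a K K' ->
    potA X 1 K A -> potA Y 1 K' A' -> agree_at E a A A' ->
    potA X (-1) K B -> potA Y (-1) K' B' -> agree_at E a B B' ->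
    balanced E S S' (tC X K A B) (tC Y K' A' B') }.

(** The point [a] at the start and the starts of the outer edges are exactly the
    vertices at which levels enter the increments from outside. *)
Lemma restrand_step (X Y : diagram) E a b u u' : gen X -> gen Y ->
  perm_eq (edges X) (strand a u b ++ E) -> perm_eq (edges Y) (strand a u' b ++ E) ->
  balanced_step X Y E (strand a u b) (strand a u' b) a ->
  invariant_step X Y (collapse a u) (unmoved X u).
Proof.
move=> GX GY PX PY [bK bA bC].
have ag F F' : agree (collapse a u) (unmoved X u) F F' -> agree_at E a F F'.
  move=> H; split.
    move=> e he; have n := rest_start_in GX PX he.
    rewrite H; last by split=> //; case: (edge_vertices GX (rest_sub PX he)).
    by rewrite /collapse (negbTE n).
  have n := start_notin GX PX.
  rewrite H; first by rewrite /collapse (negbTE n).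
  by split=> //; apply: (strand_vertex GX PX); rewrite inE eqxx.
split.
- by case: bK => b1 b2; apply: restrand_conserved PX PY b1 b2.
- move=> K K' pK pK' /ag aK j j0; have [b1 b2] := bA K K' pK pK' aK j j0.
  exact: restrand_conserved PX PY b1 b2.
- move=> K K' A A' B B' pK pK' /ag aK pA pA' /ag aA pB pB' /ag aB.
  have [b1 b2] := bC _ _ _ _ _ _ pK pK' aK pA pA' aA pB pB' aB.
  rewrite /sC /sumC (perm_big _ PX) [RHS](perm_big _ PY) !big_cat /=; congr (_ + _) => //.
  by rewrite big_seq [RHS]big_seq; apply: eq_bigr.
Qed.

(** This covers the replacement of a part that meets the other edges in virtual
    crossings only, or not at all. *)
Section Outer.
Variables (X Y : diagram) (E0 S S' : seq edge).
Hypothesis PX : perm_eq (edges X) (E0 ++ S).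
Hypothesis PY : perm_eq (edges Y) (E0 ++ S').
Hypothesis mm : same_marks X Y E0.
Hypothesis vX : forall e g, e \in E0 -> g \in S -> xing e g -> mark X e g = Virtual.
Hypothesis vY : forall e g, e \in E0 -> g \in S' -> xing e g -> mark Y e g = Virtual.

Let mx e g : e \in E0 -> g \in E0 -> xing e g -> mark X e g = mark Y e g.
Proof. by move=> he hg /xing_cross; exact: mm. Qed.

Let zz : agree0 E0 (fun=> 0 : R) (fun=> 0). Proof. by []. Qed.

Lemma outer_tK e : e \in E0 -> tK X e = tK Y e.
Proof. by have [_] := outerK PX PY mx vX vY zz; exact. Qed.

Lemma outer_tA K K' j e : agree0 E0 K K' -> e \in E0 -> tA X j K e = tA Y j K' e.
Proof.
move=> KK; have [_] := outerA PX PY mx vX vY j KK zz; exact.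
Qed.

Lemma outer_tC K K' A A' B B' e : agree0 E0 K K' -> agree0 E0 A A' -> agree0 E0 B B' ->
  e \in E0 -> tC X K A B e = tC Y K' A' B' e.
Proof. by move=> KK AA BB; exact: (outerC PX PY mx vX vY KK AA BB). Qed.
End Outer.

Lemma rise_nox (E : seq edge) z e : (forall g, g \in E -> ~~ xing e g) -> rise E z e = 0.
Proof. by move=> H; rewrite /rise big1_seq // => g /andP[x /H]; rewrite x. Qed.

(** The form to which every move apart from saddles, births and isotopies is
    reduced. *)
Definition restranded (D D' : diagram) : Prop :=
  exists E a b u u', [/\ perm_eq (edges D) (strand a u b ++ E),
    perm_eq (edges D') (strand a u' b ++ E) &
    balanced_step D D' E (strand a u b) (strand a u' b) a].

(** The set of edges does not change; the first edge of the long component serves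
    as the replaced strand. *)
Lemma relisting_step (D D' : diagram) : wf D -> wf D' -> relisting D D' ->
  restranded D D'.
Proof.
move=> wD wD' [P sm]; have [m Em] := long_shape (wf_gen wD).
have [x [l El]] : exists x l, rcons m (ptR R) = x :: l.
  by case: m {Em} => [|y m]; [exists (ptR R), [::] | exists y, (rcons m (ptR R))].
pose E := behead (edges D).
have Ed : edges D = strand (ptL R) [::] x ++ E.
  by rewrite /E /edges /edges_of Em El path_edges_cons.
exists E, (ptL R), x, [::], [::].
have PX : perm_eq (edges D) (edges D ++ [::]) by rewrite cats0.
have PY : perm_eq (edges D') (edges D ++ [::]) by rewrite cats0 perm_sym.
have v0 (Z : diagram) (e g : edge) : e \in edges D -> g \in [::] -> xing e g -> mark Z e g = Virtual by [].
have oK := outer_tK PX PY sm (v0 D) (v0 D').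
have oA := outer_tA PX PY sm (v0 D) (v0 D').
have oC := outer_tC PX PY sm (v0 D) (v0 D').
have bal t t' : (forall e, e \in edges D -> t e = t' e) ->
    balanced E (strand (ptL R) [::] x) (strand (ptL R) [::] x) t t'.
  move=> H; split=> [e he|]; first by apply: H; rewrite Ed mem_cat he orbT.
  by rewrite big_seq [RHS]big_seq; apply: eq_bigr => e he; apply: H; rewrite Ed mem_cat he.
have ag F F' : agree_at E (ptL R) F F' -> agree0 (edges D) F F'.
  move=> [h1 h2] e; rewrite Ed mem_cat => /orP[|/h1 //].
  by rewrite inE => /eqP->.
split; [by rewrite -Ed | by rewrite -Ed perm_sym |].
split; first exact: bal.
- by move=> K K' _ _ /ag aK j _; apply: bal => e; exact: oA.
- by move=> K K' A A' B B' _ _ /ag aK _ _ /ag aA _ _ /ag aB; apply: bal => e; exact: oC.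
Qed.

Lemma all_virtual_rise (D : diagram) P z e : all_virtual D P -> e \in P ->
  (forall g, mark D e g = Virtual -> z e g = 0) -> rise (edges D) z e = 0.
Proof.
move=> vP he H; rewrite /rise big1_seq // => g /andP[/xing_cross x hg].
by apply: H; exact: vP.
Qed.

(** All increments along a virtual arc are 0. *)
Lemma detour_step (D D' : diagram) : wf D -> wf D' -> detour D D' ->
  restranded D D'.
Proof.
move=> wD wD' [E0 [a [b [u [u' [ab [P vP] [P' vP'] sm]]]]]].
exists E0, a, b, u, u'.
have virt (Z : diagram) Q : wf Z -> perm_eq (edges Z) (E0 ++ Q) -> all_virtual Z Q ->
    forall e g, e \in E0 -> g \in Q -> xing e g -> mark Z e g = Virtual.
  move=> wZ PZ vZ e g he hg x.
  have heZ : e \in edges Z by rewrite (perm_mem PZ) mem_cat he.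
  have hgZ : g \in edges Z by rewrite (perm_mem PZ) mem_cat hg orbT.
  have x' : xing g e by rewrite xingC.
  by rewrite (wf_flip wZ hgZ heZ x') (vZ _ _ hg heZ (xing_cross x')).
have vX := virt _ _ wD P vP; have vY := virt _ _ wD' P' vP'.
have bal t t' : (forall e, e \in E0 -> t e = t' e) ->
    (forall e, e \in strand a u b -> t e = 0) -> (forall e, e \in strand a u' b -> t' e = 0) ->
    balanced E0 (strand a u b) (strand a u' b) t t'.
  move=> H1 H2 H3; split=> //; transitivity (0 : R); [|symmetry];
    by apply: big1_seq => e /andP[_]; [exact: H2 || exact: H3].
split; [by apply: perm_trans P _; rewrite perm_catC | by apply: perm_trans P' _; rewrite perm_catC |].
split.
- apply: bal => e he; first exact: (outer_tK P P' sm vX vY he).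
    by apply: (all_virtual_rise vP he) => g; exact: jumpK_virtual.
  by apply: (all_virtual_rise vP' he) => g; exact: jumpK_virtual.
- move=> K K' _ _ [aK _] j _; apply: bal => e he; first exact: (outer_tA P P' sm vX vY _ aK he).
    by apply: (all_virtual_rise vP he) => g; exact: jumpA_virtual.
  by apply: (all_virtual_rise vP' he) => g; exact: jumpA_virtual.
- move=> K K' A A' B B' _ _ [aK _] _ _ [aA _] _ _ [aB _]; apply: bal => e he.
  + exact: (outer_tC P P' sm vX vY aK aA aB he).
  + by apply: (all_virtual_rise vP he) => g; exact: jumpC_virtual.
  + by apply: (all_virtual_rise vP' he) => g; exact: jumpC_virtual.
Qed.

(** The new circle has no crossings, hence no increments. *)
Lemma birth_step (D D' : diagram) : wf D -> wf D' -> birth D D' ->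
  topo Birth D D' false id (fun v => v \in vertices D) /\
  invariant_step D D' id (fun v => v \in vertices D).
Proof.
move=> wD wD' [l [El Els nox sm]]; have G := wf_gen wD; have G' := wf_gen wD'.
split; first exact: birth_topo El Els.
have P' : perm_eq (edges D') (edges D ++ loop_edges l).
  by rewrite /edges /edges_of El Els /= -catA perm_cat2l perm_catC.
have P : perm_eq (edges D) (edges D ++ [::]) by rewrite cats0.
have nx e g : e \in loop_edges l -> g \in edges D' -> ~~ xing e g.
  by move=> he hg; apply/negP => /xing_cross; exact: nox.
have vX (e g : edge) : e \in edges D -> g \in [::] -> xing e g -> mark D e g = Virtual by [].
have vY (e g : edge) : e \in edges D -> g \in loop_edges l -> xing e g -> mark D' e g = Virtual.
  move=> he hg; rewrite xingC (negbTE (nx _ _ hg _)) //.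
  by rewrite (perm_mem P') mem_cat he.
have t0 z e : e \in loop_edges l -> rise (edges D') z e = 0.
  by move=> he; apply: rise_nox => g; exact: nx.
have ag F F' : agree id (fun v => v \in vertices D) F F' -> agree0 (edges D) F F'.
  by move=> H e he; apply: H; case: (edge_vertices G he).
split.
- apply: birth_conserved El Els _ _ => // e he; last exact: t0.
  exact: (outer_tK P P' sm vX vY he).
- move=> K K' _ _ /ag aK j _; apply: birth_conserved El Els _ _ => // e he; last exact: t0.
  exact: (outer_tA P P' sm vX vY _ aK he).
- move=> K K' A A' B B' _ _ /ag aK _ _ /ag aA _ _ /ag aB.
  have -> : sC D' K' A' B' = \sum_(e <- edges D) tC D' K' A' B' e.
    rewrite /sC /sumC (perm_big _ P') big_cat /= -[RHS]addr0; congr (_ + _).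
    by apply: big1_seq => e /andP[_ he]; exact: t0.
  rewrite /sC /sumC big_seq [RHS]big_seq; apply: eq_bigr => e he.
  exact: (outer_tC P P' sm vX vY aK aA aB he).
Qed.

End Invariance.

(** * Kinks, pokes and triangles *)

Section LocalAlgebra.
Variable R : realType.
Notation pt := (R * R)%type.
Notation edge := (pt * pt)%type.
Notation diagram := (diagram R).
Variable D : diagram.
Notation E := (edges D).
Notation m := (mark D).

(** A kink made of three edges, the first and the last of which cross. The
    hypotheses describe the sums over crossings on its edges. *)
Section Kink.
Variables e1 e2 e3 : edge.
Hypothesis T1 : forall z, rise E z e1 = z e1 e3.
Hypothesis T2 : forall z, rise E z e2 = 0.
Hypothesis T3 : forall z, rise E z e3 = z e3 e1.
Hypothesis V1 : forall z F, level E z F e1 e3 = F e1.1.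
Hypothesis V3 : forall z F, level E z F e3 e1 = F e3.1.
Hypothesis h1 : e1 \in E.
Hypothesis h2 : e2 \in E.
Hypothesis l12 : e1.2 = e2.1.
Hypothesis l23 : e2.2 = e3.1.
Hypothesis fl : m e3 e1 = flip (m e1 e3).

(** The strand meets itself: the two jumps have opposite signs. *)
Lemma kink_K : tK D e1 + (tK D e2 + tK D e3) = 0.
Proof.
rewrite /tK /riseK T1 T2 T3 /jumpK fl (sgn_swap e3).
by case: (m e1 e3); rewrite /=; ring.
Qed.

(** The loop of the kink is entered and left at the same crossing, and the level
    changes along it by the sign of that crossing. *)
Lemma kink_index K : potK D K -> (if m e1 e3 is Virtual then false else true) ->
  relidx E m K e1 e3 = 0 /\ relidx E m K e3 e1 = 0.
Proof.
move=> pK cl.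
have E3 : K e3.1 = K e1.1 + sgn e1 e3.
  rewrite -l23 (pK _ h2) -l12 (pK _ h1) /tK /riseK T1 T2 addr0 /jumpK.
  by case: (m e1 e3) cl.
by rewrite /relidx !V1 !V3 E3 (sgn_swap e3); split; ring.
Qed.

Lemma kink_A K j : potK D K -> j != 0 -> tA D j K e1 + (tA D j K e2 + tA D j K e3) = 0.
Proof.
move=> pK j0; rewrite /tA /riseA T1 T2 T3 /jumpA fl; have := kink_index pK.
case: (m e1 e3) => /= H; rewrite ?addr0 //.
  by have [_ ->] := H isT; rewrite [0 == j]eq_sym (negbTE j0) ?add0r ?addr0.
by have [-> _] := H isT; rewrite [0 == j]eq_sym (negbTE j0) ?add0r ?addr0.
Qed.

Lemma kink_C K A B : potK D K -> tC D K A B e1 + (tC D K A B e2 + tC D K A B e3) = 0.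
Proof.
move=> pK; rewrite /tC /riseC T1 T2 T3 /jumpC fl; have := kink_index pK.
have n1 : (0 == 1 :> R) = false by rewrite eq_sym oner_eq0.
have n2 : (0 == 2%:R :> R) = false by rewrite eq_sym pnatr_eq0.
case: (m e1 e3) => /= H; rewrite ?addr0 //.
  by have [_ ->] := H isT; rewrite n1 n2 ?add0r ?addr0 ?mulr0 ?addr0.
by have [-> _] := H isT; rewrite n1 n2 ?add0r ?addr0 ?mulr0 ?addr0.
Qed.
End Kink.

(** A strand [g] and a strand made of [e1] and [e2] that crosses it twice with
    opposite signs; [o] tells which crossing comes first on [g]. *)
Section Poke.
Variables (g e1 e2 : edge) (o over : bool).
Hypothesis Tg : forall z, rise E z g = z g e1 + z g e2.
Hypothesis T1 : forall z, rise E z e1 = z e1 g.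
Hypothesis T2 : forall z, rise E z e2 = z e2 g.
Hypothesis V1 : forall z F, level E z F e1 g = F e1.1.
Hypothesis V2 : forall z F, level E z F e2 g = F e2.1.
Hypothesis Vg1 : forall z F, level E z F g e1 = F g.1 + if o then 0 else z g e2.
Hypothesis Vg2 : forall z F, level E z F g e2 = F g.1 + if o then z g e1 else 0.
Hypothesis he : e1 \in E.
Hypothesis l12 : e1.2 = e2.1.
Hypothesis s12 : sgn g e2 = - sgn g e1.
Hypothesis mg1 : m g e1 = if over then Over else Under.
Hypothesis mg2 : m g e2 = if over then Over else Under.
Hypothesis m1g : m e1 g = if over then Under else Over.
Hypothesis m2g : m e2 g = if over then Under else Over.

Lemma poke_jumpK : [/\ jumpK m g e1 = sgn g e1, jumpK m g e2 = - sgn g e1,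
  jumpK m e1 g = - sgn g e1 & jumpK m e2 g = sgn g e1].
Proof.
rewrite /jumpK mg1 mg2 m1g m2g (sgn_swap e1) (sgn_swap e2) s12 opprK.
by case: (over).
Qed.

Lemma poke_K : tK D g = 0 /\ tK D e1 + tK D e2 = 0.
Proof.
have [j1 j2 j3 j4] := poke_jumpK.
by rewrite /tK /riseK Tg T1 T2 j1 j2 j3 j4; split; ring.
Qed.

(** Between the two crossings both levels change by the same amount. *)
Lemma poke_index K : potK D K -> relidx E m K g e1 = relidx E m K g e2 /\
  relidx E m K e1 g = relidx E m K e2 g.
Proof.
move=> pK; have [j1 j2 j3 j4] := poke_jumpK.
have E2 : K e2.1 = K e1.1 - sgn g e1 by rewrite -l12 (pK _ he) /tK /riseK T1 j3.
rewrite /relidx !V1 !V2 !Vg1 !Vg2 j1 j2 E2 s12 (sgn_swap e1) (sgn_swap e2) s12.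
by case: (o); split; ring.
Qed.

Lemma poke_A K j : potK D K -> tA D j K g = 0 /\ tA D j K e1 + tA D j K e2 = 0.
Proof.
move=> pK; have [i1 i2] := poke_index pK.
rewrite /tA /riseA Tg T1 T2 /jumpA mg1 mg2 m1g m2g i1 i2 (sgn_swap e1) (sgn_swap e2) s12.
by case: (over); do ?case: ifP => _; split; ring.
Qed.

(** The level [A] of the lower strand changes between the two crossings only if
    their index is 1, and the levels [A] and [B] of the upper strand do not change
    at all. Both crossings thus contribute the same quantity, with opposite signs. *)
Lemma poke_C K A B : potK D K -> potA D 1 K A -> potA D (-1) K B ->
  tC D K A B g = 0 /\ tC D K A B e1 + tC D K A B e2 = 0.
Proof.
move=> pK pA pB; have [i1 i2] := poke_index pK.
have A2 : A e2.1 = A e1.1 + jumpA E m 1 K e1 g.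
  by rewrite -l12 (pA _ he) /tA /riseA T1.
have B2 : B e2.1 = B e1.1 + jumpA E m (-1) K e1 g.
  by rewrite -l12 (pB _ he) /tA /riseA T1.
rewrite /tC /riseC Tg T1 T2 /jumpC mg1 mg2 m1g m2g i1 i2 (sgn_swap e1) (sgn_swap e2) s12.
rewrite /levelA !V1 !V2 !Vg1 !Vg2 A2 B2 /jumpA ?mg1 ?mg2 ?m1g ?m2g ?i1 ?i2 (sgn_swap e1) ?s12.
have n21 : (2%:R == 1 :> R) = false by rewrite -[1]/(1%:R) eqr_nat.
have n12 : (1 == 2%:R :> R) = false by rewrite eq_sym.
case: (over) => /=.
  case: (eqVneq (relidx E m K e2 g) 2%:R) => [->|_]; rewrite ?n21.
    by case: (o); split; rewrite ?addr0 //; ring.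
  by case: (relidx E m K e2 g == 1); case: (o); split; rewrite ?addr0 //; ring.
case: (eqVneq (relidx E m K g e2) 2%:R) => [->|_]; rewrite ?n21.
  by case: (o); split; rewrite ?addr0 //; ring.
by case: (relidx E m K g e2 == 1); case: (relidx E m K g e2 == -1); case: (o); split;
   rewrite ?addr0 //; ring.
Qed.
End Poke.
End LocalAlgebra.

Inductive tri := T1 | T2 | T3.
Definition trineq (i j : tri) : bool :=
  match i, j with T1, T1 | T2, T2 | T3, T3 => false | _, _ => true end.
Definition third (i j : tri) : tri :=
  match i, j with
  | T1, T2 | T2, T1 => T3 | T1, T3 | T3, T1 => T2 | T2, T3 | T3, T2 => T1
  | _, _ => T1 end.

Section Triangle.
Variable R : realType.
Notation pt := (R * R)%type.
Notation edge := (pt * pt)%type.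
Notation diagram := (diagram R).

(** Three strands of [D] that meet pairwise: [SE i] lists the edges of the strand
    [i], which starts at [st i]; [c i j] is the one that crosses the strand [j],
    and [o i j] tells that the crossing with [j] comes first. *)
Record triangle (D : diagram) (SE : tri -> seq edge) (st : tri -> pt)
    (c : tri -> tri -> edge) (o : tri -> tri -> bool) (h : tri -> nat)
    (s : tri -> tri -> R) : Prop := Triangle {
  tri_rise : forall i j, trineq i j -> forall z,
    \sum_(e <- SE i) rise (edges D) z e =
      z (c i j) (c j i) + z (c i (third i j)) (c (third i j) i);
  tri_level : forall i j, trineq i j -> forall z F, pot (edges D) (rise (edges D) z) F ->
    level (edges D) z F (c i j) (c j i) = F (st i) +
      if o i j then 0 else z (c i (third i j)) (c (third i j) i);
  tri_o : forall i j, trineq i j -> o i (third i j) = ~~ o i j;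
  tri_m : forall i j, trineq i j -> mark D (c i j) (c j i) =
    if (h j < h i)%N then Over else Under;
  tri_s : forall i j, trineq i j -> sgn (c i j) (c j i) = s i j }.

(** The jumps of the lowest strand [x] in a triangle with strands [y] above it and
    [z] on top, where the crossings [xy], [yz] and [xz] have indices [p], [q] and
    [p + q], and the booleans tell that the crossing [xy] comes first on [x], on
    [y]. Reversing the order of all crossings, a term for index 2 at [xy] changes
    by the jump of [A] at [xz] when [q = -1] and by the jump of [B] at [yz], which
    occurs for the same [q]; a term for index 2 at [xz] changes by the jump of [A]
    at [xy] when [p = q = 1], and then so does the term for index 1 at [xy], by the
    jump of [A] at [yz]. In both cases the two changes cancel, by the hypothesis on
    signs. *)
Lemma tri_alg (sxy sxz syz Ax Ay By Az Bz p q : R) (c1 c2 : bool) :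
  (if c1 then - sxz else sxz) = (if c2 then - syz else syz) ->
  let f c1 c2 :=
    sxy * ((if p == 2%:R then
              Ax + (if c1 then 0 else if p + q == 1 then sxz else 0)
              - (By + (if c2 then 0 else if q == -1 then syz else 0)) else 0)
           + (if p == 1 then Ay + (if c2 then 0 else if q == 1 then syz else 0) else 0))
    + sxz * ((if p + q == 2%:R then
                Ax + (if ~~ c1 then 0 else if p == 1 then sxy else 0) - Bz else 0)
             + (if p + q == 1 then Az else 0)) in
  f c1 c2 = f (~~ c1) (~~ c2).
Proof.
move=> H f; rewrite /f.
have n21 : (2%:R == 1 :> R) = false by rewrite -[1]/(1%:R) eqr_nat.
have n12 : (1 == 2%:R :> R) = false by rewrite eq_sym.
case: (eqVneq p 2%:R) => [->|p2].
  have -> : (2%:R + q == 1) = (q == -1) by apply/eqP/eqP; lra.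
  rewrite n21; case: (q == -1); last first.
    by case: (_ == _); move: H; case: c1; case: c2 => /= H; ring.
  have {}H : (if c1 then sxz else - sxz) = (if c2 then syz else - syz).
    by case: c1 H; case: c2 => /= H; lra.
  by case: (_ == _); case: c1 H; case: c2 => /= H;
     (have -> : sxz = syz by lra) || (have -> : sxz = - syz by lra); ring.
case: (eqVneq p 1) => [->|p1].
  have -> : (1 + q == 2%:R) = (q == 1) by apply/eqP/eqP; lra.
  case: (q == 1); last first.
    by case: (_ == _); move: H; case: c1; case: c2 => /= H; ring.
  have {}H : (if c1 then sxz else - sxz) = (if c2 then syz else - syz).
    by case: c1 H; case: c2 => /= H; lra.
  by case: (_ == _); case: c1 H; case: c2 => /= H;
     (have -> : sxz = syz by lra) || (have -> : sxz = - syz by lra); ring.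
by case: (p + q == 2%:R); case: (p + q == 1); case: c1 {H}; case: c2 => /=; ring.
Qed.

End Triangle.

(** * The triangle move *)

Section TriangleMove.
Variable R : realType.
Notation pt := (R * R)%type.
Notation edge := (pt * pt)%type.
Notation diagram := (diagram R).

Lemma third_facts i j : trineq i j ->
  [/\ trineq j i, third j i = third i j, trineq i (third i j), third i (third i j) = j
    & [/\ trineq (third i j) i, trineq j (third i j), trineq (third i j) j,
          third j (third i j) = i & third (third i j) j = i]].
Proof. by case: i; case: j. Qed.

Lemma third_back i j : trineq i j -> third (third i j) i = j.
Proof. by case: i; case: j. Qed.

(** The levels and jumps at the crossings of a triangle, expressed by the levels at
    the starts of the three strands. *)
Section OneTriangle.
Variables (D : diagram) (SE : tri -> seq edge) (st : tri -> pt).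
Variables (c : tri -> tri -> edge) (o : tri -> tri -> bool) (h : tri -> nat).
Variable s : tri -> tri -> R.
Hypothesis Tr : triangle D SE st c o h s.
Notation E := (edges D).
Notation m := (mark D).

Lemma tri_jumpK i j : trineq i j -> jumpK m (c i j) (c j i) = s i j.
Proof.
by move=> n; rewrite /jumpK (tri_m Tr n) (tri_s Tr n); case: ifP.
Qed.

Definition tri_ix (K : pt -> R) i j : R :=
  K (st j) + (if o j i then 0 else s j (third i j))
  - (K (st i) + if o i j then 0 else s i (third i j)) - s i j.

Lemma tri_relidx K i j : trineq i j -> potK D K ->
  relidx E m K (c i j) (c j i) = tri_ix K i j.
Proof.
move=> n pK; have [n' t1 n2 t2 [n3 n4 n5 t3 t4]] := third_facts n.
rewrite /relidx !(tri_level Tr) // !tri_jumpK // ?t1 //.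
by rewrite (tri_s Tr n) /tri_ix.
Qed.

Definition tri_jA (J : R) K i j : R :=
  if (h j < h i)%N then 0 else if tri_ix K i j == J then s i j else 0.

Lemma tri_jumpA J K i j : trineq i j -> potK D K ->
  jumpA E m J K (c i j) (c j i) = tri_jA J K i j.
Proof.
move=> n pK; rewrite /jumpA (tri_m Tr n) tri_relidx // (tri_s Tr n) /tri_jA.
by case: (h j < h i)%N.
Qed.

Lemma tri_levelA J K A i j : trineq i j -> potK D K -> potA D J K A ->
  levelA E m J K A (c i j) (c j i) =
  A (st i) + if o i j then 0 else tri_jA J K i (third i j).
Proof.
move=> n pK pA; have [n' t1 n2 t2 [n3 n4 n5 t3 t4]] := third_facts n.
by rewrite /levelA (tri_level Tr n) // tri_jumpA.
Qed.

Definition tri_jC K A B i j : R :=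
  if (h j < h i)%N then 0 else s i j *
   ((if tri_ix K i j == 2%:R then
      A (st i) + (if o i j then 0 else tri_jA 1 K i (third i j))
      - (B (st j) + if o j i then 0 else tri_jA (-1) K j (third i j)) else 0)
    + (if tri_ix K i j == 1 then
      A (st j) + (if o j i then 0 else tri_jA 1 K j (third i j)) else 0)).

Lemma tri_jumpC K A B i j : trineq i j -> potK D K -> potA D 1 K A -> potA D (-1) K B ->
  jumpC E m K A B (c i j) (c j i) = tri_jC K A B i j.
Proof.
move=> n pK pA pB; have [n' t1 n2 t2 [n3 n4 n5 t3 t4]] := third_facts n.
rewrite /jumpC (tri_m Tr n) tri_relidx // (tri_s Tr n) /tri_jC.
by rewrite !tri_levelA // ?t1; case: (h j < h i)%N.
Qed.

Lemma tri_tK i j : trineq i j -> \sum_(e <- SE i) tK D e = s i j + s i (third i j).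
Proof.
move=> n; have [n' t1 n2 t2 [n3 n4 n5 t3 t4]] := third_facts n.
by rewrite /tK /riseK (tri_rise Tr n) !tri_jumpK.
Qed.
Lemma tri_tA J K i j : trineq i j -> potK D K ->
  \sum_(e <- SE i) tA D J K e = tri_jA J K i j + tri_jA J K i (third i j).
Proof.
move=> n pK; have [n' t1 n2 t2 [n3 n4 n5 t3 t4]] := third_facts n.
by rewrite /tA /riseA (tri_rise Tr n) !tri_jumpA.
Qed.
Lemma tri_tC K A B i j : trineq i j -> potK D K -> potA D 1 K A -> potA D (-1) K B ->
  \sum_(e <- SE i) tC D K A B e = tri_jC K A B i j + tri_jC K A B i (third i j).
Proof.
move=> n pK pA pB; have [n' t1 n2 t2 [n3 n4 n5 t3 t4]] := third_facts n.
by rewrite /tC /riseC (tri_rise Tr n) !tri_jumpC.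
Qed.
End OneTriangle.

(** The two sides of the third move. The hypothesis [os] is planarity: both of its
    sides tell on which side of the strand [k] the crossing of [i] and [j] lies. *)
Section TwoTriangles.
Variables (D D' : diagram) (SE SE' : tri -> seq edge) (st : tri -> pt).
Variables (c c' : tri -> tri -> edge) (o o' : tri -> tri -> bool) (h : tri -> nat).
Variable s : tri -> tri -> R.
Hypothesis Tr : triangle D SE st c o h s.
Hypothesis Tr' : triangle D' SE' st c' o' h s.
Hypothesis oo' : forall i j, trineq i j -> o' i j = ~~ o i j.
Hypothesis hinj : forall i j, trineq i j -> h i <> h j.
Hypothesis sN : forall i j, s j i = - s i j.
Hypothesis os : forall i j, trineq i j -> let k := third i j in
  (if o i k then s i k else - s i k) = (if o j k then s j k else - s j k).

Let os' i j : trineq i j ->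
  (if o i j then - s i (third i j) else s i (third i j)) =
  (if o j i then - s j (third i j) else s j (third i j)).
Proof.
move=> n; have [n' t1 n2 t2 [n3 n4 n5 t3 t4]] := third_facts n.
have := os n; rewrite /= (tri_o Tr n) -{3}t1 (tri_o Tr n').
by case: (o i j); case: (o j i).
Qed.

Lemma tri_move_K i : \sum_(e <- SE i) tK D e = \sum_(e <- SE' i) tK D' e.
Proof.
have [j n] : exists j, trineq i j by case: i; [exists T2 | exists T1 | exists T1].
by rewrite (tri_tK Tr n) (tri_tK Tr' n).
Qed.

Variables K K' : pt -> R.
Hypothesis pK : potK D K.
Hypothesis pK' : potK D' K'.
Hypothesis KK : forall i, K (st i) = K' (st i).

(** Each of the two strands at a crossing meets the third one before the crossing
    on exactly one side of the move, and the resulting changes of the two levels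
    are equal. *)
Lemma tri_ix_move i j : trineq i j -> tri_ix st o s K i j = tri_ix st o' s K' i j.
Proof.
move=> n; have [n' t1 n2 t2 [n3 n4 n5 t3 t4]] := third_facts n.
rewrite /tri_ix !KK !oo' //; have := os' n.
by case: (o i j); case: (o j i) => /= H; lra.
Qed.

Lemma tri_jA_move J i j : trineq i j ->
  tri_jA st o h s J K i j = tri_jA st o' h s J K' i j.
Proof. by move=> n; rewrite /tri_jA tri_ix_move. Qed.

Lemma tri_move_A J i : \sum_(e <- SE i) tA D J K e = \sum_(e <- SE' i) tA D' J K' e.
Proof.
have [j n] : exists j, trineq i j by case: i; [exists T2 | exists T1 | exists T1].
have [n' t1 n2 t2 [n3 n4 n5 t3 t4]] := third_facts n.
by rewrite (tri_tA Tr J n) // (tri_tA Tr' J n) // !tri_jA_move.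
Qed.

(** An index is a difference of levels at a crossing. The three crossings lie at
    different places of the strands, but the jumps between them compensate by the
    planarity condition. *)
Lemma tri_ix_add i j : trineq i j ->
  tri_ix st o s K i (third i j) = tri_ix st o s K i j + tri_ix st o s K j (third i j).
Proof.
move=> n; have [n' t1 n2 t2 [n3 n4 n5 t3 t4]] := third_facts n.
have H1 := os' n; have H2 := os' n2; have H3 := os' n4.
have o1 := tri_o Tr n; have o2 := tri_o Tr n'; have o3 := tri_o Tr n3.
rewrite t1 in o2.
have o3' : o (third i j) j = ~~ o (third i j) i.
  by rewrite -o3 third_back.
rewrite t2 t3 in H1 H2 H3 *; rewrite /tri_ix t2 t3 o1 o2 o3'.
move: H1 H2 H3; rewrite o1 o2 o3' (sN i j) (sN i (third i j)) (sN j (third i j)).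
by case: (o i j); case: (o j i); case: (o (third i j) i) => /= *; lra.
Qed.

Variables A B A' B' : pt -> R.
Hypothesis AA : forall i, A (st i) = A' (st i).
Hypothesis BB : forall i, B (st i) = B' (st i).

Notation jC := (tri_jC st o h s K A B).
Notation jC' := (tri_jC st o' h s K' A' B').

(** The middle strand passes under the top one only, and neither of these passes
    under anything else that could raise [A] or [B] before that crossing. *)
Lemma tri_C_side i j : trineq i j -> (h (third i j) < h i)%N -> (h i < h j)%N ->
  jC i j = jC' i j.
Proof.
move=> n l1 l2; have [n' t1 n2 t2 [n3 n4 n5 t3 t4]] := third_facts n.
rewrite /tri_jC -!tri_ix_move // !AA !BB /tri_jA l1 (ltn_trans l1 l2).
by rewrite !if_same.
Qed.

Lemma tri_C_bottom i j : trineq i j -> (h i < h j)%N -> (h j < h (third i j))%N ->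
  jC i j + jC i (third i j) = jC' i j + jC' i (third i j).
Proof.
move=> n l1 l2; have [n' t1 n2 t2 [n3 n4 n5 t3 t4]] := third_facts n.
have l3 := ltn_trans l1 l2.
have alg := @tri_alg R (s i j) (s i (third i j)) (s j (third i j)) (A (st i)) (A (st j))
  (B (st j)) (A (st (third i j))) (B (st (third i j)))
  (tri_ix st o s K i j) (tri_ix st o s K j (third i j)) (o i j) (o j i) (os' n).
rewrite /tri_jC /tri_jA t2 -!tri_ix_move // -!AA -!BB ?t1 ?t3.
have f1 : (h j < h i)%N = false by rewrite ltnNge (ltnW l1).
have f2 : (h (third i j) < h j)%N = false by rewrite ltnNge (ltnW l2).
have f3 : (h (third i j) < h i)%N = false by rewrite ltnNge (ltnW l3).
rewrite ?f1 ?f2 ?f3 ?l1 ?l2 ?l3 !oo' // !(tri_o Tr n) (tri_ix_add n) !if_same !addr0.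
by move: alg; rewrite /= => ->.
Qed.

Lemma tri_jC_over i j : (h j < h i)%N -> jC i j = 0 /\ jC' i j = 0.
Proof. by move=> l; rewrite /tri_jC l. Qed.

Hypothesis pA : potA D 1 K A.
Hypothesis pA' : potA D' 1 K' A'.
Hypothesis pB : potA D (-1) K B.
Hypothesis pB' : potA D' (-1) K' B'.

Lemma tri_move_C i : \sum_(e <- SE i) tC D K A B e = \sum_(e <- SE' i) tC D' K' A' B' e.
Proof.
have [j n] : exists j, trineq i j by case: i; [exists T2 | exists T1 | exists T1].
rewrite (tri_tC Tr n) // (tri_tC Tr' n) //.
have [n' t1 n2 t2 [n3 n4 n5 t3 t4]] := third_facts n.
have [lij|lji|/(hinj n)//] := ltngtP (h i) (h j).
  have [lik|lki|/(hinj n2)//] := ltngtP (h i) (h (third i j)).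
    have [ljk|lkj|/(hinj n4)//] := ltngtP (h j) (h (third i j)).
      exact: tri_C_bottom.
    have := tri_C_bottom n2; rewrite t2 => /(_ lik lkj).
    by rewrite addrC => ->; rewrite addrC.
  rewrite (tri_C_side n lki lij).
  by have [-> ->] := tri_jC_over lki.
have [-> ->] := tri_jC_over lji.
have [lik|lki|/(hinj n2)//] := ltngtP (h i) (h (third i j)).
  by have := tri_C_side n2; rewrite t2 => ->.
by have [-> ->] := tri_jC_over lki.
Qed.

End TwoTriangles.
End TriangleMove.

(** * Surgeries and saddles *)

Section Surgeries.
Variable R : realType.
Notation pt := (R * R)%type.
Notation edge := (pt * pt)%type.
Notation diagram := (diagram R).
Notation ipt := (int * int)%type.
Notation iedge := (ipt * ipt)%type.
Notation quarter := (@quarter R).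

Definition iorient (b : bool) (l : seq ipt) := if b then rev l else l.
Lemma orient_map (g : ipt -> pt) b l : orient b (map g l) = map g (iorient b l).
Proof. by case: b; rewrite //= map_rev. Qed.

Lemma quarterE (x y : R) (a b : int) : x = a%:~R / 4%:R -> y = b%:~R / 4%:R ->
  (x, y) = quarter (a, b).
Proof. by move=> -> ->. Qed.

(** Sums over the crossings of a local picture that fills a chart. *)
Section LocalBlock.
Variables (p u v : pt) (D : diagram) (E0 : seq edge) (iS : seq iedge).
Hypothesis uv : det u v != 0.
Hypothesis P : perm_eq (edges D) (E0 ++ map (affE p u v) iS).
Hypothesis nox : forall e g, e \in iS -> g \in E0 -> ~~ xing (affE p u v e) g.
Notation aE := (affE p u v).

Lemma rise_local (z : edge -> edge -> R) e : e \in iS ->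
  rise (edges D) z (aE e) = \sum_(g <- [seq g <- iS | xing e g]) z (aE e) (aE g).
Proof. exact: (rise_block uv P nox). Qed.

Lemma level_local (z : edge -> edge -> R) (F : pt -> R) e h : e \in iS -> level (edges D) z F (aE e) (aE h) =
  F (aff p u v e.1) + \sum_(g <- [seq g <- iS | xing e g && before e g h]) z (aE e) (aE g).
Proof. exact: (level_block uv P nox). Qed.

Lemma local_sub e : e \in iS -> aE e \in edges D.
Proof. by move=> he; rewrite (perm_mem P) mem_cat map_f ?orbT. Qed.

Lemma local_virtual e g : e \in E0 -> g \in map aE iS -> xing e g -> mark D e g = Virtual.
Proof.
by move=> he /mapP[g' hg ->]; rewrite xingC (negbTE (nox hg he)).
Qed.
End LocalBlock.

Lemma layered_mark (f : pt -> pt) p u v h (iS : seq (seq ipt)) (D : diagram) i j e e' :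
  (forall q, f q = (p.1 + q.1 * u.1 + q.2 * v.1, p.2 + q.1 * u.2 + q.2 * v.2)) ->
  layered h f (map (map quarter) iS) D ->
  e \in ipath (nth [::] iS i) -> e' \in ipath (nth [::] iS j) -> xing e e' ->
  mark D (affE p (u4 u) (v4 v) e) (affE p (u4 u) (v4 v) e') =
    if (h j < h i)%N then Over else Under.
Proof.
move=> Ef lay he he' x.
pose q4 : pt -> pt -> pt * pt := fun _ _ => ((4%:R^-1, 0), (0, 4%:R^-1)).
have uv4 : det (4%:R^-1, 0) (0, 4%:R^-1) != 0 :> R.
  by rewrite /det /= mulr0 subr0 mulf_neq0 ?invr_neq0 ?pnatr_eq0.
have qE q : quarter q = aff (0, 0) (4%:R^-1, 0) (0, 4%:R^-1) q.
  by rewrite /quarter /aff /=; congr pair; ring.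
have mem k e0 : e0 \in ipath (nth [::] iS k) ->
    affE (0, 0) (4%:R^-1, 0) (0, 4%:R^-1) e0
      \in path_edges (nth [::] (map (map quarter) iS) k).
  move=> h0; have lt : (k < size iS)%N.
    by rewrite ltnNge; apply/negP => le; move: h0; rewrite nth_default.
  rewrite (nth_map [::]) // (eq_map qE) path_edges_aff.
  exact: map_f.
have fE e0 : affE p (u4 u) (v4 v) e0 = mapE f (affE (0, 0) (4%:R^-1, 0) (0, 4%:R^-1) e0).
  by rewrite /affE /mapE /= -!qE -!(chart_quarter Ef).
rewrite !fE; apply: lay (mem _ _ he) (mem _ _ he') _.
by apply: xing_cross; rewrite xing_aff.
Qed.

Definition iA_saddle : seq (seq ipt) := [:: [:: (-4, -2); (4, -2)]; [:: (4, 2); (-4, 2)]].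
Definition iB_saddle : seq (seq ipt) :=
  [:: [:: (-4, -2); (-2, 0); (-4, 2)]; [:: (4, 2); (2, 0); (4, -2)]].

Lemma saddle_invariant (X Y : diagram) p q r s u1 u2 w1 w2 E : wf X -> wf Y ->
  perm_eq (edges X) (strand p u1 q ++ (strand r u2 s ++ E)) ->
  perm_eq (edges Y) (strand p w1 s ++ (strand r w2 q ++ E)) ->
  cidx X p <> cidx X r -> same_marks X Y E ->
  (forall e g, e \in strand p u1 q ++ strand r u2 s -> g \in edges X -> ~~ xing e g) ->
  (forall e g, e \in strand p w1 s ++ strand r w2 q -> g \in edges Y -> ~~ xing e g) ->
  invariant_step X Y (collapse2 p r u1 u2) (saddle_kept X u1 u2).
Proof.
move=> wX wY PX PY sep sm nX nY; have GX := wf_gen wX; have GY := wf_gen wY.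
have PX' : perm_eq (edges X) (E ++ (strand p u1 q ++ strand r u2 s)).
  by apply: perm_trans PX _; rewrite catA perm_catC.
have PY' : perm_eq (edges Y) (E ++ (strand p w1 s ++ strand r w2 q)).
  by apply: perm_trans PY _; rewrite catA perm_catC.
have vX (e g : edge) : e \in E -> g \in strand p u1 q ++ strand r u2 s ->
    xing e g -> mark X e g = Virtual.
  by move=> he hg; rewrite xingC (negbTE (nX _ _ hg _)) // (perm_mem PX') mem_cat he.
have vY (e g : edge) : e \in E -> g \in strand p w1 s ++ strand r w2 q ->
    xing e g -> mark Y e g = Virtual.
  by move=> he hg; rewrite xingC (negbTE (nY _ _ hg _)) // (perm_mem PY') mem_cat he.
have t0 z e : e \in strand p u1 q ++ strand r u2 s -> rise (edges X) z e = 0.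
  by move=> he; apply: rise_nox => g; exact: nX.
have t0' z e : e \in strand p w1 s ++ strand r w2 q -> rise (edges Y) z e = 0.
  by move=> he; apply: rise_nox => g; exact: nY.
have ag F F' : agree (collapse2 p r u1 u2) (saddle_kept X u1 u2) F F' -> agree0 E F F'.
  move=> H e he; have [c1 _] := col_E GX PX he.
  rewrite H ?c1 //; split; first by case: (edge_vertices GX (two_E PX he)).
  rewrite mem_cat negb_or; apply/andP; split.
    by apply: (rest_start_in GX PX); rewrite mem_cat he orbT.
  by apply: (rest_start_in GX (two_swap PX)); rewrite mem_cat he orbT.
split.
- apply: (saddle_conserved GX PX PY sep) => e he.
  + exact: (outer_tK PX' PY' sm vX vY he).
  + exact: t0.
  + exact: t0'.
- move=> K K' _ _ /ag aK j _; apply: (saddle_conserved GX PX PY sep) => e he.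
  + exact: (outer_tA PX' PY' sm vX vY _ aK he).
  + exact: t0.
  + exact: t0'.
- move=> K K' A A' B B' _ _ /ag aK _ _ /ag aA _ _ /ag aB.
  rewrite /sC /sumC (perm_big _ PX') [RHS](perm_big _ PY') !big_cat /=.
  have z (Z : diagram) (S : seq edge) (z0 : edge -> edge -> R) :
      (forall e, e \in S -> rise (edges Z) z0 e = 0) -> \sum_(e <- S) rise (edges Z) z0 e = 0.
    by move=> H; apply: big1_seq => e /andP[_ /H].
  rewrite !(z X (strand _ _ _)) ?(z Y (strand _ _ _)); try by
    move=> e he; (apply: t0 || apply: t0'); rewrite mem_cat he ?orbT.
  rewrite !addr0 big_seq [RHS]big_seq; apply: eq_bigr => e he.
  exact: (outer_tC PX' PY' sm vX vY aK aA aB he).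
Qed.

(** Which side is the finer one depends on how the two strands are connected
    outside the picture: either they lie on distinct components before the move, or
    on distinct ones after it. *)
Lemma saddle_step (D D' : diagram) : wf D -> wf D' -> saddle D D' ->
  exists b rho kept, topo Saddle D D' b rho kept /\
    invariant_step (finer b D D') (coarser b D D') rho kept.
Proof.
move=> wD wD' [f [E0 [[[p [u [v [uv Ef]]]] _] P P' out sm]]].
pose a := aff p (u4 u) (v4 v); pose aE := affE p (u4 u) (v4 v).
have uv4 := det4 uv.
have EA : [:: [:: (-1, - 2^-1); (1, - 2^-1)]; [:: (1, 2^-1); (-1, 2^-1)]] =
    map (map quarter) iA_saddle.
  by rewrite /iA_saddle /=; do ![congr (_ :: _) | apply: quarterE | lra].
have EB : [:: [:: (-1, - 2^-1); (- 2^-1, 0); (-1, 2^-1)];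
        [:: (1, 2^-1); (2^-1, 0); (1, - 2^-1)]] = map (map quarter) iB_saddle.
  by rewrite /iB_saddle /=; do ![congr (_ :: _) | apply: quarterE | lra].
rewrite EA (strand_edges_aff Ef) in P; rewrite EB (strand_edges_aff Ef) in P'.
have nox iS e g : all in_box (iedges iS) -> e \in iedges iS -> g \in E0 -> ~~ xing (aE e) g.
  by move=> /allP H /H box; exact: (outside_nox Ef out box).
have nD e g : e \in map aE (iedges iA_saddle) -> g \in edges D -> ~~ xing e g.
  move=> /mapP[e' he ->]; rewrite (perm_mem P) mem_cat => /orP[|/mapP[g' hg ->]].
    by move=> hg; apply: (nox iA_saddle) he hg; vm_compute.
  rewrite xing_aff //; move: e' g' he hg.
  have : all (fun e => all (fun g => ~~ xing e g) (iedges iA_saddle)) (iedges iA_saddle).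
    by vm_compute.
  by move=> /allP H e' g' /H/allP H' /H'.
have nD' e g : e \in map aE (iedges iB_saddle) -> g \in edges D' -> ~~ xing e g.
  move=> /mapP[e' he ->]; rewrite (perm_mem P') mem_cat => /orP[|/mapP[g' hg ->]].
    by move=> hg; apply: (nox iB_saddle) he hg; vm_compute.
  rewrite xing_aff //; move: e' g' he hg.
  have : all (fun e => all (fun g => ~~ xing e g) (iedges iB_saddle)) (iedges iB_saddle).
    by vm_compute.
  by move=> /allP H e' g' /H/allP H' /H'.
pose p1 := a (-4, -2); pose q1 := a (4, -2); pose r1 := a (4, 2); pose s1 := a (-4, 2).
pose m1 := a (-2, 0); pose m2 := a (2, 0).
have LA : map aE (iedges iA_saddle) = strand p1 [::] q1 ++ strand r1 [::] s1 by [].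
have LB : map aE (iedges iB_saddle) = strand p1 [:: m1] s1 ++ strand r1 [:: m2] q1 by [].
have PX : perm_eq (edges D) (strand p1 [::] q1 ++ (strand r1 [::] s1 ++ E0)).
  by apply: perm_trans P _; rewrite -/aE LA perm_catC -catA.
have PY : perm_eq (edges D') (strand p1 [:: m1] s1 ++ (strand r1 [:: m2] q1 ++ E0)).
  by apply: perm_trans P' _; rewrite -/aE LB perm_catC -catA.
rewrite LA in nD; rewrite LB in nD'.
have GX := wf_gen wD; have GY := wf_gen wD'.
(* On one component before the move, they are on two after it, and the move is read
   backwards. *)
have [same|/eqP sep] := eqVneq (cidx D p1) (cidx D r1).
  have sep := merged_splits GX GY PX PY same.
  exists true, (collapse2 p1 r1 [:: m1] [:: m2]), (saddle_kept D' [:: m1] [:: m2]); split.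
    by apply: (saddle_topo true GY GX PY PX sep) => w.
  apply: saddle_invariant PY PX sep _ nD' nD => //.
  by move=> e g he hg x; rewrite sm.
exists false, (collapse2 p1 r1 [::] [::]), (saddle_kept D [::] [::]); split.
  by apply: (saddle_topo false GX GY PX PY sep).
exact: saddle_invariant PX PY sep sm nD nD'.
Qed.

End Surgeries.

(** * The first and second Reidemeister moves *)

Section ReidemeisterMoves.
Variable R : realType.
Notation pt := (R * R)%type.
Notation edge := (pt * pt)%type.
Notation diagram := (diagram R).
Notation ipt := (int * int)%type.
Notation iedge := (ipt * ipt)%type.
Notation quarter := (@quarter R).

Section Local.
Variables (p u v : pt) (D D' : diagram) (E0 : seq edge).
Hypothesis uv : det u v != 0.
Hypothesis wD' : wf D'.
Hypothesis sm : same_marks D D' E0.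
Notation a := (aff p u v).
Notation aE := (affE p u v).

(** The integer conditions are those that computation checks for the picture of the
    first move in either orientation. *)
Lemma kink_balanced x0 x1 x2 x3 (A := ipath [:: x0; x3]) (B := ipath [:: x0; x1; x2; x3])
  (e1 : iedge := (x0, x1)) (e2 : iedge := (x1, x2)) (e3 : iedge := (x2, x3)) :
  perm_eq (edges D) (E0 ++ map aE A) -> perm_eq (edges D') (E0 ++ map aE B) ->
  (forall e g, e \in A -> g \in E0 -> ~~ xing (aE e) g) ->
  (forall e g, e \in B -> g \in E0 -> ~~ xing (aE e) g) ->
  [seq g <- A | xing (x0, x3) g] = [::] ->
  [seq g <- B | xing e1 g] = [:: e3] -> [seq g <- B | xing e2 g] = [::] ->
  [seq g <- B | xing e3 g] = [:: e1] ->
  ~~ before e1 e3 e3 -> ~~ before e3 e1 e1 -> restranded D D'.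
Proof.
move=> P P' nA nB fA f1 f2 f3 b1 b3.
exists E0, (a x0), (a x3), [::], [:: a x1; a x2].
have PX : perm_eq (edges D) (strand (a x0) [::] (a x3) ++ E0).
  by apply: perm_trans P _; rewrite perm_catC.
have PY : perm_eq (edges D') (strand (a x0) [:: a x1; a x2] (a x3) ++ E0).
  by apply: perm_trans P' _; rewrite perm_catC.
split=> //.
have vX := local_virtual D nA; have vY := local_virtual D' nB.
have m1 : e1 \in B by rewrite inE eqxx.
have m2 : e2 \in B by rewrite !inE eqxx orbT.
have m3 : e3 \in B by rewrite !inE eqxx !orbT.
have tA0 z : rise (edges D) z (aE (x0, x3)) = 0.
  by rewrite (rise_local uv P nA) ?inE // fA big_nil.
have t1 z : rise (edges D') z (aE e1) = z (aE e1) (aE e3).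
  by rewrite (rise_local uv P' nB) // f1 big_seq1.
have t2 z : rise (edges D') z (aE e2) = 0.
  by rewrite (rise_local uv P' nB) // f2 big_nil.
have t3 z : rise (edges D') z (aE e3) = z (aE e3) (aE e1).
  by rewrite (rise_local uv P' nB) // f3 big_seq1.
have sub q e l h : [seq g <- B | xing e g] = l -> all (fun g => ~~ before e g h) l ->
    [seq g <- B | xing e g && before e g h] = q -> q = [::].
  move=> fl al <-; rewrite (eq_filter (a2 := predI (fun g => before e g h) (xing e))).
    by rewrite filter_predI fl; elim: l al {fl} => //= g l IH /andP[/negbTE-> /IH].
  by move=> g; rewrite /= andbC.
have v1 z F : level (edges D') z F (aE e1) (aE e3) = F (aE e1).1.
  by rewrite (level_local uv P' nB) // (sub _ _ _ _ f1 _ erefl) /= ?b1 // big_nil addr0.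
have v3 z F : level (edges D') z F (aE e3) (aE e1) = F (aE e3).1.
  by rewrite (level_local uv P' nB) // (sub _ _ _ _ f3 _ erefl) /= ?b3 // big_nil addr0.
have h1 := local_sub P' m1; have h2 := local_sub P' m2; have h3 := local_sub P' m3.
have x13 : xing (aE e1) (aE e3).
  rewrite xing_aff //; have : e3 \in [seq g <- B | xing e1 g] by rewrite f1 inE eqxx.
  by rewrite mem_filter => /andP[].
have fl := wf_flip wD' h1 h3 x13.
have l12 : (aE e1).2 = (aE e2).1 by []. have l23 : (aE e2).2 = (aE e3).1 by [].
have bal t t' : (forall e, e \in E0 -> t e = t' e) -> t (aE (x0, x3)) = 0 ->
    t' (aE e1) + (t' (aE e2) + t' (aE e3)) = 0 ->
    balanced E0 (strand (a x0) [::] (a x3)) (strand (a x0) [:: a x1; a x2] (a x3)) t t'.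
  move=> H1 H2 H3; split=> //.
  rewrite /strand /= !path_edges_cons !big_cons.
  rewrite -[(a x0, a x3)]/(aE (x0, x3)) H2 /path_edges /= !big_nil !addr0; symmetry; exact: H3.
split.
- apply: bal => [e he||]; first exact: (outer_tK P P' sm vX vY he).
    exact: tA0.
  exact: (kink_K t1 t2 t3 fl).
- move=> K K' _ pK' [aK _] j j0; apply: bal => [e he||].
  + exact: (outer_tA P P' sm vX vY _ aK he).
  + exact: tA0.
  + exact: (kink_A t1 t2 t3 v1 v3 h1 h2 l12 l23 fl).
- move=> K K' A1 A1' B1 B1' _ pK' [aK _] _ _ [aA _] _ _ [aB _]; apply: bal => [e he||].
  + exact: (outer_tC P P' sm vX vY aK aA aB he).
  + exact: tA0.
  + exact: (kink_C t1 t2 t3 v1 v3 h1 h2 l12 l23 fl).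
Qed.
End Local.

Lemma reidemeister1_step (D D' : diagram) : wf D -> wf D' ->
  reidemeister1 D D' -> restranded D D'.
Proof.
move=> wD wD' [f [E0 [b [[[[p [u [v [uv Ef]]]] _] P P' out sm] _]]]].
pose iA := [:: iorient b [:: (-4, 0); (4, 0)]].
pose iB := [:: iorient b [:: (-4, 0); (2, 2); (-2, 2); (4, 0)]].
have EA : [:: orient b [:: (-1, 0); (1, 0)]] = map (map quarter) iA.
  rewrite /iA /= -orient_map; congr [:: orient b _].
  by rewrite /=; do ![congr (_ :: _) | apply: quarterE | lra].
have EB : [:: orient b [:: (-1, 0); (2^-1, 2^-1); (- 2^-1, 2^-1); (1, 0)]] =
    map (map quarter) iB.
  rewrite /iB /= -orient_map; congr [:: orient b _].
  by rewrite /=; do ![congr (_ :: _) | apply: quarterE | lra].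
rewrite EA (strand_edges_aff Ef) in P; rewrite EB (strand_edges_aff Ef) in P'.
have nox iS e g : all in_box (iedges iS) -> e \in iedges iS -> g \in E0 ->
    ~~ xing (affE p (u4 u) (v4 v) e) g.
  by move=> /allP H /H box; exact: (outside_nox Ef out box).
have nA : forall e g, e \in iedges iA -> g \in E0 -> ~~ xing (affE p (u4 u) (v4 v) e) g.
  by move=> e g; apply: nox; rewrite /iA; case: (b); vm_compute.
have nB : forall e g, e \in iedges iB -> g \in E0 -> ~~ xing (affE p (u4 u) (v4 v) e) g.
  by move=> e g; apply: nox; rewrite /iB; case: (b); vm_compute.
move: P P' nA nB; rewrite /iA /iB; case: (b) => P P' nA nB.
  by refine (kink_balanced (x0 := (4, 0)) (x1 := (-2, 2)) (x2 := (2, 2)) (x3 := (-4, 0))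
    (det4 uv) wD' sm P P' nA nB _ _ _ _ _ _); vm_compute.
by refine (kink_balanced (x0 := (-4, 0)) (x1 := (2, 2)) (x2 := (-2, 2)) (x3 := (4, 0))
    (det4 uv) wD' sm P P' nA nB _ _ _ _ _ _); vm_compute.
Qed.

(** The straight strand [g] counts as one of the outer edges: the balance holds for
    it separately. *)
Lemma poke_balanced (p u v : pt) (D D' : diagram) (E0 : seq edge) (y0 y1 x0 x1 x2 : ipt)
  (over : bool) : det u v != 0 -> wf D' -> same_marks D D' E0 ->
  let A := [:: (y0, y1); (x0, x2)] in let B := [:: (y0, y1); (x0, x1); (x1, x2)] in
  let g := (y0, y1) in let e1 := (x0, x1) in let e2 := (x1, x2) in
  let aE := affE p u v in
  perm_eq (edges D) (E0 ++ map aE A) -> perm_eq (edges D') (E0 ++ map aE B) ->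
  (forall e f, e \in A -> f \in E0 -> ~~ xing (aE e) f) ->
  (forall e f, e \in B -> f \in E0 -> ~~ xing (aE e) f) ->
  [seq f <- A | xing g f] = [::] -> [seq f <- A | xing (x0, x2) f] = [::] ->
  [seq f <- B | xing g f] = [:: e1; e2] -> [seq f <- B | xing e1 f] = [:: g] ->
  [seq f <- B | xing e2 f] = [:: g] -> before g e1 e2 = ~~ before g e2 e1 ->
  sgn g e2 = - sgn g e1 ->
  mark D' (aE g) (aE e1) = (if over then Over else Under) ->
  mark D' (aE g) (aE e2) = (if over then Over else Under) ->
  restranded D D'.
Proof.
move=> uv wD' sm A B g e1 e2 aE P P' nA nB fA fA' fg f1 f2 bb s12 mg1 mg2.
pose a := aff p u v.
exists (aE g :: E0), (a x0), (a x2), [::], [:: a x1].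
have PX : perm_eq (edges D) (strand (a x0) [::] (a x2) ++ aE g :: E0).
  by apply: perm_trans P _; rewrite perm_catC /= -[_ :: _ :: E0]/([:: aE g] ++ [:: aE (x0, x2)] ++ E0) perm_catCA.
have PY : perm_eq (edges D') (strand (a x0) [:: a x1] (a x2) ++ aE g :: E0).
  apply: perm_trans P' _; rewrite perm_catC.
  by rewrite -[map _ _ ++ E0]/([:: aE g] ++ [:: aE e1; aE e2] ++ E0) perm_catCA.
split=> //.
have vX := local_virtual D nA; have vY := local_virtual D' nB.
have mg : g \in B by rewrite inE eqxx.
have m1 : e1 \in B by rewrite !inE eqxx orbT.
have m2 : e2 \in B by rewrite !inE eqxx !orbT.
have tAg z : rise (edges D) z (aE g) = 0.
  by rewrite (rise_local uv P nA) ?inE ?eqxx // fA big_nil.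
have tA0 z : rise (edges D) z (aE (x0, x2)) = 0.
  by rewrite (rise_local uv P nA) ?inE ?eqxx ?orbT // fA' big_nil.
have tg z : rise (edges D') z (aE g) = z (aE g) (aE e1) + z (aE g) (aE e2).
  by rewrite (rise_local uv P' nB) // fg big_cons big_seq1.
have t1 z : rise (edges D') z (aE e1) = z (aE e1) (aE g).
  by rewrite (rise_local uv P' nB) // f1 big_seq1.
have t2 z : rise (edges D') z (aE e2) = z (aE e2) (aE g).
  by rewrite (rise_local uv P' nB) // f2 big_seq1.
have fil e h : [seq f <- B | xing e f && before e f h] =
    [seq f <- [seq f <- B | xing e f] | before e f h].
  by rewrite -filter_predI; apply: eq_filter => f; rewrite /= andbC.
have bself e f : before e f f = false :> bool by rewrite /before !ltxx if_same.
have v1 z F : level (edges D') z F (aE e1) (aE g) = F (aE e1).1.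
  by rewrite (level_local uv P' nB) // fil f1 /= bself big_nil addr0.
have v2 z F : level (edges D') z F (aE e2) (aE g) = F (aE e2).1.
  by rewrite (level_local uv P' nB) // fil f2 /= bself big_nil addr0.
have vg1 z F : level (edges D') z F (aE g) (aE e1) =
    F (aE g).1 + if before g e1 e2 then 0 else z (aE g) (aE e2).
  rewrite (level_local uv P' nB) // fil fg /= bself bb.
  by case: (before g e2 e1); rewrite /= ?big_seq1 ?big_nil.
have vg2 z F : level (edges D') z F (aE g) (aE e2) =
    F (aE g).1 + if before g e1 e2 then z (aE g) (aE e1) else 0.
  rewrite (level_local uv P' nB) // fil fg /= bself.
  by case: (before g e1 e2); rewrite /= ?big_seq1 ?big_nil.
have hg := local_sub P' mg; have h1 := local_sub P' m1; have h2 := local_sub P' m2.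
have xg e : e \in [seq f <- B | xing g f] -> xing (aE g) (aE e).
  by rewrite mem_filter xing_aff // => /andP[].
have xg1 : xing (aE g) (aE e1) by apply: xg; rewrite fg inE eqxx.
have xg2 : xing (aE g) (aE e2) by apply: xg; rewrite fg !inE eqxx orbT.
have m1g : mark D' (aE e1) (aE g) = if over then Under else Over.
  by rewrite (wf_flip wD' hg h1 xg1) mg1; case: (over).
have m2g : mark D' (aE e2) (aE g) = if over then Under else Over.
  by rewrite (wf_flip wD' hg h2 xg2) mg2; case: (over).
have sg12 : sgn (aE g) (aE e2) = - sgn (aE g) (aE e1).
  by rewrite !sgn_aff s12 mulrNz mulrN.
have l12 : (aE e1).2 = (aE e2).1 by [].
have bal t t' : (forall e, e \in E0 -> t e = t' e) -> t (aE g) = 0 -> t (aE (x0, x2)) = 0 ->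
    t' (aE g) = 0 /\ t' (aE e1) + t' (aE e2) = 0 ->
    balanced (aE g :: E0) (strand (a x0) [::] (a x2)) (strand (a x0) [:: a x1] (a x2)) t t'.
  move=> H1 H2 H3 [H4 H5]; split.
    by move=> e; rewrite inE => /orP[/eqP->|/H1 //]; rewrite H2 H4.
  rewrite /strand /= !path_edges_cons !big_cons.
  by rewrite -[(a x0, a x2)]/(aE (x0, x2)) H3 /path_edges /= !big_nil !addr0; symmetry; exact: H5.
have sub0 (F F' : pt -> R) : agree_at (aE g :: E0) (a x0) F F' -> agree0 E0 F F'.
  by move=> [H _] e he; apply: H; rewrite inE he orbT.
split.
- apply: bal => [e he|||]; first exact: (outer_tK P P' sm vX vY he).
  + exact: tAg.
  + exact: tA0.
  + exact: (poke_K tg t1 t2 sg12 mg1 mg2 m1g m2g).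
- move=> K K' _ pK' /sub0 aK j j0; apply: bal => [e he|||].
  + exact: (outer_tA P P' sm vX vY _ aK he).
  + exact: tAg.
  + exact: tA0.
  + exact: (poke_A tg t1 t2 v1 v2 vg1 vg2 h1 l12 sg12 mg1 mg2 m1g m2g).
- move=> K K' A1 A1' B1 B1' _ pK' /sub0 aK _ pA' /sub0 aA _ pB' /sub0 aB.
  apply: bal => [e he|||].
  + exact: (outer_tC P P' sm vX vY aK aA aB he).
  + exact: tAg.
  + exact: tA0.
  + exact: (poke_C tg t1 t2 v1 v2 vg1 vg2 h1 l12 sg12 mg1 mg2 m1g m2g).
Qed.

Lemma reidemeister2_step (D D' : diagram) : wf D -> wf D' ->
  reidemeister2 D D' -> restranded D D'.
Proof.
move=> wD wD' [f [E0 [b [b' [h [hinj [[[p [u [v [uv Ef]]]] _] P P' out sm] lay]]]]]].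
pose iA := [:: iorient b [:: (-4, -2); (4, -2)]; iorient b' [:: (-4, 2); (4, 2)]].
pose iB := [:: iorient b [:: (-4, -2); (4, -2)]; iorient b' [:: (-4, 2); (0, -3); (4, 2)]].
have EA : [:: orient b [:: (-1, - 2^-1); (1, - 2^-1)]; orient b' [:: (-1, 2^-1); (1, 2^-1)]]
    = map (map quarter) iA.
  rewrite /iA /= -!orient_map; congr [:: orient b _; orient b' _];
  by rewrite /=; do ![congr (_ :: _) | apply: quarterE | lra].
have EB : [:: orient b [:: (-1, - 2^-1); (1, - 2^-1)];
      orient b' [:: (-1, 2^-1); (0, - (3 / 4)); (1, 2^-1)]] = map (map quarter) iB.
  rewrite /iB /= -!orient_map; congr [:: orient b _; orient b' _];
  by rewrite /=; do ![congr (_ :: _) | apply: quarterE | lra].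
rewrite EA (strand_edges_aff Ef) in P; rewrite EB (strand_edges_aff Ef) in P'.
rewrite EB in lay.
have nox iS e g : all in_box (iedges iS) -> e \in iedges iS -> g \in E0 ->
    ~~ xing (affE p (u4 u) (v4 v) e) g.
  by move=> /allP H /H box; exact: (outside_nox Ef out box).
have nA : forall e g, e \in iedges iA -> g \in E0 -> ~~ xing (affE p (u4 u) (v4 v) e) g.
  by move=> e g; apply: nox; rewrite /iA; case: (b); case: (b'); vm_compute.
have nB : forall e g, e \in iedges iB -> g \in E0 -> ~~ xing (affE p (u4 u) (v4 v) e) g.
  by move=> e g; apply: nox; rewrite /iB; case: (b); case: (b'); vm_compute.
have lm e e' : e \in ipath (nth [::] iB 0) -> e' \in ipath (nth [::] iB 1) -> xing e e' ->
  mark D' (affE p (u4 u) (v4 v) e) (affE p (u4 u) (v4 v) e') =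
    if (h 1 < h 0)%N then Over else Under.
  exact: (layered_mark Ef lay).
(* One picture for each choice of orientations of the two strands. *)
move: P P' nA nB lm; rewrite /iA /iB; case: (b); case: (b') => P P' nA nB lm.
- refine (poke_balanced (y0 := (4, -2)) (y1 := (-4, -2)) (x0 := (4, 2)) (x1 := (0, -3))
    (x2 := (-4, 2)) (det4 uv) wD' sm P P' nA nB _ _ _ _ _ _ _ (lm _ _ _ _ _) (lm _ _ _ _ _));
    by vm_compute.
- refine (poke_balanced (y0 := (4, -2)) (y1 := (-4, -2)) (x0 := (-4, 2)) (x1 := (0, -3))
    (x2 := (4, 2)) (det4 uv) wD' sm P P' nA nB _ _ _ _ _ _ _ (lm _ _ _ _ _) (lm _ _ _ _ _));
    by vm_compute.
- refine (poke_balanced (y0 := (-4, -2)) (y1 := (4, -2)) (x0 := (4, 2)) (x1 := (0, -3))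
    (x2 := (-4, 2)) (det4 uv) wD' sm P P' nA nB _ _ _ _ _ _ _ (lm _ _ _ _ _) (lm _ _ _ _ _));
    by vm_compute.
- refine (poke_balanced (y0 := (-4, -2)) (y1 := (4, -2)) (x0 := (-4, 2)) (x1 := (0, -3))
    (x2 := (4, 2)) (det4 uv) wD' sm P P' nA nB _ _ _ _ _ _ _ (lm _ _ _ _ _) (lm _ _ _ _ _));
    by vm_compute.
Qed.

End ReidemeisterMoves.

(** * The third Reidemeister move *)

Section ReidemeisterThree.
Variable R : realType.
Notation pt := (R * R)%type.
Notation edge := (pt * pt)%type.
Notation diagram := (diagram R).
Notation ipt := (int * int)%type.
Notation iedge := (ipt * ipt)%type.
Notation quarter := (@quarter R).

(** The integer model of three strands that meet pairwise: two segments [e1] and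
    [e2], and a path of two edges; [f1] is the edge that crosses [e1] and [f2] the
    one that crosses [e2], and [sw] tells that [f1] comes first. *)
Section Model.
Variables (e1 e2 f1 f2 : iedge) (sw : bool).

Definition tri_c (i j : tri) : iedge :=
  match i, j with
  | T1, _ => e1 | T2, _ => e2 | T3, T1 => f1 | T3, _ => f2 end.
Definition tri_first (i j : tri) : bool :=
  match i, j with
  | T3, T1 => sw | T3, _ => ~~ sw
  | _, _ => before (tri_c i j) (tri_c j i) (tri_c (third i j) i) end.
Definition tri_sg (i j : tri) : int := sgn (tri_c i j) (tri_c j i).
Definition tri_S : seq iedge := [:: e1; e2] ++ (if sw then [:: f1; f2] else [:: f2; f1]).
Definition tri_SE (i : tri) : seq iedge :=
  match i with T1 => [:: e1] | T2 => [:: e2] | T3 => if sw then [:: f1; f2] else [:: f2; f1] end.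
Definition tri_st (i : tri) : ipt :=
  match i with T1 => e1.1 | T2 => e2.1 | T3 => if sw then f1.1 else f2.1 end.

Definition pairs : seq (tri * tri) :=
  [:: (T1, T2); (T1, T3); (T2, T1); (T2, T3); (T3, T1); (T3, T2)].

Definition all_pairs (Q : tri -> tri -> bool) : bool :=
  all (fun ij => Q ij.1 ij.2) pairs.

Definition tri_ok : bool :=
  [&& [seq g <- tri_S | xing e1 g] == [:: e2; f1],
      [seq g <- tri_S | xing e2 g] == [:: e1; f2],
      [seq g <- tri_S | xing f1 g] == [:: e1],
      [seq g <- tri_S | xing f2 g] == [:: e2],
      (if sw then f1.2 == f2.1 else f2.2 == f1.1),
      all_pairs (fun i j => (tri_first i (third i j) == ~~ tri_first i j))
    & all in_box tri_S].
End Model.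

Lemma pairsP (Q : tri -> tri -> bool) : all_pairs Q ->
  forall i j, trineq i j -> Q i j.
Proof. by move=> /= /and5P[h1 h2 h3 h4 /and3P[h5 h6 _]] [] []. Qed.

Section OneModel.
Variables (e1 e2 f1 f2 : iedge) (sw : bool).
Hypothesis ok : tri_ok e1 e2 f1 f2 sw.
Notation c := (tri_c e1 e2 f1 f2).
Notation o := (tri_first e1 e2 f1 f2 sw).
Notation S := (tri_S e1 e2 f1 f2 sw).
Notation SE := (tri_SE e1 e2 f1 f2 sw).
Notation st := (tri_st e1 e2 f1 f2 sw).

Variables (p u v : pt) (D : diagram) (E0 : seq edge) (h : tri -> nat).
Hypothesis uv : det u v != 0.
Notation aE := (affE p u v).
Hypothesis P : perm_eq (edges D) (E0 ++ map aE S).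
Hypothesis nox : forall e g, e \in S -> g \in E0 -> ~~ xing (aE e) g.
Hypothesis marks : forall i j, trineq i j -> mark D (aE (c i j)) (aE (c j i)) =
  if (h j < h i)%N then Over else Under.

Lemma model_triangle : triangle D (fun i => map aE (SE i)) (fun i => aff p u v (st i))
  (fun i j => aE (c i j)) o h (fun i j => Num.sg (det u v) * (tri_sg e1 e2 f1 f2 i j)%:~R).
Proof.
have [/eqP x1 /eqP x2 /eqP x3 /eqP x4 /andP[lk /andP[os _]]] := and5P ok.
have m1 : e1 \in S by rewrite inE eqxx.
have m2 : e2 \in S by rewrite !inE eqxx orbT.
have m3 : f1 \in S by rewrite /tri_S; case: (sw); rewrite !inE eqxx ?orbT.
have m4 : f2 \in S by rewrite /tri_S; case: (sw); rewrite !inE eqxx ?orbT.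
have t1 z : rise (edges D) z (aE e1) = z (aE e1) (aE e2) + z (aE e1) (aE f1).
  by rewrite (rise_local uv P nox) // x1 big_cons big_seq1.
have t2 z : rise (edges D) z (aE e2) = z (aE e2) (aE e1) + z (aE e2) (aE f2).
  by rewrite (rise_local uv P nox) // x2 big_cons big_seq1.
have t3 z : rise (edges D) z (aE f1) = z (aE f1) (aE e1).
  by rewrite (rise_local uv P nox) // x3 big_seq1.
have t4 z : rise (edges D) z (aE f2) = z (aE f2) (aE e2).
  by rewrite (rise_local uv P nox) // x4 big_seq1.
have fil e k : [seq f <- S | xing e f && before e f k] =
    [seq f <- [seq f <- S | xing e f] | before e f k].
  by rewrite -filter_predI; apply: eq_filter => f; rewrite /= andbC.
have bself e f : before e f f = false :> bool by rewrite /before !ltxx if_same.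
have oN i j : trineq i j -> o i (third i j) = ~~ o i j.
  by move=> n; apply/eqP; exact: (pairsP os n).
split.
- case=> -[] //= _ z; rewrite ?big_cons ?big_nil ?addr0 ?t1 ?t2 //; try exact: addrC.
    by case: (sw); rewrite /= !big_cons big_nil addr0 t3 t4 // addrC.
  by case: (sw); rewrite /= !big_cons big_nil addr0 t3 t4 // addrC.
- have n12 := oN T1 T2 isT; have n13 := oN T1 T3 isT.
  have n21 := oN T2 T1 isT; have n23 := oN T2 T3 isT.
  rewrite /= in n12 n13 n21 n23.
  case=> -[] //= _ z F pF; rewrite (level_local uv P nox) // fil ?x1 ?x2 ?x3 ?x4 /= ?bself.
  + by rewrite n12; case: (before e1 e2 f1); rewrite /= ?big_seq1 ?big_nil.
  + by rewrite n13; case: (before e1 f1 e2); rewrite /= ?big_seq1 ?big_nil.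
  + by rewrite n21; case: (before e2 e1 f2); rewrite /= ?big_seq1 ?big_nil.
  + by rewrite n23; case: (before e2 f2 e1); rewrite /= ?big_seq1 ?big_nil.
  + rewrite big_nil addr0; move: lk; case: (sw) => /= /eqP lk; first by rewrite addr0.
    by rewrite -lk -t4 -[aff p u v f2.2]/((aE f2).2) (pF _ (local_sub P m4)).
  + rewrite big_nil addr0; move: lk; case: (sw) => /= /eqP lk; last by rewrite addr0.
    by rewrite -lk -t3 -[aff p u v f1.2]/((aE f1).2) (pF _ (local_sub P m3)).
- exact: oN.
- exact: marks.
- by move=> i j n; rewrite sgn_aff.
Qed.
End OneModel.

(** The two sides of the third move have the same signs and opposite orders of
    crossings; the condition that compares [o] with [s] is the planarity condition
    of the triangle move. *)
Definition tri_pair_ok (e1 e2 f1 f2 : iedge) (sw : bool) (f1' f2' : iedge) (sw' : bool) :=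
  let s := tri_sg e1 e2 f1 f2 in let o := tri_first e1 e2 f1 f2 sw in
  [&& tri_ok e1 e2 f1 f2 sw, tri_ok e1 e2 f1' f2' sw',
      all_pairs (fun i j => tri_sg e1 e2 f1' f2' i j == s i j),
      all_pairs (fun i j => tri_first e1 e2 f1' f2' sw' i j == ~~ o i j),
      all_pairs (fun i j => let k := third i j in
        (if o i k then s i k else - s i k) ==
        (if o j k then s j k else - s j k))
    & (if sw then f1.1 else f2.1) == (if sw' then f1'.1 else f2'.1)].

(** The move is read as the replacement of the bent strand; the balance for the two
    straight ones is part of the balance of the outer edges. *)
Lemma triangle_balanced (p u v : pt) (D D' : diagram) (E0 : seq edge)
    (e1 e2 f1 f2 f1' f2' : iedge) (sw sw' : bool) (h : tri -> nat) :
  det u v != 0 -> same_marks D D' E0 ->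
  tri_pair_ok e1 e2 f1 f2 sw f1' f2' sw' ->
  let aE := affE p u v in
  let S := tri_S e1 e2 f1 f2 sw in let S' := tri_S e1 e2 f1' f2' sw' in
  let c := tri_c e1 e2 f1 f2 in let c' := tri_c e1 e2 f1' f2' in
  let e3 := if sw then f2.2 else f1.2 in
  e3 == (if sw' then f2'.2 else f1'.2) ->
  perm_eq (edges D) (E0 ++ map aE S) -> perm_eq (edges D') (E0 ++ map aE S') ->
  (forall e g, e \in S -> g \in E0 -> ~~ xing (aE e) g) ->
  (forall e g, e \in S' -> g \in E0 -> ~~ xing (aE e) g) ->
  (forall i j, trineq i j -> h i <> h j) ->
  (forall i j, trineq i j -> mark D (aE (c i j)) (aE (c j i)) =
    if (h j < h i)%N then Over else Under) ->
  (forall i j, trineq i j -> mark D' (aE (c' i j)) (aE (c' j i)) =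
    if (h j < h i)%N then Over else Under) ->
  restranded D D'.
Proof.
move=> uv sm /and5P[ok ok' sgs ords /andP[os /eqP st0]] aE S S' c c' e3 /eqP en0.
move=> P P' nA nB hinj mk mk'; pose a := aff p u v.
have Tr := model_triangle ok uv P nA mk.
have Tr' := model_triangle ok' uv P' nB mk'.
set st := fun i => aff p u v (tri_st e1 e2 f1' f2' sw' i) in Tr'.
have stE i : st i = aff p u v (tri_st e1 e2 f1 f2 sw i).
  by case: i => //; rewrite /st /= -st0.
set s := fun i j => Num.sg (det u v) * (tri_sg e1 e2 f1' f2' i j)%:~R in Tr'.
set o := tri_first e1 e2 f1 f2 sw in Tr.
set o' := tri_first e1 e2 f1' f2' sw' in Tr'.
have {}Tr : triangle D (fun i => map aE (tri_SE e1 e2 f1 f2 sw i)) st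
    (fun i j => aE (c i j)) o h s.
  case: Tr => T V O M G; split=> //.
    by move=> i j n z F pF; rewrite stE V.
  by move=> i j n; rewrite /s (eqP (pairsP sgs n)) G.
have oo i j : trineq i j -> o' i j = ~~ o i j by move=> n; exact/eqP/(pairsP ords n).
have sN i j : s j i = - s i j.
  by rewrite /s /tri_sg sgn_swap mulrNz mulrN.
have osR i j : trineq i j -> let k := third i j in
    (if o i k then s i k else - s i k) = (if o j k then s j k else - s j k).
  move=> n k; have := eqP (pairsP os n); rewrite -/o -/k.
  have [n' t1 n2 t2 [n3 n4 n5 t3 t4]] := third_facts n.
  rewrite /s (eqP (pairsP sgs n2)) (eqP (pairsP sgs n4)) -/k.
  have push (w : bool) (x : int) (d : R) :
      (if w then d * x%:~R else - (d * x%:~R)) = d * (if w then x else - x)%:~R.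
    by case: w; rewrite ?mulrNz ?mulrN.
  by rewrite !push => ->.
pose F1 := if sw then [:: aE f1; aE f2] else [:: aE f2; aE f1].
have s3 : map aE (tri_SE e1 e2 f1 f2 sw T3) =
    strand (st T3) [:: if sw then a f1.2 else a f2.2] (a e3).
  rewrite stE /e3 /tri_SE /tri_st; have [_ _ _ _ /andP[lk _]] := and5P ok.
  by case: (sw) lk => /= /eqP lk; rewrite /strand /path_edges /aE /affE /a /= lk.
have s3' : map aE (tri_SE e1 e2 f1' f2' sw' T3) =
    strand (st T3) [:: if sw' then a f1'.2 else a f2'.2] (a e3).
  rewrite en0 /st /tri_SE /tri_st; have [_ _ _ _ /andP[lk _]] := and5P ok'.
  by case: (sw') lk => /= /eqP lk; rewrite /strand /path_edges /aE /affE /a /= lk.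
have vX := local_virtual D nA; have vY := local_virtual D' nB.
pose E := [:: aE e1; aE e2] ++ E0.
exists E, (st T3), (a e3), [:: if sw then a f1.2 else a f2.2],
  [:: if sw' then a f1'.2 else a f2'.2].
have PX : perm_eq (edges D) (map aE (tri_SE e1 e2 f1 f2 sw T3) ++ E).
  apply: perm_trans P _; rewrite perm_catC.
  by rewrite /S /tri_S map_cat -catA perm_catCA.
have PY : perm_eq (edges D') (map aE (tri_SE e1 e2 f1' f2' sw' T3) ++ E).
  apply: perm_trans P' _; rewrite perm_catC.
  by rewrite /S' /tri_S map_cat -catA perm_catCA.
rewrite -s3 -s3'; split=> //.
have bal t t' : (forall e, e \in E0 -> t e = t' e) ->
    (forall i, \sum_(e <- map aE (tri_SE e1 e2 f1 f2 sw i)) t e =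
               \sum_(e <- map aE (tri_SE e1 e2 f1' f2' sw' i)) t' e) ->
    balanced E (map aE (tri_SE e1 e2 f1 f2 sw T3)) (map aE (tri_SE e1 e2 f1' f2' sw' T3)) t t'.
  move=> H1 H2; split; last exact: H2.
  move=> e; rewrite !inE => /or3P[/eqP->|/eqP->|/H1 //].
    by have := H2 T1; rewrite /= !big_seq1.
  by have := H2 T2; rewrite /= !big_seq1.
have sub0 (F F' : pt -> R) : agree_at E (st T3) F F' ->
    agree0 E0 F F' /\ forall i, F (st i) = F' (st i).
  move=> [H H3]; split; first by move=> e he; apply: H; rewrite mem_cat he orbT.
  by case=> //; [apply: (H (aE e1)) | apply: (H (aE e2))]; rewrite !inE eqxx ?orbT.
split.
- apply: bal => [e he|i]; first exact: (outer_tK P P' sm vX vY he).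
  exact: (tri_move_K Tr Tr').
- move=> K K' pK pK' /sub0[aK sK] j _; apply: bal => [e he|i].
    exact: (outer_tA P P' sm vX vY _ aK he).
  exact: (tri_move_A Tr Tr' oo osR pK pK' sK).
- move=> K K' A A' B B' pK pK' /sub0[aK sK] pA pA' /sub0[aA sA] pB pB' /sub0[aB sB].
  apply: bal => [e he|i]; first exact: (outer_tC P P' sm vX vY aK aA aB he).
  exact: (tri_move_C Tr Tr' oo hinj sN osR pK pK' sK sA sB).
Qed.

Definition tri_nat (i : tri) : nat := match i with T1 => 0 | T2 => 1 | T3 => 2 end.

(** The bent strand passes to the right or to the left of the crossing of the
    straight ones according to the sign of [x]. *)
Definition iS3 b b' b'' (x : int) : seq (seq ipt) :=
  [:: iorient b [:: (-4, -2); (4, 2)]; iorient b' [:: (-4, 2); (4, -2)];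
      iorient b'' [:: (0, -4); (x, 0); (0, 4)]].

Lemma reidemeister3_step (D D' : diagram) : wf D -> wf D' ->
  reidemeister3 D D' -> restranded D D'.
Proof.
move=> wD wD' [f [E0 [b [b' [b'' [h [hinj [[[p [u [v [uv Ef]]]] _] P P' out sm] lay lay']]]]]]].
have ES x (y : int) : x = y%:~R / 4%:R :> R ->
    [:: orient b [:: (-1, - 2^-1); (1, 2^-1)]; orient b' [:: (-1, 2^-1); (1, - 2^-1)];
        orient b'' [:: (0, -1); (x, 0); (0, 1)]] = map (map quarter) (iS3 b b' b'' y).
  move=> Ex; rewrite /iS3 /= -!orient_map; congr [:: orient b _; orient b' _; orient b'' _];
  by rewrite /=; do ![congr (_ :: _) | apply: quarterE | exact: Ex | lra].
have e2 : 2^-1 = (2 : int)%:~R / 4%:R :> R by lra.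
have e2' : - 2^-1 = (-2 : int)%:~R / 4%:R :> R by lra.
rewrite (ES _ _ e2) in P lay; rewrite (ES _ _ e2') in P' lay'.
rewrite (strand_edges_aff Ef) in P; rewrite (strand_edges_aff Ef) in P'.
have nox iS e g : all in_box (iedges iS) -> e \in iedges iS -> g \in E0 ->
    ~~ xing (affE p (u4 u) (v4 v) e) g.
  by move=> /allP H /H box; exact: (outside_nox Ef out box).
pose S0 := iS3 b b' b'' 2; pose S1 := iS3 b b' b'' (-2).
have nA : forall e g, e \in iedges S0 -> g \in E0 -> ~~ xing (affE p (u4 u) (v4 v) e) g.
  by move=> e g; apply: nox; rewrite /S0; case: (b); case: (b'); case: (b''); vm_compute.
have nB : forall e g, e \in iedges S1 -> g \in E0 -> ~~ xing (affE p (u4 u) (v4 v) e) g.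
  by move=> e g; apply: nox; rewrite /S1; case: (b); case: (b'); case: (b''); vm_compute.
pose i0 := ((0, 0), (0, 0)) : iedge.
pose e1 := head i0 (ipath (nth [::] S0 0)); pose e2i := head i0 (ipath (nth [::] S0 1)).
pose g k S := nth i0 (ipath (nth [::] S 2)) k.
(* With the bent strand upwards and [x > 0], the second straight strand is met
   first; orientation and the sign of [x] each exchange the order. *)
pose f1 := if b'' then g 0%N S0 else g 1%N S0; pose f2 := if b'' then g 1%N S0 else g 0%N S0.
pose f1' := if b'' then g 1%N S1 else g 0%N S1; pose f2' := if b'' then g 0%N S1 else g 1%N S1.
have ok : tri_pair_ok e1 e2i f1 f2 b'' f1' f2' (~~ b'').
  rewrite /e1 /e2i /f1 /f2 /f1' /f2' /g /S0 /S1.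
  by case: (b); case: (b'); case: (b''); vm_compute.
have en : (if b'' then f2.2 else f1.2) == (if ~~ b'' then f2'.2 else f1'.2).
  rewrite /f1 /f2 /f1' /f2' /g /S0 /S1.
  by case: (b); case: (b'); case: (b''); vm_compute.
have EP : iedges S0 = tri_S e1 e2i f1 f2 b''.
  rewrite /e1 /e2i /f1 /f2 /g /S0.
  by case: (b); case: (b'); case: (b''); vm_compute.
have EP' : iedges S1 = tri_S e1 e2i f1' f2' (~~ b'').
  rewrite /e1 /e2i /f1' /f2' /g /S0 /S1.
  by case: (b); case: (b'); case: (b''); vm_compute.
have hI i j : trineq i j -> h (tri_nat i) <> h (tri_nat j).
  by move=> n E; have := hinj _ _ E; clear E; move: n; case: i; case: j.
have chk : all_pairs (fun i j => [&& tri_c e1 e2i f1 f2 i j \in ipath (nth [::] S0 (tri_nat i)),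
    tri_c e1 e2i f1' f2' i j \in ipath (nth [::] S1 (tri_nat i)),
    xing (tri_c e1 e2i f1 f2 i j) (tri_c e1 e2i f1 f2 j i) &
    xing (tri_c e1 e2i f1' f2' i j) (tri_c e1 e2i f1' f2' j i)]).
  rewrite /e1 /e2i /f1 /f2 /f1' /f2' /g /S0 /S1.
  by case: (b); case: (b'); case: (b''); vm_compute.
have n_sym i j : trineq i j -> trineq j i by case: i; case: j.
have mk i j : trineq i j ->
    mark D (affE p (u4 u) (v4 v) (tri_c e1 e2i f1 f2 i j))
      (affE p (u4 u) (v4 v) (tri_c e1 e2i f1 f2 j i)) =
    if (h (tri_nat j) < h (tri_nat i))%N then Over else Under.
  move=> n; have /and4P[c1 c2 c3 c4] := pairsP chk n.
  have /and4P[c1' _ _ _] := pairsP chk (n_sym _ _ n).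
  exact: (layered_mark Ef lay c1 c1' c3).
have mk' i j : trineq i j ->
    mark D' (affE p (u4 u) (v4 v) (tri_c e1 e2i f1' f2' i j))
      (affE p (u4 u) (v4 v) (tri_c e1 e2i f1' f2' j i)) =
    if (h (tri_nat j) < h (tri_nat i))%N then Over else Under.
  move=> n; have /and4P[c1 c2 c3 c4] := pairsP chk n.
  have /and4P[_ c2' _ _] := pairsP chk (n_sym _ _ n).
  exact: (layered_mark Ef lay' c2 c2' c4).
rewrite -/S0 EP in P; rewrite -/S1 EP' in P'; rewrite EP in nA; rewrite EP' in nB.
exact: (triangle_balanced (h := h \o tri_nat) (det4 uv) sm ok en P P' nA nB hI mk mk').
Qed.

End ReidemeisterThree.

(** * Subdivision of an edge *)

Section Subdivision.
Variable R : realType.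
Notation pt := (R * R)%type.
Notation edge := (pt * pt)%type.
Notation diagram := (diagram R).

Variables (D D' : diagram) (E0 : seq edge) (e : edge) (s : R).
Hypothesis wD : wf D.
Hypothesis wD' : wf D'.
Hypothesis hs : 0 < s < 1.
Notation c := (on_edge e s).
Notation e1 := (e.1, c).
Notation e2 := (c, e.2).
Hypothesis P : perm_eq (edges D) (e :: E0).
Hypothesis P' : perm_eq (edges D') [:: e1, e2 & E0].
Hypothesis sm : same_marks D D' E0.
Hypothesis sm' : forall e' f, e' \in [:: e1; e2] -> f \in E0 ->
  cross e' f -> mark D' e' f = mark D e f.

Let s0 : 0 < s. Proof. by case/andP: hs. Qed.
Let s1 : 0 < 1 - s. Proof. by case/andP: hs => _; rewrite subr_gt0. Qed.

Lemma turn_e1 g : turn e1 g = s * turn e g.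
Proof. by rewrite /turn /det /vec /on_edge /=; ring. Qed.
Lemma turn_e2 g : turn e2 g = (1 - s) * turn e g.
Proof. by rewrite /turn /det /vec /on_edge /=; ring. Qed.
Lemma lead_e1 g : lead e1 g = lead e g. Proof. by []. Qed.
Lemma lead_e2 g : lead e2 g = lead e g - s * turn e g.
Proof. by rewrite /lead /turn /det /vec /on_edge /=; ring. Qed.
Lemma leadr_e1 g : lead g e1 = s * lead g e.
Proof. by rewrite /lead /det /vec /on_edge /=; ring. Qed.
Lemma leadr_e2 g : lead g e2 = (1 - s) * lead g e.
Proof. by rewrite /lead /det /vec /on_edge /=; ring. Qed.
Lemma turnr_e1 g : turn g e1 = s * turn g e.
Proof. by rewrite turn_swap turn_e1 (turn_swap g); ring. Qed.
Lemma turnr_e2 g : turn g e2 = (1 - s) * turn g e.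
Proof. by rewrite turn_swap turn_e2 (turn_swap g); ring. Qed.

Let s0n : s != 0. Proof. by rewrite gt_eqF. Qed.
Let s1n : 1 - s != 0. Proof. by rewrite gt_eqF. Qed.

Lemma par_e1 g : turn e g != 0 -> par e1 g = par e g / s.
Proof. by move=> n; rewrite /par turn_e1 lead_e1; field; rewrite s0n n. Qed.
Lemma par_e2 g : turn e g != 0 -> par e2 g = (par e g - s) / (1 - s).
Proof. by move=> n; rewrite /par turn_e2 lead_e2; field; rewrite s1n n. Qed.
Lemma parr_e1 g : turn e g != 0 -> par g e1 = par g e.
Proof.
move=> n; have n' : turn g e != 0 by rewrite turn_swap oppr_eq0.
by rewrite /par turnr_e1 leadr_e1; field; rewrite s0n n'.
Qed.
Lemma parr_e2 g : turn e g != 0 -> par g e2 = par g e.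
Proof.
move=> n; have n' : turn g e != 0 by rewrite turn_swap oppr_eq0.
by rewrite /par turnr_e2 leadr_e2; field; rewrite s1n n'.
Qed.

Lemma xing_e1 g : xing e1 g = xing e g && (par e g < s).
Proof.
rewrite !xingE turn_e1 mulf_eq0 (negbTE s0n) /=; case: eqVneq => //= n.
rewrite par_e1 // parr_e1 // pmulr_lgt0 ?invr_gt0 // ltr_pdivrMr // mul1r.
case: (ltrP (par e g) s) => [lt|le]; rewrite ?andbF ?andbT //=.
by have [_ h] := andP hs; rewrite (lt_trans lt h) andbT.
Qed.
Lemma xing_e2 g : xing e2 g = xing e g && (s < par e g).
Proof.
rewrite !xingE turn_e2 mulf_eq0 (negbTE s1n) /=; case: eqVneq => //= n.
rewrite par_e2 // parr_e2 // pmulr_lgt0 ?invr_gt0 // subr_gt0.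
rewrite ltr_pdivrMr // mul1r ltrD2r.
case: (ltrP s (par e g)) => [lt|le]; rewrite ?andbF ?andbT //=.
by rewrite (lt_trans s0 lt).
Qed.

Lemma sub_mem g : g \in E0 -> g \in edges D /\ g \in edges D'.
Proof. by move=> hg; rewrite (perm_mem P) (perm_mem P') !inE hg !orbT. Qed.
Lemma e1_mem : e1 \in edges D'. Proof. by rewrite (perm_mem P') inE eqxx. Qed.
Lemma e2_mem : e2 \in edges D'. Proof. by rewrite (perm_mem P') !inE eqxx orbT. Qed.
Lemma e_mem : e \in edges D. Proof. by rewrite (perm_mem P) inE eqxx. Qed.

Lemma par_neq g : g \in E0 -> xing e g -> par e g != s.
Proof.
move=> hg; rewrite xingE => /and3P[n hp /andP[q0 q1]]; apply/eqP => Es.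
have [_ _ _ H _] := wf_gen wD'.
have [_ hg'] := sub_mem hg.
have ne : e1 != g.
  by apply: contraNneq n => <-; rewrite turnr_e1 turn_self mulr0.
have H1 : on_edge e1 1 = on_edge g (par g e).
  rewrite -(par_meet n) Es /on_edge /=; congr pair; ring.
have [||[h _ _]|[_ h]|[h _]] := H _ _ 1 (par g e) e1_mem hg' ne _ _ H1.
- by rewrite ler01 lexx.
- by rewrite !ltW.
- by move: h; rewrite ltxx andbF.
- by rewrite h ltxx in q0.
- by move/eqP: h; rewrite oner_eq0.
Qed.

Lemma xing_split g : g \in E0 -> xing e g = xing e1 g || xing e2 g.
Proof.
move=> hg; rewrite xing_e1 xing_e2; case x: (xing e g) => //=.
by have := par_neq hg x; case: ltrgtP.
Qed.

Lemma xing_excl g : xing e1 g -> xing e2 g = false.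
Proof.
rewrite xing_e1 xing_e2 => /andP[-> lt] /=; apply/negbTE.
by rewrite -leNgt ltW.
Qed.

Lemma xing_12 : xing e1 e2 = false.
Proof.
by apply/negP => /xing_turn; rewrite turn_e1 turnr_e2 turn_self !mulr0 eqxx.
Qed.

(** Each edge of [D'] is part of an edge of [D], and each crossing of [D'] comes
    from one of [D]. The point of subdivision is not a crossing, since it is a
    vertex. *)
Definition parent (x : edge) : edge := if (x == e1) || (x == e2) then e else x.

Lemma parent1 : parent e1 = e. Proof. by rewrite /parent eqxx. Qed.
Lemma parent2 : parent e2 = e. Proof. by rewrite /parent eqxx orbT. Qed.
Lemma parent0 g : g \in E0 -> parent g = g.
Proof.
have := uniq_edges (wf_gen wD'); rewrite (perm_uniq P') /= !inE.
case/and3P; rewrite negb_or => /andP[_ n1] n2 _ hg; rewrite /parent.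
by case: eqP => [E|_]; [rewrite -E hg in n1 | case: eqP => // E; rewrite -E hg in n2].
Qed.

Lemma rise_true E (z : edge -> edge -> R) x :
  rise E z x = \sum_(y <- E | xing x y && predT y) z x y.
Proof. by apply: eq_bigl => y; rewrite andbT. Qed.

Lemma big_sub (z : edge -> edge -> R) x (q : pred edge) :
  \sum_(y <- edges D' | xing x y && q y) z x y =
  (if xing x e1 && q e1 then z x e1 else 0) + (if xing x e2 && q e2 then z x e2 else 0)
  + \sum_(y <- E0 | xing x y && q y) z x y.
Proof.
rewrite (perm_big _ P') !big_cons.
by case: (xing x e1 && q e1); case: (xing x e2 && q e2); rewrite /= ?add0r ?addr0 ?addrA.
Qed.

Lemma big_whole (z : edge -> edge -> R) x (q : pred edge) :
  \sum_(y <- edges D | xing x y && q y) z x y =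
  (if xing x e && q e then z x e else 0) + \sum_(y <- E0 | xing x y && q y) z x y.
Proof.
by rewrite (perm_big _ P) big_cons; case: (xing x e && q e); rewrite /= ?add0r.
Qed.

Definition corr (z z' : edge -> edge -> R) : Prop :=
  forall x y, x \in edges D' -> y \in edges D' -> xing x y -> z' x y = z (parent x) (parent y).

Section Corr.
Variables z z' : edge -> edge -> R.
Hypothesis zz : corr z z'.

Let z00 x y : x \in E0 -> y \in E0 -> xing x y -> z' x y = z x y.
Proof.
move=> hx hy h; have [_ hx'] := sub_mem hx; have [_ hy'] := sub_mem hy.
by rewrite zz // !parent0.
Qed.
Let z1 y : y \in E0 -> xing e1 y -> z' e1 y = z e y.
Proof.
move=> hy h; have [_ hy'] := sub_mem hy.
by rewrite (zz e1_mem hy' h) parent1 parent0.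
Qed.
Let z2 y : y \in E0 -> xing e2 y -> z' e2 y = z e y.
Proof.
move=> hy h; have [_ hy'] := sub_mem hy.
by rewrite (zz e2_mem hy' h) parent2 parent0.
Qed.
Let z1r y : y \in E0 -> xing y e1 -> z' y e1 = z y e.
Proof.
move=> hy h; have [_ hy'] := sub_mem hy.
by rewrite (zz hy' e1_mem h) parent1 parent0.
Qed.
Let z2r y : y \in E0 -> xing y e2 -> z' y e2 = z y e.
Proof.
move=> hy h; have [_ hy'] := sub_mem hy.
by rewrite (zz hy' e2_mem h) parent2 parent0.
Qed.

Lemma sub_sum0 x (q q' : pred edge) : x \in E0 ->
  (forall y, y \in edges D' -> xing x y -> q' y = q (parent y)) ->
  \sum_(y <- edges D | xing x y && q y) z x y = \sum_(y <- edges D' | xing x y && q' y) z' x y.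
Proof.
move=> hx qq; rewrite big_sub big_whole; congr (_ + _); last first.
  rewrite big_seq_cond [RHS]big_seq_cond; apply: eq_big => y.
    case hy: (y \in E0) => //=; case xy: (xing x y) => //=.
    by have [_ hy'] := sub_mem hy; rewrite qq // parent0.
  by move=> /andP[hy /andP[xy _]]; rewrite z00.
have := xing_split hx; rewrite ![xing _ x]xingC => ->.
case x1: (xing x e1) => /=.
  rewrite (qq _ e1_mem x1) parent1 z1r //.
  by have := xing_excl (g := x); rewrite ![xing _ x]xingC => /(_ x1) -> /=; rewrite addr0.
case x2: (xing x e2) => /=; last by rewrite addr0.
by rewrite (qq _ e2_mem x2) parent2 z2r // add0r.
Qed.

Lemma sub_sum1 (q : pred edge) :
  \sum_(y <- edges D' | xing e1 y && q y) z' e1 y =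
  \sum_(y <- edges D | xing e y && ((par e y < s) && q y)) z e y.
Proof.
rewrite big_sub big_whole !xing_self xing_12 /= !add0r.
rewrite big_seq_cond [RHS]big_seq_cond; apply: eq_big => y.
  by rewrite xing_e1 -andbA.
by move=> /andP[hy /andP[xy _]]; rewrite z1.
Qed.

Lemma sub_sum2 (q : pred edge) :
  \sum_(y <- edges D' | xing e2 y && q y) z' e2 y =
  \sum_(y <- edges D | xing e y && ((s < par e y) && q y)) z e y.
Proof.
rewrite big_sub big_whole !xing_self [xing e2 e1]xingC xing_12 /= !add0r.
rewrite big_seq_cond [RHS]big_seq_cond; apply: eq_big => y.
  by rewrite xing_e2 -andbA.
by move=> /andP[hy /andP[xy _]]; rewrite z2.
Qed.

Lemma sub_rise0 x : x \in E0 -> rise (edges D) z x = rise (edges D') z' x.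
Proof.
by move=> hx; rewrite !rise_true; exact: sub_sum0.
Qed.

Lemma sub_rise1 : rise (edges D') z' e1 = \sum_(y <- edges D | xing e y && (par e y < s)) z e y.
Proof.
by rewrite rise_true sub_sum1; apply: eq_bigl => y; rewrite andbT.
Qed.

Lemma sub_whole (q : pred edge) :
  \sum_(y <- edges D | xing e y && q y) z e y =
  \sum_(y <- edges D | xing e y && ((par e y < s) && q y)) z e y +
  \sum_(y <- edges D | xing e y && ((s < par e y) && q y)) z e y.
Proof.
rewrite (bigID (fun y => par e y < s)) /=; congr (_ + _).
  by apply: eq_bigl => y; rewrite -andbA [q y && _]andbC.
rewrite big_seq_cond [RHS]big_seq_cond; apply: eq_bigl => y.
case hy: (y \in edges D) => //=; case xy: (xing e y) => //=.
rewrite [q y && _]andbC; congr (_ && _); rewrite -leNgt le_eqVlt eq_sym.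
case: eqP => //= E; exfalso.
move: hy; rewrite (perm_mem P) inE => /orP[/eqP ye|hy]; first by rewrite ye xing_self in xy.
by have := par_neq hy xy; rewrite E eqxx.
Qed.

Lemma sub_rise : rise (edges D) z e = rise (edges D') z' e1 + rise (edges D') z' e2.
Proof.
by rewrite !rise_true sub_whole sub_sum1 sub_sum2.
Qed.

Variables F F' : pt -> R.
Hypothesis FE0 : forall x, x \in E0 -> F x.1 = F' x.1.
Hypothesis Fe : F e.1 = F' e.1.
Hypothesis pF' : pot (edges D') (rise (edges D') z') F'.

(** On the second half, the level at its start already contains the jumps on the
    first half. *)
Lemma sub_level x y : x \in edges D' -> y \in edges D' -> xing x y ->
  level (edges D') z' F' x y = level (edges D) z F (parent x) (parent y).
Proof.
move=> hx hy xy; rewrite /level.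
have tn (a b : edge) : xing a b -> turn a b != 0 by exact: xing_turn.
have parE a b : a \in E0 -> b \in edges D' -> xing a b ->
    par a b = par a (parent b) /\ turn a (parent b) != 0.
  move=> ha; rewrite (perm_mem P') !inE => /or3P[/eqP->|/eqP->|hb] ab.
  - have n : turn e a != 0 by move: ab; rewrite xingC xing_e1 => /andP[/tn].
    by rewrite parent1 parr_e1 // turn_swap oppr_eq0.
  - have n : turn e a != 0 by move: ab; rewrite xingC xing_e2 => /andP[/tn].
    by rewrite parent2 parr_e2 // turn_swap oppr_eq0.
  - by rewrite parent0 //; split=> //; exact: tn.
move: hx xy; rewrite (perm_mem P') !inE => /or3P[/eqP->|/eqP->|hx] xy.
- have [hy0 ny xey lt] : [/\ y \in E0, turn e y != 0, xing e y & par e y < s].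
    move: hy (xy); rewrite (perm_mem P') !inE => /or3P[/eqP->|/eqP->|hy].
    + by rewrite xing_self.
    + by rewrite xing_12.
    + by rewrite xing_e1 => /andP[h1 h2]; split=> //; exact: tn.
  rewrite parent1 (parent0 hy0) Fe sub_sum1; congr (_ + _); apply: eq_bigl => f.
  case xf: (xing e f) => //=; have nf := tn _ _ xf.
  rewrite !beforeE ?turn_e1 ?mulf_neq0 // !par_e1 // ltr_pM2r ?invr_gt0 //.
  by case: (ltrP (par e f) (par e y)) => h; rewrite ?andbF // (lt_trans h lt).
- have [hy0 ny xey lt] : [/\ y \in E0, turn e y != 0, xing e y & s < par e y].
    move: hy (xy); rewrite (perm_mem P') !inE => /or3P[/eqP->|/eqP->|hy].
    + by rewrite xingC xing_12.
    + by rewrite xing_self.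
    + by rewrite xing_e2 => /andP[h1 h2]; split=> //; exact: tn.
  rewrite parent2 (parent0 hy0) sub_sum2 [(c, e.2).1]/= -[c in F' c]/(e1.2) (pF' e1_mem) sub_rise1 -Fe.
  rewrite -addrA; congr (_ + _); rewrite [RHS]sub_whole; congr (_ + _); apply: eq_bigl => f.
    case xf: (xing e f) => //=; have nf := tn _ _ xf.
    rewrite beforeE //; case: (ltrP (par e f) s) => //= h.
    by rewrite (lt_trans h lt).
  case xf: (xing e f) => //=; have nf := tn _ _ xf; congr (_ && _).
  rewrite !beforeE ?turn_e2 ?mulf_neq0 // !par_e2 // ltr_pM2r ?invr_gt0 //.
  by rewrite ltrD2r.
rewrite (parent0 hx) -FE0 //; congr (_ + _); symmetry; apply: sub_sum0 => // f hf xf.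
have [Ey ny] := parE _ _ hx hy xy; have [Ef nf] := parE _ _ hx hf xf.
by rewrite (beforeE (tn _ _ xf) (tn _ _ xy)) (beforeE nf ny) Ey Ef.
Qed.
End Corr.

Lemma sub_mark x y : x \in edges D' -> y \in edges D' -> xing x y ->
  mark D' x y = mark D (parent x) (parent y).
Proof.
have ext g : g \in E0 -> forall e', e' \in [:: e1; e2] -> xing e' g ->
    mark D' e' g = mark D e g /\ mark D' g e' = mark D g e.
  move=> hg e' he' xg; have [hgD hgD'] := sub_mem hg.
  have he'D : e' \in edges D'.
    by move: he'; rewrite !inE => /orP[] /eqP->; [exact: e1_mem | exact: e2_mem].
  have xe : xing e g.
    by move: he' xg; rewrite !inE => /orP[] /eqP->; rewrite ?xing_e1 ?xing_e2 => /andP[].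
  have M := sm' he' hg (xing_cross xg).
  by rewrite (wf_flip wD' he'D hgD' xg) M (wf_flip wD e_mem hgD xe).
rewrite (perm_mem P') !inE => /or3P[/eqP->|/eqP->|hx].
- rewrite (perm_mem P') !inE => /or3P[/eqP->|/eqP->|hy] xy.
  + by rewrite xing_self in xy.
  + by rewrite xing_12 in xy.
  + by rewrite parent1 parent0 //; have [] := ext _ hy e1 _ xy; rewrite ?inE ?eqxx.
- rewrite (perm_mem P') !inE => /or3P[/eqP->|/eqP->|hy] xy.
  + by rewrite xingC xing_12 in xy.
  + by rewrite xing_self in xy.
  + by rewrite parent2 parent0 //; have [] := ext _ hy e2 _ xy; rewrite ?inE ?eqxx ?orbT.
rewrite (perm_mem P') !inE => /or3P[/eqP->|/eqP->|hy] xy.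
- by rewrite parent1 parent0 //; rewrite xingC in xy; have [] := ext _ hx e1 _ xy; rewrite ?inE ?eqxx.
- by rewrite parent2 parent0 //; rewrite xingC in xy; have [] := ext _ hx e2 _ xy; rewrite ?inE ?eqxx ?orbT.
- by rewrite !parent0 // sm //; exact: xing_cross.
Qed.

Lemma sub_sgn x y : x \in edges D' -> y \in edges D' -> sgn x y = sgn (parent x) (parent y).
Proof.
have sg1 g : sgn e1 g = sgn e g by rewrite /sgn turn_e1 sgrM gtr0_sg // mul1r.
have sg2 g : sgn e2 g = sgn e g by rewrite /sgn turn_e2 sgrM gtr0_sg // mul1r.
have sg1r g : sgn g e1 = sgn g e by rewrite sgn_swap sg1 -sgn_swap.
have sg2r g : sgn g e2 = sgn g e by rewrite sgn_swap sg2 -sgn_swap.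
rewrite !(perm_mem P') !inE => /or3P[/eqP->|/eqP->|hx] /or3P[/eqP->|/eqP->|hy];
  by rewrite ?parent1 ?parent2 ?(parent0 hx) ?(parent0 hy) ?sg1 ?sg2 ?sg1r ?sg2r.
Qed.

Lemma corrK : corr (jumpK (mark D)) (jumpK (mark D')).
Proof. by move=> x y hx hy xy; rewrite /jumpK sub_mark // sub_sgn. Qed.

Section Potentials.
Variables K K' : pt -> R.
Hypothesis pK' : potK D' K'.
Hypothesis aK : agree_at E0 e.1 K K'.

Lemma sub_relidx x y : x \in edges D' -> y \in edges D' -> xing x y ->
  relidx (edges D') (mark D') K' x y = relidx (edges D) (mark D) K (parent x) (parent y).
Proof.
move=> hx hy xy; have [a1 a2] := aK; have yx : xing y x by rewrite xingC.
by rewrite /relidx !(sub_level corrK a1 a2 pK') // sub_sgn.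
Qed.

Lemma corrA j : corr (jumpA (edges D) (mark D) j K) (jumpA (edges D') (mark D') j K').
Proof. by move=> x y hx hy xy; rewrite /jumpA sub_mark // sub_relidx // sub_sgn. Qed.

Variables A A' B B' : pt -> R.
Hypothesis pA' : potA D' 1 K' A'.
Hypothesis aA : agree_at E0 e.1 A A'.
Hypothesis pB' : potA D' (-1) K' B'.
Hypothesis aB : agree_at E0 e.1 B B'.

Lemma corrC : corr (jumpC (edges D) (mark D) K A B) (jumpC (edges D') (mark D') K' A' B').
Proof.
move=> x y hx hy xy; have [a1 a2] := aA; have [b1 b2] := aB; have yx : xing y x by rewrite xingC.
rewrite /jumpC sub_mark // sub_relidx // sub_sgn // /levelA.
by rewrite !(sub_level (corrA 1) a1 a2 pA') // (sub_level (corrA (-1)) b1 b2 pB').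
Qed.
End Potentials.

Lemma subdivision_balanced : restranded D D'.
Proof.
exists E0, e.1, e.2, [::], [:: c].
have Ee : strand e.1 [::] e.2 = [:: e] by rewrite /strand /path_edges /=; case: (e).
have Ec : strand e.1 [:: c] e.2 = [:: e1; e2] by [].
rewrite Ee Ec; split=> //.
have bal z z' : corr z z' ->
    balanced E0 [:: e] [:: e1; e2] (rise (edges D) z) (rise (edges D') z').
  move=> H; split; first by move=> x; exact: sub_rise0.
  by rewrite !big_cons !big_nil !addr0 (sub_rise H).
split.
- exact/bal/corrK.
- by move=> K K' _ pK' aK j _; apply: bal; exact: corrA.
- move=> K K' A A' B B' _ pK' aK _ pA' aA _ pB' aB; apply: bal; exact: corrC.
Qed.

End Subdivision.

(** * Isotopies *)

Section Isotopy.
Variable R : realType.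
Notation pt := (R * R)%type.
Notation edge := (pt * pt)%type.
Notation diagram := (diagram R).

Definition wcont (f : R -> R) : Prop := {within `[0, 1], continuous f}.

Lemma wcontB f g : wcont f -> wcont g -> wcont (fun t => f t - g t).
Proof. by move=> cf cg; exact: within_continuousB. Qed.
Lemma wcontM f g : wcont f -> wcont g -> wcont (fun t => f t * g t).
Proof. by move=> cf cg t; apply: cvgM; [exact: cf | exact: cg]. Qed.
Lemma wcont1 (f : R -> pt) : {within `[0, 1], continuous f} -> wcont (fun t => (f t).1).
Proof.
move=> cf t; apply: (@continuous_comp _ _ _ (from_subspace `[0, 1] f) fst t).
  exact: cf.
exact: cvg_fst.
Qed.
Lemma wcont2 (f : R -> pt) : {within `[0, 1], continuous f} -> wcont (fun t => (f t).2).
Proof.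
move=> cf t; apply: (@continuous_comp _ _ _ (from_subspace `[0, 1] f) snd t).
  exact: cf.
exact: cvg_snd.
Qed.

(** By the intermediate value theorem. *)
Lemma sign_constant f : wcont f -> (forall t, 0 <= t <= 1 -> f t != 0) ->
  (0 < f 0) = (0 < f 1).
Proof.
move=> cf nz.
have nz0 : f 0 != 0 by apply: nz; rewrite lexx ler01.
have nz1 : f 1 != 0 by apply: nz; rewrite lexx ler01.
have bad : Num.min (f 0) (f 1) <= 0 <= Num.max (f 0) (f 1) -> False.
  move=> h; have [t ht ft] := IVT (@ler01 R) cf h.
  by move: ht; rewrite in_itv /= => /nz; rewrite ft eqxx.
have [h0|h0] := ltrP 0 (f 0); have [h1|h1] := ltrP 0 (f 1) => //.
  by case: bad; rewrite ge_min le_max h1 orbT ltW.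
by case: bad; rewrite ge_min le_max h0 (ltW h1) orbT.
Qed.

Variables (D D' : diagram) (g : R -> pt -> pt).
Hypothesis wD : wf D.
Hypothesis wD' : wf D'.
Hypothesis g0 : forall v, g 0 v = v.
Hypothesis gc : forall v, v \in vertices D -> {within `[0, 1], continuous (fun t : R => g t v)}.
Hypothesis gg : forall t, 0 <= t <= 1 ->
  generic (map (g t) (long D)) (map (map (g t)) (loops D)) /\
  forall e f, e \in edges D -> f \in edges D ->
    (cross (mapE (g t) e) (mapE (g t) f) <-> cross e f).
Hypothesis El : long D' = map (g 1) (long D).
Hypothesis Els : loops D' = map (map (g 1)) (loops D).
Hypothesis gm : forall e f, e \in edges D -> f \in edges D -> cross e f ->
  mark D' (mapE (g 1) e) (mapE (g 1) f) = mark D e f.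

Notation at_ t e := (mapE (g t) e).
Notation G := (g 1).
Let h01 : 0 <= (1 : R) <= 1. Proof. by rewrite ler01 lexx. Qed.

(** The stages of the isotopy, as diagrams, so that results on generic diagrams
    apply to them at every time. *)
Definition stage (t : R) : diagram :=
  Diagram (map (g t) (long D)) (map (map (g t)) (loops D)) (mark D).

Lemma stage_gen t : 0 <= t <= 1 -> gen (stage t).
Proof. by case/gg. Qed.
Lemma stage_edges t : edges (stage t) = map (mapE (g t)) (edges D).
Proof. exact: isotopy_edges. Qed.
Lemma stage_mem t e : e \in edges D -> at_ t e \in edges (stage t).
Proof. by move=> he; rewrite stage_edges map_f. Qed.

Lemma at0 e : at_ 0 e = e.
Proof. by rewrite /mapE !g0; case: e. Qed.

Lemma stage_xing t e f : 0 <= t <= 1 -> e \in edges D -> f \in edges D ->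
  xing (at_ t e) (at_ t f) = xing e f.
Proof.
move=> ht he hf; have [_ cr] := gg ht; have Gt := stage_gen ht.
apply/idP/idP => x.
  by apply: (cross_xing (wf_gen wD) he hf); apply/(cr _ _ he hf)/xing_cross.
apply: (cross_xing Gt (stage_mem t he) (stage_mem t hf)).
by apply/(cr _ _ he hf)/xing_cross.
Qed.

Lemma wcont_turn e f : e \in edges D -> f \in edges D ->
  wcont (fun t => turn (at_ t e) (at_ t f)).
Proof.
move=> /(edge_vertices (wf_gen wD))[e1 e2] /(edge_vertices (wf_gen wD))[f1 f2].
by apply: wcontB; apply: wcontM; apply: wcontB; (apply: wcont1 || apply: wcont2); exact: gc.
Qed.
Lemma wcont_lead e f : e \in edges D -> f \in edges D ->
  wcont (fun t => lead (at_ t e) (at_ t f)).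
Proof.
move=> /(edge_vertices (wf_gen wD))[e1 e2] /(edge_vertices (wf_gen wD))[f1 f2].
by apply: wcontB; apply: wcontM; apply: wcontB; (apply: wcont1 || apply: wcont2); exact: gc.
Qed.

(** The determinant of two crossing edges never vanishes during the isotopy. *)
Lemma stage_sgn e f : e \in edges D -> f \in edges D -> xing e f ->
  sgn (at_ 1 e) (at_ 1 f) = sgn e f.
Proof.
move=> he hf x.
have nz t : 0 <= t <= 1 -> turn (at_ t e) (at_ t f) != 0.
  by move=> ht; apply: xing_turn; rewrite stage_xing.
have n0 := nz 0; have n1 := nz 1 h01.
have := sign_constant (wcont_turn he hf) nz; rewrite !at0 in n0 * => E.
have {}n0 : turn e f != 0 by apply: n0; rewrite lexx ler01.
rewrite /sgn; case: (ltrgtP 0 (turn e f)) E n0 => [l|l|_] //.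
  by move=> E _; rewrite !gtr0_sg // -E.
by move=> E _; rewrite !ltr0_sg // lt_neqAle n1 /= leNgt -E.
Qed.

(** If two crossings on an edge exchanged their order, they would coincide at some
    time, in a triple point. *)
Lemma stage_before e f h : e \in edges D -> f \in edges D -> h \in edges D ->
  xing e f -> xing e h -> before (at_ 1 e) (at_ 1 f) (at_ 1 h) = before e f h.
Proof.
move=> he hf hh xf xh; have [->|nfh] := eqVneq f h.
  by rewrite /before !ltxx !if_same.
have xx t b : 0 <= t <= 1 -> b \in edges D -> xing e b -> xing (at_ t e) (at_ t b).
  by move=> ht hb x; rewrite stage_xing.
pose w t := turn (at_ t e) (at_ t f) * turn (at_ t e) (at_ t h).
pose d t := lead (at_ t e) (at_ t h) * turn (at_ t e) (at_ t f)
  - lead (at_ t e) (at_ t f) * turn (at_ t e) (at_ t h).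
have cw : wcont w by apply: wcontM; exact: wcont_turn.
have cd : wcont d.
  apply: wcontB; apply: wcontM.
  - exact: wcont_lead.
  - exact: wcont_turn.
  - exact: wcont_lead.
  - exact: wcont_turn.
have nw t : 0 <= t <= 1 -> w t != 0.
  by move=> ht; rewrite mulf_neq0 // xing_turn // xx.
have nd t : 0 <= t <= 1 -> d t != 0.
  move=> ht; have x1 := xx t f ht hf xf; have x2 := xx t h ht hh xh.
  have n1 := xing_turn x1; have n2 := xing_turn x2.
  apply/negP => /eqP dt.
  have Ep : par (at_ t e) (at_ t f) = par (at_ t e) (at_ t h).
    by rewrite /par; apply/eqP; rewrite eqr_div //; move/eqP: dt; rewrite subr_eq0 eq_sym.
  have Gt := stage_gen ht; have [_ _ _ _ H] := Gt.
  have [p1 p2 p3] := xing_meet x1; have [q1 q2 q3] := xing_meet x2.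
  (* Distinct edges stay distinct, as the list of edges of each stage is duplicate
     free. *)
  have inj : at_ t f != at_ t h.
    apply: contra nfh => /eqP E.
    rewrite -(nth_index f hf) -(nth_index f hh); apply/eqP; congr nth.
    have U' : uniq (map (mapE (g t)) (edges D)).
      by have := uniq_edges Gt; rewrite stage_edges.
    apply/eqP; rewrite -(nth_uniq (at_ t f) _ _ U') ?size_map ?index_mem //.
    by rewrite !(nth_map f) ?index_mem // !nth_index // E.
  have un : uniq [:: at_ t f; at_ t e; at_ t h].
    by rewrite /= !inE negb_or eq_sym (xing_neq x1) inj (xing_neq x2).
  apply: (H _ _ _ _ _ _ (stage_mem t hf) (stage_mem t he) (stage_mem t hh) un p2 p1 q2).
  by rewrite -p3; split=> //; rewrite Ep q3.
have Ew := sign_constant cw nw; have Ed := sign_constant cd nd.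
have cmp t : 0 <= t <= 1 -> before (at_ t e) (at_ t f) (at_ t h) =
    if 0 < w t then 0 < d t else ~~ (0 < d t).
  move=> ht; rewrite /before -/(w t); case: ifP => _; first by rewrite -subr_gt0.
  by rewrite -subr_lt0 -/(d t) -leNgt [in RHS]le_eqVlt (negbTE (nd t ht)).
have := cmp 0; rewrite !at0 => ->; last by rewrite lexx ler01.
by rewrite cmp // Ew Ed.
Qed.

Let EE : edges D' = map (mapE G) (edges D). Proof. exact: isotopy_edges. Qed.

Lemma carry_level (F F' : pt -> R) (z z' : edge -> edge -> R) e h :
  (forall v, v \in vertices D -> F v = F' (G v)) ->
  e \in edges D -> h \in edges D -> xing e h ->
  (forall f, f \in edges D -> xing e f -> z e f = z' (mapE G e) (mapE G f)) ->
  level (edges D) z F e h = level (edges D') z' F' (mapE G e) (mapE G h).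
Proof.
move=> FF he hh xh zz; rewrite /level EE big_map; congr (_ + _).
  by apply: FF; case: (edge_vertices (wf_gen wD) he).
rewrite big_seq_cond [RHS]big_seq_cond; apply: eq_big => [f|f].
  case hf: (f \in edges D) => //=; rewrite stage_xing //.
  by case xf: (xing e f) => //=; rewrite stage_before.
by case/and3P => hf xf _; exact: zz.
Qed.

Lemma carry_rise (z z' : edge -> edge -> R) e : e \in edges D ->
  (forall f, f \in edges D -> xing e f -> z e f = z' (mapE G e) (mapE G f)) ->
  rise (edges D) z e = rise (edges D') z' (mapE G e).
Proof.
move=> he zz; rewrite /rise EE big_map big_seq_cond [RHS]big_seq_cond.
apply: eq_big => [f|f]; last by case/andP => hf xf; exact: zz.
by case hf: (f \in edges D) => //=; rewrite stage_xing.
Qed.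

Section Potentials.
Variables K K' : pt -> R.
Hypothesis KK : forall v, v \in vertices D -> K v = K' (G v).

Lemma carry_jumpK e f : e \in edges D -> f \in edges D -> xing e f ->
  jumpK (mark D) e f = jumpK (mark D') (mapE G e) (mapE G f).
Proof.
by move=> he hf x; rewrite /jumpK gm //; [rewrite stage_sgn | exact: xing_cross].
Qed.

Lemma carry_relidx e f : e \in edges D -> f \in edges D -> xing e f ->
  relidx (edges D) (mark D) K e f = relidx (edges D') (mark D') K' (mapE G e) (mapE G f).
Proof.
move=> he hf x; rewrite /relidx stage_sgn //; congr (_ - _ - _); apply: carry_level => //.
- by rewrite xingC.
- by move=> h hh xh; exact: carry_jumpK.
- by move=> h hh xh; exact: carry_jumpK.
Qed.

Lemma carry_jumpA j e f : e \in edges D -> f \in edges D -> xing e f ->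
  jumpA (edges D) (mark D) j K e f =
  jumpA (edges D') (mark D') j K' (mapE G e) (mapE G f).
Proof.
move=> he hf x; rewrite /jumpA gm //; last exact: xing_cross.
by rewrite carry_relidx // stage_sgn.
Qed.

Lemma carry_levelA j A A' e f : (forall v, v \in vertices D -> A v = A' (G v)) ->
  e \in edges D -> f \in edges D -> xing e f ->
  levelA (edges D) (mark D) j K A e f =
  levelA (edges D') (mark D') j K' A' (mapE G e) (mapE G f).
Proof. by move=> AA he hf x; apply: carry_level => // h hh xh; exact: carry_jumpA. Qed.

Lemma carry_jumpC A A' B B' e f : (forall v, v \in vertices D -> A v = A' (G v)) ->
  (forall v, v \in vertices D -> B v = B' (G v)) ->
  e \in edges D -> f \in edges D -> xing e f ->
  jumpC (edges D) (mark D) K A B e f =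
  jumpC (edges D') (mark D') K' A' B' (mapE G e) (mapE G f).
Proof.
move=> AA BB he hf x; rewrite /jumpC gm //; last exact: xing_cross.
have x' : xing f e by rewrite xingC.
rewrite carry_relidx // stage_sgn // (carry_levelA 1 AA he hf x).
by rewrite (carry_levelA (-1) BB hf he x') (carry_levelA 1 AA hf he x').
Qed.
End Potentials.

Lemma isotopy_end : exists rho,
  topo Isotopy D D' false rho (fun v => v \in vertices D) /\
  invariant_step D D' rho (fun v => v \in vertices D).
Proof.
have gD := wf_gen wD; have gD' := wf_gen wD'.
exists G; split; first exact: isotopy_topo.
split.
- apply: isotopy_conserved => // e he; apply: carry_rise => // f hf x.
  exact: carry_jumpK.
- move=> K K' _ _ KK j _; apply: isotopy_conserved => // e he; apply: carry_rise => // f hf x.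
  exact: carry_jumpA.
- move=> K K' A A' B B' _ _ KK _ _ AA _ _ BB.
  rewrite /sC /sumC EE big_map big_seq [RHS]big_seq; apply: eq_bigr => e he.
  rewrite -EE; apply: carry_rise => // f hf x; exact: carry_jumpC.
Qed.

End Isotopy.

Lemma isotopy_step (R : realType) (D D' : diagram R) : wf D -> wf D' -> isotopy D D' ->
  exists rho, topo Isotopy D D' false rho (fun v => v \in vertices D) /\
    invariant_step D D' rho (fun v => v \in vertices D).
Proof. by move=> wD wD' [g [g0 gc gg [El Els] gm]]; exact: (isotopy_end wD wD' g0). Qed.

(** * Concordance invariance *)

Section Invariant.
Variable R : realType.
Notation pt := (R * R)%type.
Notation edge := (pt * pt)%type.
Notation diagram := (diagram R).

Definition followed (k : kind) (D D' : diagram) (b : bool) (rho : pt -> pt)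
    (kept : pt -> Prop) : Prop :=
  topo k D D' b rho kept /\ invariant_step (finer b D D') (coarser b D D') rho kept.

Lemma followed_sym k (D D' : diagram) :
  (exists b rho kept, followed k D D' b rho kept) ->
  exists b rho kept, followed (rev_kind k) D' D b rho kept.
Proof.
move=> [b [rho [kept [T S]]]]; exists (~~ b), rho, kept; split; first exact: topo_sym.
by case: b {T} S.
Qed.

Lemma restranded_followed (D D' : diagram) : wf D -> wf D' -> restranded D D' ->
  exists b rho kept, followed Rewriting D D' b rho kept.
Proof.
move=> wD wD' [E [a [b [u [u' [P P' bal]]]]]].
exists false, (collapse a u), (unmoved D u).
have G := wf_gen wD; have G' := wf_gen wD'.
by split; [exact: restrand_topo P P' | exact: restrand_step bal].
Qed.

Lemma rewriting_followed (D D' : diagram) : wf D -> wf D' -> rewriting D D' ->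
  exists b rho kept, followed Rewriting D D' b rho kept.
Proof.
move=> wD wD' H; apply: restranded_followed => //.
case: H => [[H|[E0 [e [s [hs P P' sm sm']]]]]|H|H|[H|H]].
- exact: relisting_step.
- exact: (subdivision_balanced wD wD' hs P P' sm sm').
- exact: reidemeister1_step.
- exact: reidemeister2_step.
- exact: reidemeister3_step.
- exact: detour_step.
Qed.

Lemma move_followed k (D D' : diagram) : wf D -> wf D' -> move k D D' ->
  exists b rho kept, followed k D D' b rho kept.
Proof.
have iso X Y : wf X -> wf Y -> isotopy X Y ->
    exists b rho kept, followed Isotopy X Y b rho kept.
  move=> wX wY /(isotopy_step wX wY)[rho [T S]].
  by exists false, rho, (fun v => v \in vertices X).
have bir X Y : wf X -> wf Y -> birth X Y ->
    exists b rho kept, followed Birth X Y b rho kept.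
  by move=> wX wY H; exists false, id, (fun v => v \in vertices X); exact: birth_step.
have sad X Y : wf X -> wf Y -> saddle X Y ->
    exists b rho kept, followed Saddle X Y b rho kept.
  by move=> wX wY H; exact: saddle_step.
move=> wD wD'; case: k => /=.
- by case=> H; [exact: iso | apply: (@followed_sym Isotopy); exact: iso].
- by case=> H; [exact: rewriting_followed
               | apply: (@followed_sym Rewriting); exact: rewriting_followed].
- exact: bir.
- by move=> H; apply: (@followed_sym Birth); exact: bir.
- by case=> H; [exact: sad | apply: (@followed_sym Saddle); exact: sad].
Qed.

(** The potentials [K], then [A] and [B], are chosen for all diagrams of the movie
    at once, so that they agree across each of its moves; the invariant is then
    constant along the movie. *)
Theorem concordance_invariance (D D' : diagram) :
  concordant D D' -> loops D = [::] -> loops D' = [::] ->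
  exists K A B K' A' B',
  [/\ [/\ potK D K, potA D 1 K A & potA D (-1) K B],
      [/\ potK D' K', potA D' 1 K' A' & potA D' (-1) K' B'],
      [/\ K (ptL R) = 0, A (ptL R) = 0 & B (ptL R) = 0],
      [/\ K' (ptL R) = 0, A' (ptL R) = 0 & B' (ptL R) = 0] &
      sC D K A B = sC D' K' A' B'].
Proof.
move=> [N [k [M [[M0 MN] wfM mvM conM cnt]]]] lD lD'.
have gM i : (i <= N)%N -> gen (M i) by move=> /wfM/wf_gen.
have lM0 : loops (M 0%N) = [::] by rewrite M0.
have lMN : loops (M N) = [::] by rewrite MN.
have /boolp.choice[c Hc] i : exists c : bool * (pt -> pt) * (pt -> Prop),
    (i < N)%N -> followed (k i) (M i) (M i.+1) c.1.1 c.1.2 c.2.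
  case: (ltnP i N) => hi; last by exists (false, id, fun=> True).
  have [b [rho [kept H]]] := move_followed (wfM _ (ltnW hi)) (wfM _ hi) (mvM _ hi).
  by exists (b, rho, kept).
pose b i := (c i).1.1; pose rho i := (c i).1.2; pose kept i := (c i).2.
have tM i : (i < N)%N -> topo (k i) (M i) (M i.+1) (b i) (rho i) (kept i).
  by move=> /Hc[].
pose xi j := if b j then j.+1 else j; pose yi j := if b j then j else j.+1.
have sM j : (j < N)%N -> invariant_step (M (xi j)) (M (yi j)) (rho j) (kept j).
  by move=> /Hc[_]; rewrite -/(b j) -/(rho j) -/(kept j) finerE coarserE.
have xiN j : (j < N)%N -> (xi j <= N)%N by rewrite /xi; case: (b j) => // /ltnW.
have yiN j : (j < N)%N -> (yi j <= N)%N by rewrite /yi; case: (b j) => // /ltnW.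
have solve t := movie_potentials gM lM0 lMN conM cnt tM (t := t).
have [K [pK aK]] := solve (fun i => tK (M i)) (fun j hj => inv_K (sM j hj)).
have agK j : (j < N)%N -> agree (rho j) (kept j) (K (xi j)) (K (yi j)).
  by move=> hj v; exact: aK.
have lvl (j : R) : j != 0 -> forall i, (i < N)%N ->
    conserved (M (xi i)) (M (yi i)) (rho i) (kept i)
      (tA (M (xi i)) j (K (xi i))) (tA (M (yi i)) j (K (yi i))).
  move=> j0 i hi; apply: (inv_A (sM i hi)) => //; last exact: agK.
  - by case: (pK _ (xiN _ hi)).
  - by case: (pK _ (yiN _ hi)).
have n1 : (-1 : R) != 0 by rewrite oppr_eq0 oner_eq0.
have [A [pA aA]] := solve (fun i => tA (M i) 1 (K i)) (lvl 1 (oner_neq0 R)).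
have [B [pB aB]] := solve (fun i => tA (M i) (-1) (K i)) (lvl (-1) n1).
have step j : (j < N)%N ->
    sC (M j) (K j) (A j) (B j) = sC (M j.+1) (K j.+1) (A j.+1) (B j.+1).
  move=> hj; have hx := xiN _ hj; have hy := yiN _ hj.
  suff : sC (M (xi j)) (K (xi j)) (A (xi j)) (B (xi j)) =
         sC (M (yi j)) (K (yi j)) (A (yi j)) (B (yi j)).
    by rewrite /xi /yi; case: (b j).
  have [kx _] := pK _ hx; have [ky _] := pK _ hy.
  have [px _] := pA _ hx; have [py _] := pA _ hy.
  have [qx _] := pB _ hx; have [qy _] := pB _ hy.
  exact: (inv_C (sM j hj) kx ky (agK j hj) px py (aA j hj) qx qy (aB j hj)).
have const n : (n <= N)%N -> sC (M 0%N) (K 0%N) (A 0%N) (B 0%N) = sC (M n) (K n) (A n) (B n).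
  by elim: n => // n IH hn; rewrite (IH (ltnW hn)); exact: step.
have [k0 k0'] := pK 0%N isT; have [kN kN'] := pK N (leqnn N).
have [p0 p0'] := pA 0%N isT; have [pN pN'] := pA N (leqnn N).
have [q0 q0'] := pB 0%N isT; have [qN qN'] := pB N (leqnn N).
exists (K 0%N), (A 0%N), (B 0%N), (K N), (A N), (B N).
by rewrite -M0 -MN; split=> //; exact: const.
Qed.

End Invariant.

(** * Polygons with integer corners *)

Section Polygons.
Variable R : realType.
Notation pt := (R * R)%type.
Notation edge := (pt * pt)%type.
Notation diagram := (diagram R).
Notation ipt := (int * int)%type.
Notation iedge := (ipt * ipt)%type.

(** The parameter along [e] of the intersection with [g] lies between 0 and 1. *)
Definition in_unit (e g : iedge) : bool := 0 <= lead e g * turn e g <= turn e g ^+ 2.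

(** Two edges that are not parallel cross, or miss each other, or are consecutive. *)
Definition generic_pair (e f : iedge) : bool :=
  (turn e f != 0) &&
  [|| xing e f, ~~ in_unit e f, ~~ in_unit f e,
      (lead e f == turn e f) && (lead f e == 0) |
      (lead e f == 0) && (lead f e == turn f e)].

(** The lines of [f] and [g] meet the line of [e] in distinct points. *)
Definition generic_triple (e f g : iedge) : bool :=
  lead e f * turn e g != lead e g * turn e f.

Definition generic_ipath (l : seq ipt) : bool :=
  [&& uniq l,
      all (fun e => all (fun f => (e == f) || generic_pair e f) (ipath l)) (ipath l) &
      all (fun e => all (fun f => all (fun g =>
        ~~ uniq [:: e; f; g] || generic_triple e f g) (ipath l)) (ipath l)) (ipath l)].

Section Chart.
Variables (p u v : pt).
Hypothesis uv : det u v != 0.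
Notation aff := (aff p u v).
Notation affE := (affE p u v).

Lemma affE_inj : injective affE.
Proof. by move=> [a b] [c d] E; congr pair; apply: (aff_inj uv); [exact: (congr1 fst E) | exact: (congr1 snd E)]. Qed.

Lemma edges_aff l : edges_of (map aff l) [::] = map affE (ipath l).
Proof. by rewrite /edges_of cats0 path_edges_aff. Qed.

Lemma par_aff e g : turn e g != 0 ->
  par (affE e) (affE g) = (lead e g)%:~R / (turn e g)%:~R.
Proof.
move=> n; rewrite /par lead_aff turn_aff -mulf_div divff ?mul1r //.
Qed.

Lemma generic_aff l : generic_ipath l ->
  (exists m, map aff l = ptL R :: rcons m (ptR R)) ->
  (forall q, q \in l -> [\/ aff q = ptL R, aff q = ptR R | in_rect (aff q)]) ->
  generic (map aff l) [::].
Proof.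
case/and3P => U /allP pairs /allP triples ends rect.
have pair e f : e \in ipath l -> f \in ipath l -> e != f -> generic_pair e f.
  by move=> he hf n; have /allP/(_ f hf) := pairs e he; rewrite (negbTE n).
have at_par e f s t : turn e f != 0 -> on_edge (affE e) s = on_edge (affE f) t ->
    s * (turn e f)%:~R = (lead e f)%:~R.
  move=> n /par_unique[|-> _]; last by rewrite par_aff // divfK // intr_eq0.
  by rewrite turn_aff mulf_neq0 // intr_eq0.
split=> //.
- by rewrite cats0 (map_inj_uniq (@aff_inj _ p u v uv)).
- by move=> w; rewrite cats0 => /mapP[q hq ->]; exact: rect.
- move=> x y s t; rewrite edges_aff => /mapP[e he ->{x}] /mapP[f hf ->{y}] n hs ht meet.
  have nef : e != f by apply: contra n => /eqP->.
  have /andP[nt ok] := pair e f he hf nef.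
  have nt' : turn f e != 0 by rewrite turn_swap oppr_eq0.
  have Es := at_par e f s t nt meet; have Et := at_par f e t s nt' (esym meet).
  have unit x y r : turn x y != 0 -> 0 <= r <= 1 -> r * (turn x y)%:~R = (lead x y)%:~R :> R ->
      in_unit x y.
    move=> nxy /andP[r0 r1] Er; rewrite /in_unit expr2 -!(ler_int R) !intrM -Er.
    have p2 : 0 <= ((turn x y)%:~R * (turn x y)%:~R : R) by rewrite -expr2 sqr_ge0.
    rewrite -mulrA mulr_ge0 //=.
    by rewrite -[leRHS]mul1r ler_wpM2r.
  have cancel x y (r c : R) : turn x y != 0 -> r * (turn x y)%:~R = c * (turn x y)%:~R -> r = c.
    by move=> nxy; apply: mulIf; rewrite intr_eq0.
  case/or4P: ok => [x|/negP[]|/negP[]|/orP[]/andP[/eqP l1 /eqP l2]].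
  + constructor 1; move: x; rewrite -(xing_aff p uv) => {}x.
    have [h1 h2 _] := xing_meet x; have n2 := xing_turn x.
    by have [-> ->] := par_unique n2 meet.
  + exact: unit hs Es.
  + exact: unit ht Et.
  + constructor 2; split; first by apply: (cancel e f); rewrite // mul1r Es l1.
    by apply: (cancel f e); rewrite // mul0r Et l2.
  + constructor 3; split; first by apply: (cancel e f); rewrite // mul0r Es l1.
    by apply: (cancel f e); rewrite // mul1r Et l2.
- move=> x y z s t w; rewrite edges_aff.
  move=> /mapP[e' he ->{x}] /mapP[f' hf ->{y}] /mapP[g' hg ->{z}].
  move=> U3 _ _ _ [m1 m2].
  have U3' : uniq [:: f'; e'; g'].
    move: U3; rewrite /= !inE !negb_or !(inj_eq (@affE_inj)) andbT => /andP[/andP[n1 n2] n3].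
    by rewrite eq_sym n1 n3 n2.
  have /andP[/norP[nfe nfg] _] : ~~ ((f' == e') || (f' == g')) && (e' \notin [:: g']).
    by move: U3'; rewrite /= !inE andbT.
  have /andP[t1 _] := pair _ _ hf he nfe; have /andP[t2 _] := pair _ _ hf hg nfg.
  have E1 := at_par _ _ _ _ t1 (esym m1); have E2 := at_par _ _ _ _ t2 m2.
  have /allP/(_ _ he)/allP/(_ _ hg) := triples _ hf.
  rewrite U3' /= => /eqP; apply; apply: (@intr_inj R).
  by rewrite !intrM -E1 -E2; ring.
Qed.
End Chart.

(** A part of a diagram drawn by a chart, with no crossings with the rest: if
    potentials start with integer values there, they have the integer values
    computed on the model. *)
Section Block.
Variables (p u v : pt) (l : seq ipt) (D : diagram) (E0 : seq edge).
Variable m : iedge -> iedge -> marking.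
Hypothesis uv : 0 < det u v.
Notation aff := (aff p u v).
Notation affE := (affE p u v).
Notation S := (ipath l).
Hypothesis P : perm_eq (edges D) (E0 ++ map affE S).
Hypothesis nox : forall e g, e \in S -> g \in E0 -> ~~ xing (affE e) g.
Hypothesis mm : forall e g, e \in S -> g \in S -> mark D (affE e) (affE g) = m e g.

Let uv0 : det u v != 0. Proof. by rewrite gt_eqF. Qed.

Lemma sgn_block e g : sgn (affE e) (affE g) = (sgn e g)%:~R.
Proof. by rewrite sgn_aff // gtr0_sg // mul1r. Qed.

Definition lifts (F : pt -> R) (f : ipt -> int) := forall q, q \in l -> F (aff q) = (f q)%:~R.

Lemma ipath_mem e : e \in S -> e.1 \in l /\ e.2 \in l.
Proof. by move=> /mem_zip_pair[h1 h2]; split=> //; exact: mem_behead. Qed.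

Lemma level_lift (F : pt -> R) f (z : edge -> edge -> R) (y : iedge -> iedge -> int) e h :
  lifts F f -> (forall g, g \in S -> xing e g -> z (affE e) (affE g) = (y e g)%:~R) ->
  e \in S -> level (edges D) z F (affE e) (affE h) = (level S y f e h)%:~R.
Proof.
move=> Ff zy he; rewrite (level_block uv0 P nox) // /level intrD Ff; last by case: (ipath_mem he).
rewrite rmorph_sum big_filter /=; congr (_ + _).
rewrite big_seq_cond [RHS]big_seq_cond; apply: eq_bigr => g /and3P[hg x _]; exact: zy.
Qed.

Lemma rise_lift (z : edge -> edge -> R) (y : iedge -> iedge -> int) e :
  (forall g, g \in S -> xing e g -> z (affE e) (affE g) = (y e g)%:~R) ->
  e \in S -> rise (edges D) z (affE e) = (rise S y e)%:~R.
Proof.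
move=> zy he; rewrite (rise_block uv0 P nox) // /rise rmorph_sum big_filter /=.
rewrite big_seq_cond [RHS]big_seq_cond; apply: eq_bigr => g /andP[hg x]; exact: zy.
Qed.

(** Both sides satisfy the same recursion along the path. *)
Lemma pot_lift (F : pt -> R) f (z : edge -> edge -> R) (y : iedge -> iedge -> int) :
  pot (edges D) (rise (edges D) z) F -> pot S (rise S y) f ->
  (forall e g, e \in S -> g \in S -> xing e g -> z (affE e) (affE g) = (y e g)%:~R) ->
  F (aff (head (0, 0) l)) = (f (head (0, 0) l))%:~R -> lifts F f.
Proof.
move=> pF pf zy.
have stp e : e \in S -> F (aff e.1) = (f e.1)%:~R -> F (aff e.2) = (f e.2)%:~R.
  move=> he E; rewrite (pf e he) intrD -E -(rise_lift (z := z)) //; last by move=> g; exact: zy.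
  by apply: (pF (affE e)); rewrite (perm_mem P) mem_cat map_f ?orbT.
rewrite /lifts; case: l stp => [_ _ q|a s stp /= Fa q] //; rewrite /ipath /= in stp.
elim: s a Fa stp => [|b s IH] a Fa stp; first by rewrite inE => /eqP->.
rewrite inE => /orP[/eqP->|hq] //.
apply: (IH b) => //; first by apply: (stp (a, b)) => //; rewrite inE eqxx.
by move=> e he; apply: stp; rewrite inE he orbT.
Qed.

Lemma jumpK_lift e g : e \in S -> g \in S ->
  jumpK (mark D) (affE e) (affE g) = (jumpK m e g)%:~R.
Proof. by move=> he hg; rewrite /jumpK mm // sgn_block; case: (m e g). Qed.

Variables (K : pt -> R) (k : ipt -> int).
Hypothesis Kk : lifts K k.

Lemma relidx_lift e g : e \in S -> g \in S ->
  relidx (edges D) (mark D) K (affE e) (affE g) = (relidx S m k e g)%:~R.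
Proof.
move=> he hg; rewrite /relidx sgn_block !intrB.
by congr (_ - _ - _); apply: level_lift => // h hh _; exact: jumpK_lift.
Qed.

Lemma jumpA_lift (j : int) e g : e \in S -> g \in S ->
  jumpA (edges D) (mark D) j%:~R K (affE e) (affE g) = (jumpA S m j k e g)%:~R.
Proof.
move=> he hg; rewrite /jumpA mm // relidx_lift // sgn_block eqr_int.
by case: (m e g) => //; case: ifP.
Qed.

Variables (A B : pt -> R) (a b : ipt -> int).
Hypothesis Aa : lifts A a.
Hypothesis Bb : lifts B b.

Lemma jumpC_lift e g : e \in S -> g \in S ->
  jumpC (edges D) (mark D) K A B (affE e) (affE g) = (jumpC S m k a b e g)%:~R.
Proof.
move=> he hg; rewrite /jumpC mm // relidx_lift // sgn_block.
have E (j : int) F f x y : lifts F f -> x \in S -> y \in S ->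
    levelA (edges D) (mark D) j%:~R K F (affE x) (affE y) = (levelA S m j k f x y)%:~R.
  by move=> Ff hx hy; apply: level_lift => // h hh _; exact: jumpA_lift.
have E1 := E 1; have E2 := E (-1); rewrite mulr1z mulrN1z in E1 E2.
rewrite !(E1 A a) // (E2 B b) //.
have c2 (x : int) : (x%:~R == 2%:R :> R) = (x == 2%:R) by rewrite -(@eqr_int R).
have c1 (x : int) : (x%:~R == 1 :> R) = (x == 1) by rewrite -(@eqr_int R).
rewrite c1 c2; case: (m e g) => //.
move: (levelA S m 1 k a e g) (levelA S m (-1) k b g e) (levelA S m 1 k a g e) => x y z.
by rewrite intrM intrD; case: ifP => _; case: ifP => _; rewrite ?intrB.
Qed.

Lemma sumC_lift : \sum_(e <- map affE S) tC D K A B e = (sumC S m k a b)%:~R.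
Proof.
rewrite big_map /sumC rmorph_sum big_seq [RHS]big_seq /=; apply: eq_bigr => e he.
by apply: rise_lift => // g hg _; exact: jumpC_lift.
Qed.
End Block.

(** The integers [k], [a] and [b] are the levels at the corners, and [c] is the
    contribution of the picture to the invariant. *)
Definition reading (l : seq ipt) (m : iedge -> iedge -> marking) (k a b : ipt -> int)
    (c : int) : Prop :=
  [/\ pot (ipath l) (riseK (ipath l) m) k, pot (ipath l) (riseA (ipath l) m 1 k) a,
      pot (ipath l) (riseA (ipath l) m (-1) k) b & sumC (ipath l) m k a b = c].

Lemma block_reading (p u v : pt) l (D : diagram) E0 m k a b c K A B :
  0 < det u v ->
  perm_eq (edges D) (E0 ++ map (affE p u v) (ipath l)) ->
  (forall e g, e \in ipath l -> g \in E0 -> ~~ xing (affE p u v e) g) ->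
  (forall e g, e \in ipath l -> g \in ipath l ->
     mark D (affE p u v e) (affE p u v g) = m e g) ->
  reading l m k a b c -> potK D K -> potA D 1 K A -> potA D (-1) K B ->
  let h := head (0, 0) l in
  K (aff p u v h) = (k h)%:~R -> A (aff p u v h) = (a h)%:~R ->
  B (aff p u v h) = (b h)%:~R ->
  [/\ lifts p u v l K k, lifts p u v l A a, lifts p u v l B b &
      \sum_(e <- map (affE p u v) (ipath l)) tC D K A B e = c%:~R].
Proof.
move=> uv P nox mm [pk pa pb <-] pK pA pB h hK hA hB.
have Kk : lifts p u v l K k.
  by apply: (pot_lift uv P nox pK pk) => // e g he hg _; exact: (jumpK_lift uv mm).
have Aa : lifts p u v l A a.
  apply: (pot_lift uv P nox pA pa) => // e g he hg _.
  by have := jumpA_lift uv P nox mm Kk 1 he hg; rewrite mulr1z.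
have Bb : lifts p u v l B b.
  apply: (pot_lift uv P nox pB pb) => // e g he hg _.
  by have := jumpA_lift uv P nox mm Kk (-1) he hg; rewrite mulrN1z.
by split=> //; exact: (sumC_lift uv P nox mm Kk Aa Bb).
Qed.

End Polygons.

(** * Two long knots that do not commute *)

Section Knots.
Variable R : realType.
Notation pt := (R * R)%type.
Notation edge := (pt * pt)%type.
Notation diagram := (diagram R).
Notation ipt := (int * int)%type.
Notation iedge := (ipt * ipt)%type.

(** A polygon with five crossings. With its sides numbered from 0, side 0 crosses
    sides 3 and 4, side 1 crosses sides 3 and 4, and side 2 crosses side 4. *)
Definition corners : seq ipt :=
  [:: (0, 0); (5, 3); (5, 0); (6, 2); (3, 2); (8, 0)].
Definition sides : seq iedge := ipath corners.

Lemma corners_generic : generic_ipath corners.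
Proof. by vm_compute. Qed.

Definition symmetrized (w : nat -> nat -> marking) (i j : nat) : marking :=
  if (i < j)%N then w i j else flip (w j i).
Definition smark w (e g : iedge) := symmetrized w (index e sides) (index g sides).

Lemma symmetrizedC w i j : i != j -> symmetrized w j i = flip (symmetrized w i j).
Proof.
by rewrite /symmetrized; case: ltngtP => // _ _; case: (w _ _).
Qed.

Definition chart_at (x h : R) (q : ipt) : pt := aff (x, 1) (h, 0) (0, 4^-1) q.
(** The chart maps the segment from [(0, 0)] to [(8, 0)] to one at height 1 that
    starts at abscissa [x] and has length [8 * h]; height 4 of the picture is
    height 1 of the rectangle. *)
Definition edge_at (x h : R) (e : iedge) : edge := affE (x, 1) (h, 0) (0, 4^-1) e.

Lemma chart_at_det (h : R) : 0 < h -> 0 < det ((h, 0) : pt) (0, 4^-1).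
Proof. by rewrite /det /= => h0; rewrite mulr0 subr0 mulr_gt0 ?invr_gt0 ?ltr0n. Qed.

Definition knot_of (w : nat -> nat -> marking) : diagram :=
  Diagram (map (chart_at 0 8^-1) corners) [::]
    (fun e f => symmetrized w (index e (map (edge_at 0 8^-1) sides))
                              (index f (map (edge_at 0 8^-1) sides))).

Let det8 : 0 < det ((8^-1, 0) : pt) (0, 4^-1).
Proof. by apply: chart_at_det; lra. Qed.

Lemma knot_edges w : edges (knot_of w) = map (edge_at 0 8^-1) sides.
Proof. exact: edges_aff. Qed.

Lemma knot_mark w e g : mark (knot_of w) (edge_at 0 8^-1 e) (edge_at 0 8^-1 g) = smark w e g.
Proof.
by congr symmetrized; apply: index_map; apply: affE_inj; exact: lt0r_neq0.
Qed.

Lemma knot_wf w : wf (knot_of w).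
Proof.
split.
  apply: generic_aff; first exact: lt0r_neq0.
  - exact: corners_generic.
  - exists (map (chart_at 0 8^-1) [:: (5, 3); (5, 0); (6, 2); (3, 2)]).
    by rewrite /= /chart_at /aff /= /ptL /ptR; congr [:: _, _, _, _, _ & [:: _]]; congr pair; field.
  - move=> q; rewrite !inE => /or4P[/eqP->|/eqP->|/eqP->|/or3P[/eqP->|/eqP->|/eqP->]].
    + by constructor 1; rewrite /aff /ptL /=; congr pair; field.
    + by constructor 3; rewrite /in_rect /aff /=; split; apply/andP; split; lra.
    + by constructor 3; rewrite /in_rect /aff /=; split; apply/andP; split; lra.
    + by constructor 3; rewrite /in_rect /aff /=; split; apply/andP; split; lra.
    + by constructor 3; rewrite /in_rect /aff /=; split; apply/andP; split; lra.
    + by constructor 2; rewrite /aff /ptR /=; congr pair; field.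
move=> e f; rewrite knot_edges => he hf [nef _]; apply: symmetrizedC.
apply: contra nef; move: he hf; move: (map _ sides) => s he hf /eqP E.
by rewrite -(nth_index e he) -(nth_index e hf) E.
Qed.

Lemma squeeze_at c h e :
  mapE (squeeze c) (edge_at 0 h e) = edge_at c (h / 2) e.
Proof. by rewrite /mapE /edge_at /affE /aff /squeeze /=; congr pair; congr pair; field. Qed.

Let det16 : 0 < det ((8^-1 / 2, 0) : pt) (0, 4^-1).
Proof. by apply: chart_at_det; lra. Qed.

Section Concat.
Variables w w' : nat -> nat -> marking.
Let X := knot_of w.
Let Y := knot_of w'.
Let D := concat X Y.
Notation left_part := (map (edge_at 0 (8^-1 / 2)) sides).
Notation right_part := (map (edge_at 2^-1 (8^-1 / 2)) sides).

(** Each factor, squeezed to half its width, is again the image of the polygon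
    under a chart. *)
Lemma concat_parts : perm_eq (edges D) (left_part ++ right_part).
Proof.
have := edges_concat (wf_gen (knot_wf w)) (wf_gen (knot_wf w')).
rewrite -/(edges X) -/(edges Y) !knot_edges -!map_comp.
rewrite (eq_map (g := edge_at 0 (8^-1 / 2))); last by move=> e /=; rewrite squeeze_at.
by rewrite (eq_map (f := mapE _ \o _) (g := edge_at 2^-1 (8^-1 / 2))) // => e /=; rewrite squeeze_at.
Qed.

Lemma parts_nox e g : e \in left_part -> g \in right_part -> ~~ xing e g /\ ~~ xing g e.
Proof.
move=> /mapP[e' he ->] /mapP[g' hg ->]; rewrite -!squeeze_at.
have hX : edge_at 0 8^-1 e' \in edges X by rewrite knot_edges map_f.
have hY : edge_at 0 8^-1 g' \in edges Y by rewrite knot_edges map_f.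
have [n1 n2] := nocross_concat (wf_gen (knot_wf w)) (wf_gen (knot_wf w')) hX hY.
by split; apply/negP => /xing_cross.
Qed.

(** The levels at the end of the first factor are those at the start of the second. *)
Lemma concat_reading k a b c k' a' b' c' K A B :
  reading corners (smark w) k a b c -> reading corners (smark w') k' a' b' c' ->
  k (0, 0) = 0 -> a (0, 0) = 0 -> b (0, 0) = 0 ->
  k' (0, 0) = k (8, 0) -> a' (0, 0) = a (8, 0) -> b' (0, 0) = b (8, 0) ->
  potK D K -> potA D 1 K A -> potA D (-1) K B ->
  K (ptL R) = 0 -> A (ptL R) = 0 -> B (ptL R) = 0 ->
  sC D K A B = (c + c')%:~R.
Proof.
move=> rd rd' k0 a0 b0 kk aa bb pK pA pB K0 A0 B0.
have EL : aff (0, 1) (8^-1 / 2, 0) (0, 4^-1) (0, 0) = ptL R.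
  by rewrite /aff /ptL /=; congr pair; field.
have ER : aff (2^-1, 1) (8^-1 / 2, 0) (0, 4^-1) (0, 0) =
    aff (0, 1) (8^-1 / 2, 0) (0, 4^-1) (8, 0) :> pt.
  by rewrite /aff /=; congr pair; field.
have P := concat_parts.
have P' : perm_eq (edges D) (right_part ++ left_part).
  by apply: perm_trans P _; rewrite perm_catC.
have noxL e g : e \in sides -> g \in right_part -> ~~ xing (edge_at 0 (8^-1 / 2) e) g.
  by move=> he hg; case: (parts_nox (map_f _ he) hg).
have noxR e g : e \in sides -> g \in left_part -> ~~ xing (edge_at 2^-1 (8^-1 / 2) e) g.
  by move=> he hg; case: (parts_nox hg (map_f _ he)).
have mL e g : e \in sides -> g \in sides ->
    mark D (edge_at 0 (8^-1 / 2) e) (edge_at 0 (8^-1 / 2) g) = smark w e g.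
  move=> he hg; rewrite -!squeeze_at mark_left ?knot_mark //; first exact: knot_wf.
  by rewrite knot_edges map_f.
have mR e g : e \in sides -> g \in sides ->
    mark D (edge_at 2^-1 (8^-1 / 2) e) (edge_at 2^-1 (8^-1 / 2) g) = smark w' e g.
  move=> he hg; rewrite -!squeeze_at mark_right ?mapEK ?knot_mark //; first exact: knot_wf.
  by rewrite knot_edges map_f.
have eqL F (f : ipt -> int) : F (ptL R) = 0 -> f (0, 0) = 0 ->
    F (aff (0, 1) (8^-1 / 2, 0) (0, 4^-1) (0, 0)) = (f (0, 0))%:~R :> R.
  by move=> F0 ->; rewrite EL F0.
have [lK lA lB SL] := block_reading det16 P' noxL mL rd pK pA pB
  (eqL K k K0 k0) (eqL A a A0 a0) (eqL B b B0 b0).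
have top : ((8, 0) : ipt) \in corners by rewrite !inE eqxx !orbT.
have eqR F (f f' : ipt -> int) : lifts (0, 1) (8^-1 / 2, 0) (0, 4^-1) corners F f ->
    f' (0, 0) = f (8, 0) ->
    F (aff (2^-1, 1) (8^-1 / 2, 0) (0, 4^-1) (0, 0)) = (f' (0, 0))%:~R :> R.
  by move=> lF ->; rewrite ER lF.
have [_ _ _ SR] := block_reading det16 P noxR mR rd' pK pA pB
  (eqR _ _ _ lK kk) (eqR _ _ _ lA aa) (eqR _ _ _ lB bb).
by rewrite /sC /sumC (perm_big _ P) big_cat /= intrD; congr (_ + _).
Qed.

End Concat.

(** Sides 4 and 1 cross with index 2, side 4 passing under; no crossing has index 1
    or -1. *)
Definition marks_a (i j : nat) : marking :=
  match i, j with 0, 3 => Over | 1, 4 => Over | 2, 4 => Under | _, _ => Virtual end%N.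
(** Two crossings of index -1, where sides 3 and 4 pass under, raise the level [B]
    by 2; there are none of index 1 or 2. *)
Definition marks_b (i j : nat) : marking :=
  match i, j with 0, 4 | 1, 3 | 1, 4 => Over | _, _ => Virtual end%N.

Definition at_corners (s : seq int) (q : ipt) : int := nth 0 s (index q corners).

Lemma potP (t : iedge -> int) (f : ipt -> int) :
  all (fun e => f e.2 == f e.1 + t e) sides -> pot sides t f.
Proof. by move=> /allP H e /H/eqP. Qed.

(** The crossing of index 2 is negative and the level [A] is 0, so that its
    contribution is the level [B] of side 1, which is the initial one. *)
Lemma reading_a (c : int) : c \in [:: 0; 2] ->
  reading corners (smark marks_a) (at_corners [:: 0; 1; 2; 1; 0; 0])
    (at_corners (nseq 6 0)) (at_corners (nseq 6 c)) c.
Proof.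
rewrite !inE => /orP[]/eqP->; split; try apply: potP.
all: rewrite /riseK /riseA /sumC /riseC /jumpC /levelA /jumpA /relidx /rise /level !bigop.unlock.
all: by vm_compute.
Qed.

Lemma reading_b :
  reading corners (smark marks_b) (at_corners [:: 0; -1; -1; -1; 0; 0])
    (at_corners (nseq 6 0)) (at_corners [:: 0; 0; 0; 0; 1; 2]) 0.
Proof.
split; try apply: potP.
all: rewrite /riseK /riseA /sumC /riseC /jumpC /levelA /jumpA /relidx /rise /level !bigop.unlock.
all: by vm_compute.
Qed.

End Knots.

Theorem theorem7p4p1 (R : realType) :
  ~ (forall a b : VC R, VC_mul a b = VC_mul b a).
Proof.
pose X : long_knot R := exist _ (knot_of R marks_a) (conj (knot_wf R marks_a) erefl).
pose Y : long_knot R := exist _ (knot_of R marks_b) (conj (knot_wf R marks_b) erefl).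
move=> /(_ (\pi_(VC R) X)%qT (\pi_(VC R) Y)%qT); rewrite -!pi_VC_mul.
move=> /(@eqmodP _ (conc_equiv R))/asboolP H.
have [K [A [B [K' [A' [B' [[pK pA pB] [pK' pA' pB'] [K0 A0 B0] [K0' A0' B0']]]]]]]] :=
  concordance_invariance H erefl erefl.
rewrite (concat_reading (reading_a (c := 0) erefl) reading_b erefl erefl erefl
  erefl erefl erefl pK pA pB K0 A0 B0).
rewrite (concat_reading reading_b (reading_a (c := 2) erefl) erefl erefl erefl
  erefl erefl erefl pK' pA' pB' K0' A0' B0').
by move/eqP; rewrite eqr_int.
Qed.
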